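(* Let $N\in\mathbb N$ and assume $1<q<\frac N2$, $1<p<q^*$, $p\ne q$, $q\ne p^*$. Let $p<\sigma<2q$ and $r_\sigma:=\frac{pq+\sigma(q-p)}{2q-p}$. Then $r_\sigma\ge1$ and $r_\sigma\in(p^*_\sigma,q^{**}_\sigma)$. In particular, the embedding $\mathcal W\hookrightarrow L^{r_\sigma}_\sigma(\mathbb R^N)$ is compact.
   Context: $p^*=\frac{Np}{N-p}$, $q^*=\frac{Nq}{N-q}$, $q^{**}=\frac{Nq}{N-2q}$, $p^*_\sigma=\frac{p(N-\sigma)}{N-p}$, $q^{**}_\sigma=\frac{q(N-\sigma)}{N-2q}$. $D^{1,p}(\mathbb R^N)=\{u\in L^{p^*}(\mathbb R^N):|\nabla u|\in L^p(\mathbb R^N)\}$, $D^{2,q}(\mathbb R^N)=\{u\in L^{q^{**}}(\mathbb R^N):|D^2u|\in L^q(\mathbb R^N)\}$, and $\mathcal W=D^{1,p}(\mathbb R^N)\cap D^{2,q}(\mathbb R^N)$ with norm $\|u\|=\|\nabla u\|_p+\|\Delta u\|_q$. $L^r_\sigma(\mathbb R^N)$ is the weighted Lebesgue space of measurable $u$ with norm $\big(\int_{\mathbb R^N}|u|^r|x|^{-\sigma}dx\big)^{1/r}<\infty$. *)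

(* Defs.v *)
From HB Require Import structures.
From mathcomp Require Import all_boot all_order all_algebra.
From mathcomp Require Import all_classical all_reals all_analysis.

Set Implicit Arguments.
Unset Strict Implicit.
Unset Printing Implicit Defensive.
Import Order.TTheory GRing.Theory Num.Theory.
Import numFieldNormedType.Exports.

Local Open Scope classical_set_scope.
Local Open Scope ring_scope.

Section measurable_rV.
Context d (T : measurableType d) (n : nat).

Let coord (i : 'I_n) (v : 'rV[T]_n) : T := v ord0 i.

Let rV_set0 : g_sigma_preimage coord set0.
Proof. exact: sigma_algebra0. Qed.

Let rV_setC A : g_sigma_preimage coord A -> g_sigma_preimage coord (~` A).
Proof. exact: sigma_algebraC. Qed.

Let rV_bigcup (F : _^nat) : (forall i, g_sigma_preimage coord (F i)) ->
  g_sigma_preimage coord (\bigcup_i (F i)).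
Proof. exact: sigma_algebra_bigcup. Qed.

(* The product sigma-algebra; for [T] the reals with their Borel sigma-algebra,
   this is the Borel sigma-algebra of [R^n]. *)
HB.instance Definition _ := @isMeasurable.Build (measure_tuple_display d)
  'rV[T]_n (g_sigma_preimage coord) rV_set0 rV_setC rV_bigcup.

Lemma measurable_rV_coord (i : 'I_n) :
  measurable_fun [set: 'rV[T]_n] (fun v : 'rV[T]_n => v ord0 i).
Proof.
move=> _ Y mY; rewrite setTI; apply: sub_sigma_algebra.
by rewrite (bigD1 i)//=; left; exists Y => //; rewrite setTI.
Qed.

Lemma measurable_fun_rV d' (S : measurableType d') (f : S -> 'rV[T]_n) :
  (forall i, measurable_fun setT (fun x => f x ord0 i)) ->
  measurable_fun setT f.
Proof.
move=> mf; apply: (@measurability _ _ _ _ _ _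
  (\big[setU/set0]_(i < n) preimage_set_system setT (coord i) measurable)) => //.
move=> _ [B + <-].
elim/big_ind : _ => [//|P Q IP IQ [/IP//|/IQ//]|i _ [C mC <-]].
rewrite [X in _ `&` (_ @^-1` X)]setTI -comp_preimage.
exact: mf.
Qed.

End measurable_rV.

Section lebesgue_measure_rV.
Context (R : realType).

Definition rV_cons n (xv : measurableTypeR R * 'rV[R]_n) : 'rV[R]_n.+1 :=
  \row_i (if unlift ord0 i is Some j then xv.2 ord0 j else xv.1).

Definition rV_uncons n (v : 'rV[R]_n.+1) : measurableTypeR R * 'rV[R]_n :=
  (v ord0 ord0, \row_j v ord0 (lift ord0 j)).

Lemma rV_consK n : cancel (@rV_cons n) (@rV_uncons n).
Proof.
move=> [x v]; rewrite /rV_uncons /rV_cons !mxE unlift_none; congr pair.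
by apply/rowP => j; rewrite !mxE liftK.
Qed.

Lemma measurable_rV_cons n : measurable_fun setT (@rV_cons n).
Proof.
apply: measurable_fun_rV => i; rewrite /rV_cons.
case: (unliftP ord0 i) => [j ->|->].
  rewrite (_ : (fun _ => _) = (fun v : 'rV[R]_n => v ord0 j) \o snd).
    exact: measurableT_comp (@measurable_rV_coord _ _ _ _) measurable_snd.
  by apply/funext => xv /=; rewrite mxE liftK.
rewrite (_ : (fun _ => _) = fst) //.
by apply/funext => xv /=; rewrite mxE unlift_none.
Qed.

Lemma measurable_rV_uncons n : measurable_fun setT (@rV_uncons n).
Proof.
apply/measurable_fun_pairP; split; first exact: measurable_rV_coord.
apply: measurable_fun_rV => i /=.
rewrite (_ : (fun _ => _) = (fun v : 'rV[R]_n.+1 => v ord0 (lift ord0 i))).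
  exact: measurable_rV_coord.
by apply/funext => v /=; rewrite mxE.
Qed.

Definition cons_measure n (mu : {sigma_finite_measure set 'rV[R]_n -> \bar R}) :
    set 'rV[R]_n.+1 -> \bar R :=
  pushforward (lebesgue_measure \x mu)%E (@rV_cons n).


Section cons_measure_structure.
Local Open Scope ereal_scope.
Context n (mu : {sigma_finite_measure set 'rV[R]_n -> \bar R}).

Let mpre (A : set 'rV[R]_n.+1) : measurable A -> measurable (@rV_cons n @^-1` A).
Proof. by move=> mA; rewrite -[X in measurable X]setTI; exact: measurable_rV_cons. Qed.

Let cons_measure0 : cons_measure mu set0 = 0.
Proof. by rewrite /cons_measure /pushforward preimage_set0 measure0. Qed.

Let cons_measure_ge0 A : 0 <= cons_measure mu A.
Proof. by rewrite /cons_measure /pushforward; exact: measure_ge0. Qed.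

Let cons_measure_sigma_additive : semi_sigma_additive (cons_measure mu).
Proof.
move=> F mF tF mUF; rewrite /cons_measure /pushforward preimage_bigcup.
apply: measure_semi_sigma_additive.
- by move=> k; exact: mpre.
- apply/trivIsetP => /= i j _ _ ij; rewrite -preimage_setI.
  by move/trivIsetP : tF => /(_ _ _ _ _ ij) ->//; rewrite preimage_set0.
- by rewrite -preimage_bigcup; exact: mpre.
Qed.

HB.instance Definition _ := isMeasure.Build _ _ _ (cons_measure mu)
  cons_measure0 cons_measure_ge0 cons_measure_sigma_additive.

Let cons_measure_sigma_finite : sigma_finite setT (cons_measure mu).
Proof.
have /sigma_finiteP[F [FT ndF Foo]] :=
  @sigma_finiteT _ _ _ [the {sigma_finite_measure set _ -> \bar R} of
    @lebesgue_measure R].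
have /sigma_finiteP[G [GT ndG Goo]] := sigma_finiteT mu.
exists (fun k => @rV_uncons n @^-1` (F k `*` G k)).
  rewrite -preimage_bigcup (_ : \bigcup_k _ = setT) ?preimage_setT//.
  apply/seteqP; split => // -[x v] _.
  have : setT x by []. have : setT v by [].
  rewrite {1}GT {1}FT => -[j _ Gv] [i _ Fx].
  exists (maxn i j) => //; split => /=.
  - by move: x Fx; exact/subsetPset/ndF/leq_maxl.
  - by move: v Gv; exact/subsetPset/ndG/leq_maxr.
move=> k; have [mF Fkoo] := Foo k; have [mG Gkoo] := Goo k; split.
  rewrite -[X in measurable X]setTI; apply: measurable_rV_uncons => //.
  exact: measurableX.
rewrite /cons_measure /pushforward -comp_preimage (_ : _ \o _ = id); last first.
  by apply/funext => xv /=; rewrite rV_consK.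
by rewrite preimage_id product_measure1E// lte_mul_pinfty// ge0_fin_numE.
Qed.

HB.instance Definition _ := Measure_isSigmaFinite.Build _ _ _ (cons_measure mu)
  cons_measure_sigma_finite.

End cons_measure_structure.

Fixpoint lebesgue_rV n : {sigma_finite_measure set 'rV[R]_n -> \bar R} :=
  if n is m.+1 then cons_measure (lebesgue_rV m) else dirac (0 : 'rV[R]_0).


Lemma lebesgue_rV_box n (a b : 'rV[R]_n) : (forall i, a ord0 i <= b ord0 i) ->
  lebesgue_rV n [set v | forall i, v ord0 i \in `[a ord0 i, b ord0 i]] =
  (\prod_(i < n) (b ord0 i - a ord0 i))%:E.
Proof.
have mbox m (c d : 'rV[R]_m) :
    measurable [set v : 'rV[R]_m | forall i, v ord0 i \in `[c ord0 i, d ord0 i]].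
  rewrite (_ : [set _ | _] = \big[setI/setT]_(i < m)
      ((fun v : 'rV[R]_m => v ord0 i) @^-1` `[c ord0 i, d ord0 i])).
    apply: big_ind => // [A B mA mB|i _]; first exact: measurableI.
    by rewrite -[X in measurable X]setTI; exact: measurable_rV_coord.
  apply/seteqP; split => v /=.
    move=> vcd; elim/big_ind : _ => // i _ /=; exact: vcd.
  by move=> + i; rewrite (bigD1 i)//= => -[].
elim: n a b => [|n IH] a b ab /=.
  rewrite big_ord0 diracE mem_set//= => -[]//.
rewrite /cons_measure /pushforward big_ord_recl /=.
pose t (c : 'rV[R]_n.+1) : 'rV[R]_n := \row_j c ord0 (lift ord0 j).
rewrite (_ : _ @^-1` _ = `[a ord0 ord0, b ord0 ord0] `*`
   [set v : 'rV[R]_n | forall i, v ord0 i \in `[t a ord0 i, t b ord0 i]]).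
  rewrite product_measure1E //; last exact: mbox.
  rewrite IH; last by move=> i; rewrite !mxE.
  rewrite EFinM; congr (_ * _)%E.
    rewrite [LHS]lebesgue_measure_itv /= lte_fin.
    case: ltP => //= ba; rewrite [b _ _](_ : _ = a ord0 ord0) ?subrr//.
    by apply/eqP; rewrite eq_le ba ab.
  by congr _%:E; apply: eq_bigr => i _; rewrite !mxE.
apply/seteqP; split => -[x v] /=.
  move=> H; split; first by have := H ord0; rewrite mxE unlift_none.
  by move=> i; have := H (lift ord0 i); rewrite !mxE liftK.
move=> [H1 H2] i; rewrite mxE; case: (unliftP ord0 i) => [j|] -> //.
by have := H2 j; rewrite !mxE.
Qed.

End lebesgue_measure_rV.

Section weak_derivatives.
Context {R : realType} {N : nat}.
Implicit Types (u g phi : 'rV[R]_N -> R) (s : seq 'I_N).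

(* The library norm on ['rV[R]_N] is the sup norm. *)
Definition enorm (v : 'rV[R]_N) : R := Num.sqrt (\sum_i v ord0 i ^+ 2).

Fixpoint partials s phi : 'rV[R]_N -> R :=
  if s is i :: s' then fun x => 'D_(delta_mx ord0 i) (partials s' phi) x else phi.

Definition smooth phi := forall s, continuous (partials s phi) /\
  forall i x, derivable (partials s phi) x (delta_mx ord0 i).

Definition test_function phi :=
  smooth phi /\ compact (closure [set x | phi x != 0]).

Definition loc_integrable u := measurable_fun setT u /\
  forall K, compact K -> (lebesgue_rV R N).-integrable K (EFin \o u).

Definition is_weak_partials s u g :=
  [/\ loc_integrable u, loc_integrable g &
   forall phi, test_function phi ->
     \int[lebesgue_rV R N]_x (u x * partials s phi x) =
     (-1) ^+ size s * \int[lebesgue_rV R N]_x (g x * phi x)].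

Definition has_weak_partials s u := exists g, is_weak_partials s u g.

(* Determined up to a null set when [has_weak_partials s u]; the zero function
   otherwise. *)
Definition weak_partials s u : 'rV[R]_N -> R :=
  xget (cst 0) [set g | is_weak_partials s u g].

Definition weak_grad u (x : 'rV[R]_N) : 'rV[R]_N :=
  \row_i weak_partials [:: i] u x.

Definition weak_hess u (x : 'rV[R]_N) : 'M[R]_N :=
  \matrix_(i, j) weak_partials [:: i; j] u x.

Definition weak_laplacian u (x : 'rV[R]_N) : R := \tr (weak_hess u x).

Definition hsnorm (A : 'M[R]_N) : R := Num.sqrt (\sum_i \sum_j A i j ^+ 2).

End weak_derivatives.

Section exponents.
Context {R : realType} (N : nat).

Definition sobolev1 (p : R) : R := N%:R * p / (N%:R - p).
Definition sobolev2 (q : R) : R := N%:R * q / (N%:R - 2 * q).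
Definition hardy_sobolev1 (sigma p : R) : R := p * (N%:R - sigma) / (N%:R - p).
Definition hardy_sobolev2 (sigma q : R) : R := q * (N%:R - sigma) / (N%:R - 2 * q).

End exponents.

Section spaces.
Context {R : realType} {N : nat}.
Implicit Types (u : 'rV[R]_N -> R) (p q r sigma : R).
Local Notation leb := (lebesgue_rV R N).

Definition D1 p : set ('rV[R]_N -> R) := [set u |
  [/\ u \in Lfun leb (sobolev1 N p)%:E, forall i, has_weak_partials [:: i] u
    & enorm \o weak_grad u \in Lfun leb p%:E]].

Definition D2 q : set ('rV[R]_N -> R) := [set u |
  [/\ u \in Lfun leb (sobolev2 N q)%:E, forall i j, has_weak_partials [:: i; j] u
    & hsnorm \o weak_hess u \in Lfun leb q%:E]].

Definition W p q : set ('rV[R]_N -> R) := D1 p `&` D2 q.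

Definition Wnorm p q u : \bar R :=
  ('N[leb]_(p%:E) [EFin \o (enorm \o weak_grad u)] +
   'N[leb]_(q%:E) [EFin \o weak_laplacian u])%E.

(* [powR] gives the weight the value [0] at the origin; this is a null set. *)
Definition wLnorm r sigma u : \bar R :=
  ((\int[leb]_x (`|u x| `^ r * enorm x `^ (- sigma))%:E) `^ r^-1)%E.

Definition wL r sigma : set ('rV[R]_N -> R) :=
  [set u | measurable_fun setT u /\ (wLnorm r sigma u < +oo)%E].

End spaces.

(* The inclusion is well defined, bounded, and maps bounded sequences to
   sequences with a convergent subsequence. Elements are functions rather than
   classes modulo null sets, so [nX] and [nY] are only seminorms. *)
Definition compact_embedding {R : realType} {T : Type}
    (X : set (T -> R)) (nX : (T -> R) -> \bar R)
    (Y : set (T -> R)) (nY : (T -> R) -> \bar R) : Prop :=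
  [/\ X `<=` Y,
      exists C : R, forall u, X u -> (nY u <= C%:E * nX u)%E
    & forall u_ : nat -> (T -> R), (forall n, X (u_ n)) ->
        (exists M : R, forall n, (nX (u_ n) <= M%:E)%E) ->
        exists k : nat -> nat, {homo k : m n / (m < n)%N} /\
        exists2 v, Y v & nY (u_ (k n) \- v) @[n --> \oo] --> 0%E].

(* Main.v *)
(** Every function in a bounded subset of [W] is approximated by its mollifications, for which
    integration by parts against regularized powers of the distance yields the weighted Hardy and
    Rellich inequalities; Hardy's inequality centred at [x] moreover gives a weak form of the
    Sobolev bound. Consider the ratio [Y = |u|^(q-p) |x|^(p-2q)] of the two Hardy integrands. The
    target integrand [|u|^r |x|^-sigma] interpolates between them, so its integral over the region
    where [Y] is close to [0] or to infinity is uniformly small, while elsewhere [|u|] and [|x|]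
    determine each other up to constants and a layer-cake argument with the weak Sobolev bound
    controls the tails in [|u|]. Compactness follows: mollifications at a fixed scale are
    equi-Lipschitz, so a subsequence converges at every scale, the limits form a rapidly Cauchy
    sequence in [L^p], and the uniform tail estimates upgrade local [L^p] convergence to
    convergence in the weighted space. *)

Require Import Defs.
From mathcomp Require Import all_boot all_order all_algebra.
From mathcomp Require Import all_classical all_reals all_analysis.
From mathcomp Require Import measurable_realfun ring lra.
Import Order.TTheory GRing.Theory Num.Theory.
Import numFieldNormedType.Exports.
Set Implicit Arguments.
Unset Strict Implicit.
Unset Printing Implicit Defensive.
Local Open Scope classical_set_scope.
Local Open Scope ring_scope.

(** Three regularizations make the vector fields smooth and compactly supported: [(v^2 + k)^b]
    replaces [|v|^(2b)], which is not smooth enough for small exponents, [del + |x - y|^2] replaces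
    the squared distance, and a cutoff in this weight at [rho] truncates. The cutoff error is
    handled qualitatively: [k] is tied to [rho], and the error vanishes as [rho] grows because the
    critical power of [|v|] is integrable. In Rellich's inequality convexity of the regularized
    power discards the gradient term, so the Laplacian alone appears. A weak Sobolev bound suffices
    because the power [pq/(2q-p)] of [|u|] that has to be controlled lies strictly below
    [sobolev1 N p]; this is the condition [p < sobolev1 N q] in the form [N (p - q) < p q]. The same
    inequality makes [|x|^(pq/(q-p))] integrable at infinity when [q < p]. That the mollifications
    converge to [u] itself, and not just to some limit, is a separate point, settled by testing
    against bumps. *)

(** * Borel sets in the product sigma-algebra *)

Section borel_rV.
Context {R : realType} {n : nat}.
Implicit Types (A : set 'rV[R]_n) (f : 'rV[R]_n -> R).

Lemma measurable_rV_forall (P : 'I_n -> set R) : (forall i, measurable (P i)) ->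
  measurable [set v : 'rV[R]_n | forall i, P i (v ord0 i)].
Proof.
move=> mP; rewrite (_ : [set _ | _] = \big[setI/setT]_(i < n)
    ((fun v : 'rV[R]_n => v ord0 i) @^-1` P i)).
  apply: big_ind => // [A B mA mB|i _]; first exact: measurableI.
  by rewrite -[X in measurable X]setTI; exact: measurable_rV_coord.
apply/seteqP; split => v /=.
  move=> vcd; elim/big_ind : _ => // i _ /=; exact: vcd.
by move=> + i; rewrite (bigD1 i)//= => -[].
Qed.

(** The norm is the sup norm, so its balls are boxes with measurable sides. An open set is the
    countable union of the boxes with rational centre and radius [1/(k+1)] that it contains. *)
Lemma open_measurable_rV A : open A -> measurable A.
Proof.
move=> oA.
pose B (ck : 'rV[rat]_n * nat) : set 'rV[R]_n :=
  [set v | forall i, ball (ratr (ck.1 ord0 i) : R) (ck.2.+1%:R^-1) (v ord0 i)].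
rewrite (_ : A = \bigcup_ck (if `[< B ck `<=` A >] then B ck else set0)).
  apply: (@countable_bigcupT_measurable _ _ ('rV[rat]_n * nat)%type).
    exact: (@countableP ('rV[rat]_n * nat)%type).
  move=> ck; case: ifP => // _.
  apply: (@measurable_rV_forall (fun i => ball (ratr (ck.1 ord0 i) : R) ck.2.+1%:R^-1)).
  by move=> i; apply: open_measurable; exact: ball_open.
apply/seteqP; split => [v Av|v [ck _]]; last first.
  by case: asboolP => [BA /BA|_ []].
have /nbhs_ballP[e /= e0 veA] : nbhs v A by exact: open_nbhs_nbhs.
(* A box of radius [d] containing [v] lies in the ball of radius [2 * d] around [v], hence the
   margin [2 * d < e]. *)
have [k [d [dE d0 de]]] : exists k (d : R), [/\ d = k.+1%:R^-1, 0 < d & 2 * d < e].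
  have e20 : 0 < e / 2 by rewrite divr_gt0.
  have [k] := ltr_add_invr e20; rewrite add0r => ke; exists k, k.+1%:R^-1.
  by rewrite invr_gt0 mulrC -ltr_pdivlMr.
have /all_sig[c cP] : forall i, {c : rat | `|v ord0 i - ratr c| < d}.
  move=> i; apply: cid.
  have : v ord0 i - d < v ord0 i + d by lra.
  move=> /rat_in_itvoo[r]; rewrite in_itv/= => /andP[r1 r2]; exists r.
  by rewrite ltr_norml; apply/andP; split; lra.
exists (\row_i c i, k) => //; case: asboolP => [_ i|] /=.
  by rewrite mxE /ball/= -dE distrC.
  move=> nBA; exfalso; apply: nBA => w /= Bw; apply: veA; split => // a i; rewrite ord1.
have := Bw i; rewrite mxE /ball /= -dE => h.
apply: le_lt_trans (_ : `|v ord0 i - ratr (c i)| + `|ratr (c i) - w ord0 i| < _).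
  exact: ler_distD.
by have := cP i; lra.
Qed.

Lemma continuous_measurable_rV f : continuous f -> measurable_fun setT f.
Proof.
move=> /continuousP cf; apply: (measurability (@RGenOpens.G R)).
  by exact: (RGenOpens.measurableE R).
move=> _ [_ [a [b ->] <-]]; rewrite setTI; apply: open_measurable_rV.
by apply: cf; exact: interval_open.
Qed.

Lemma compact_measurable_rV A : compact A -> measurable A.
Proof.
move=> cA; rewrite -(setCK A); apply: measurableC; apply: open_measurable_rV.
by apply: closed_openC; apply: compact_closed => //; exact: norm_hausdorff.
Qed.

End borel_rV.

(** * Translation invariance of Lebesgue measure *)

Section translation.
Context {R : realType}.

Lemma lebesgue_measure_shift (a : R) (A : set R) : measurable A ->
  lebesgue_measure ((fun x => x + a) @^-1` A) = lebesgue_measure A.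
Proof.
move=> mA.
have mph : measurable_fun [set: measurableTypeR R] (fun x : measurableTypeR R => x + a : measurableTypeR R).
  by apply: measurable_funD.
pose nu := pushforward (@lebesgue_measure R) (fun x : measurableTypeR R => x + a : measurableTypeR R).
pose nu' := measure_function_pushforward__canonical__measure_function_Measure (@lebesgue_measure R) mph.
apply/esym; apply: (@lebesgue_measure_unique _ nu') => //.
move=> _ [[u v] _ <-] /=.
rewrite /nu /pushforward (_ : _ @^-1` _ = `]u - a, v - a]%classic).
  by rewrite !lebesgue_measure_itv /= !lte_fin ltrD2r -!EFinB; case: ifP => // _; congr EFin; ring.
by apply/seteqP; split => x /=; rewrite !in_itv/= ltrBlDr lerBrDr.
Qed.

Lemma measurable_rV_shift n (a : 'rV[R]_n) :
  measurable_fun setT (fun x : 'rV[R]_n => x + a).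
Proof.
apply: measurable_fun_rV => i.
rewrite (_ : (fun _ => _) = (fun x : 'rV[R]_n => x ord0 i + a ord0 i)).
  by apply: measurable_funD => //; exact: measurable_rV_coord.
by apply/funext => x; rewrite mxE.
Qed.

(** In dimension [n+1] the measure is the image of a product, and a translation acts on each factor
    separately. Uniqueness of the product measure reduces the claim to rectangles, where the
    one-dimensional case and the induction hypothesis apply. *)
Lemma lebesgue_rV_shift n (a : 'rV[R]_n) (A : set 'rV[R]_n) : measurable A ->
  lebesgue_rV R n ((fun x => x + a) @^-1` A) = lebesgue_rV R n A.
Proof.
elim: n a A => [|n IH] a A mA.
  congr (lebesgue_rV R 0 _); apply/seteqP.
  by split => x /=; rewrite (_ : x + a = x)//; apply/rowP => -[].
pose a0 := (rV_uncons a).1; pose a' := (rV_uncons a).2.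
pose tr (xv : measurableTypeR R * 'rV[R]_n) : measurableTypeR R * 'rV[R]_n :=
  (xv.1 + a0 : R, xv.2 + a').
have mtr : measurable_fun setT tr.
  apply/measurable_fun_pairP; split.
    exact: (@measurable_funD _ _ _ _ (fst : measurableTypeR R * 'rV[R]_n -> R) (cst a0)).
  exact: (measurableT_comp (measurable_rV_shift a') measurable_snd).
have mc : measurable (@rV_cons R n @^-1` A).
  by rewrite -[X in measurable X]setTI; exact: measurable_rV_cons.
rewrite /= /cons_measure /pushforward.
transitivity ((lebesgue_measure \x lebesgue_rV R n)%E (tr @^-1` (@rV_cons R n @^-1` A))).
  congr (_ _); apply/seteqP.
  have E xv : rV_cons xv + a = rV_cons (tr xv).
    apply/rowP => i; rewrite !mxE; case: unliftP => [j ->|->] /=; rewrite ?mxE//.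
  by split => xv /=; rewrite E.
apply/esym; apply: (@product_measure_unique _ _ _ _ _ _ _
  (measure_function_pushforward__canonical__measure_function_Measure
    (lebesgue_measure \x lebesgue_rV R n)%E mtr)) => // A' B' mA' mB'.
transitivity ((lebesgue_measure \x lebesgue_rV R n)%E
   (((fun x : R => x + a0) @^-1` A') `*` ((fun v => v + a') @^-1` B'))) => //.
have mA1 : measurable ((fun x : measurableTypeR R => x + a0) @^-1` A').
  rewrite -[X in measurable X]setTI.
  have := @measurable_funD _ (measurableTypeR R) R setT idfun (cst a0).
  by apply => //; exact: measurable_id.
have mB1 : measurable ((fun v => v + a') @^-1` B').
  by rewrite -[X in measurable X]setTI; exact: measurable_rV_shift.
rewrite (product_measure1E _ _ mA1 mB1).
congr (_ * _)%E; [exact: lebesgue_measure_shift|exact: IH].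
Qed.

Lemma ge0_integral_shift n (a : 'rV[R]_n) (f : 'rV[R]_n -> \bar R) :
  measurable_fun setT f -> (forall x, 0 <= f x)%E ->
  (\int[lebesgue_rV R n]_x f (x + a)%R = \int[lebesgue_rV R n]_x f x)%E.
Proof.
move=> mf f0.
have := @ge0_integral_pushforward _ _ _ _ _ _ (measurable_rV_shift a)
  (lebesgue_rV R n) setT f measurableT mf (fun x _ => f0 x).
rewrite preimage_setT => <-; apply: eq_measure_integral.
  exact: (measurable_rV_shift a).
by move=> ? A mA _; exact: lebesgue_rV_shift.
Qed.

Lemma integral_shift n (a : 'rV[R]_n) (f : 'rV[R]_n -> \bar R) :
  measurable_fun setT f ->
  (\int[lebesgue_rV R n]_x f (x + a)%R = \int[lebesgue_rV R n]_x f x)%E.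
Proof.
move=> mf; rewrite [in LHS]integralE [in RHS]integralE; congr (_ - _)%E.
  rewrite -[RHS](ge0_integral_shift a)//; last exact: measurable_funepos.
  by apply: eq_integral => x _; rewrite !funeposE.
rewrite -[RHS](ge0_integral_shift a)//; last exact: measurable_funeneg.
by apply: eq_integral => x _; rewrite !funenegE.
Qed.

Lemma integrable_shift n (a : 'rV[R]_n) (f : 'rV[R]_n -> \bar R) :
  (lebesgue_rV R n).-integrable setT f ->
  (lebesgue_rV R n).-integrable setT (fun x => f (x + a)).
Proof.
move=> /integrableP[mf foo]; apply/integrableP; split.
  exact: (measurableT_comp mf (measurable_rV_shift a)).
rewrite (@ge0_integral_shift n a (abse \o f)).
- exact: foo.
- exact: (measurableT_comp (@abse_measurable R setT) mf).
- by move=> x; exact: abse_ge0.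
Qed.

End translation.

(** * Integrals of nonnegative functions *)

Section nonneg_integrals.
Context d (T : measurableType d) (R : realType) (mu : {measure set T -> \bar R}).
Implicit Types (f g h : T -> R).
Local Open Scope ereal_scope.

Lemma le_int f g : measurable_fun setT f -> measurable_fun setT g ->
  (forall x, 0 <= f x)%R -> (forall x, f x <= g x)%R ->
  \int[mu]_x (f x)%:E <= \int[mu]_x (g x)%:E.
Proof.
move=> mf mg f0 fg; apply: ge0_le_integral => //.
- by move=> x _; rewrite lee_fin.
- exact/measurable_EFinP.
- exact/measurable_EFinP.
- by move=> x _; rewrite lee_fin.
Qed.

Lemma intD f g : measurable_fun setT f -> measurable_fun setT g ->
  (forall x, 0 <= f x)%R -> (forall x, 0 <= g x)%R ->
  \int[mu]_x (f x + g x)%:E = \int[mu]_x (f x)%:E + \int[mu]_x (g x)%:E.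
Proof.
move=> mf mg f0 g0; rewrite -ge0_integralD//.
- by move=> x _; rewrite lee_fin.
- exact/measurable_EFinP.
- by move=> x _; rewrite lee_fin.
- exact/measurable_EFinP.
Qed.

Lemma intZ (k : R) f : measurable_fun setT f -> (forall x, 0 <= f x)%R ->
  (0 <= k)%R ->
  \int[mu]_x (k * f x)%:E = k%:E * \int[mu]_x (f x)%:E.
Proof.
move=> mf f0 k0; rewrite -ge0_integralZl//.
- exact/measurable_EFinP.
- by move=> x _; rewrite lee_fin.
Qed.

Lemma int_sum (I : Type) (s : seq I) (f : I -> T -> R) :
  (forall i, measurable_fun setT (f i)) -> (forall i x, 0 <= f i x)%R ->
  \int[mu]_x (\sum_(i <- s) f i x)%:E = \sum_(i <- s) \int[mu]_x (f i x)%:E.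
Proof.
move=> mf f0; under eq_integral do rewrite -sumEFin.
rewrite ge0_integral_sum//.
- by move=> i; exact/measurable_EFinP.
- by move=> i x _; rewrite lee_fin.
Qed.

Lemma int_indic (k : R) (A : set T) : measurable A -> (0 <= k)%R ->
  \int[mu]_x (k * \1_A x)%:E = k%:E * mu A.
Proof.
by move=> mA k0; rewrite intZ// integral_indic// setIT.
Qed.

Lemma markov_int f (k : R) (A : set T) : measurable A -> measurable_fun setT f ->
  (forall x, 0 <= f x)%R -> (0 <= k)%R -> (forall x, A x -> k <= f x)%R ->
  k%:E * mu A <= \int[mu]_x (f x)%:E.
Proof.
move=> mA mf f0 k0 kf; rewrite -int_indic//; apply: le_int => //.
- by apply: measurable_funM => //; exact: measurable_indic.
- by move=> x; rewrite mulr_ge0.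
move=> x; rewrite indicE; case: (boolP (x \in A)) => [|_]; last by rewrite mulr0.
by rewrite inE mulr1; exact: kf.
Qed.

(** Fatou's lemma in the form used throughout: a uniform bound on integrals survives an almost
    everywhere limit. *)
Lemma fatou_bound (f_ : nat -> T -> R) f (C : \bar R) :
  (forall n, measurable_fun setT (f_ n)) -> measurable_fun setT f ->
  (forall n x, 0 <= f_ n x)%R -> (forall x, 0 <= f x)%R ->
  {ae mu, forall x, (f_ ^~ x) @ \oo --> f x} ->
  (forall n, \int[mu]_x (f_ n x)%:E <= C) ->
  \int[mu]_x (f x)%:E <= C.
Proof.
move=> mf_ mf f_0 f0 cf fC.
apply: (@le_trans _ _ (\int[mu]_x (limn_einf (fun n => (f_ n x)%:E)))).
  apply: ae_ge0_le_integral => //.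
  - by move=> x _; rewrite lee_fin.
  - exact/measurable_EFinP.
  - move=> x _; rewrite limn_einf_lim; apply: lime_ge; first exact: is_cvg_einfs.
    by apply: nearW => n; apply: le_ereal_inf_tmp => _ [k _ <-]; rewrite lee_fin.
  - rewrite (_ : (fun _ => _) = \- (fun x => limn_esup (fun n => - (f_ n x)%:E))); last first.
      by apply/funext => x; rewrite -limn_einfN; congr limn_einf; apply/funext => n /=; rewrite ?oppeK ?opprK.
    apply: measurableT_comp => //; apply: measurable_fun_limn_esup => n.
    by apply: measurableT_comp => //; exact/measurable_EFinP.
  apply: filterS cf => x fx _.
  have fxE : (fun n => (f_ n x)%:E) @ \oo --> (f x)%:E by apply/fine_cvgP; split => //; exact: nearW.
  by rewrite (cvg_limn_einf_sup fxE).1.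
apply: (@le_trans _ _ (limn_einf (fun n => \int[mu]_x (f_ n x)%:E))).
  apply: fatou => //.
  - by move=> n; exact/measurable_EFinP.
  - by move=> n x _; rewrite lee_fin.
rewrite limn_einf_lim; apply: lime_le; first exact: is_cvg_einfs.
apply: nearW => n; apply: le_trans (fC n); apply: ge_ereal_inf.
by exists (\int[mu]_x (f_ n x)%:E) => //; exists n => /=.
Qed.

(** Jensen's inequality for the probability density [w]. Since [a] is only bounded by the mean, the
    modulus of a signed integral can be taken for [a]. *)
Lemma jensen_powR (p a : R) f (w : T -> R) : (1 < p)%R -> (0 <= a)%R ->
  measurable_fun setT f -> measurable_fun setT w ->
  (forall x, 0 <= f x)%R -> (forall x, 0 <= w x)%R ->
  \int[mu]_x (w x)%:E = 1 ->
  a%:E <= \int[mu]_x (f x * w x)%:E ->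
  (a `^ p)%:E <= \int[mu]_x (f x `^ p * w x)%:E.
Proof.
move=> p1 a0 mf mw f0 w0 w1 aI.
have p0 : (0 < p)%R by lra.
have mfp : measurable_fun setT (fun x => f x `^ p)%R.
  exact: (measurableT_comp (@measurable_powR R p) mf).
have mfpw : measurable_fun setT (fun x => f x `^ p * w x)%R by exact: measurable_funM.
have mfw : measurable_fun setT (fun x => f x * w x)%R by exact: measurable_funM.
have fpw0 x : (0 <= f x `^ p * w x)%R by rewrite mulr_ge0// powR_ge0.
have fw0 x : (0 <= f x * w x)%R by rewrite mulr_ge0.
set A := \int[mu]_x (f x `^ p * w x)%:E.
have A0 : 0 <= A by apply: integral_ge0 => x _; rewrite lee_fin.
have [Afin|] := boolP (A \is a fin_num); last first.
  by rewrite ge0_fin_numE// -leNgt leye_eq => /eqP ->; rewrite leey.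
(* Young's inequality against the constant [a `^ (p - 1)], with weight [w] *)
have young x : (a `^ (p - 1) * (f x * w x) <= p^-1 * (f x `^ p * w x) + (p - 1) / p * a `^ p * w x)%R.
  have q0 : (0 < p / (p - 1))%R by rewrite divr_gt0//; lra.
  have pq : (p^-1 + (p / (p - 1))^-1 = 1)%R by field; apply/andP; split; lra.
  have := @conjugate_powR R (f x) (a `^ (p - 1))%R p _ (f0 x) (powR_ge0 _ _) p0 q0 pq.
  rewrite -powRrM (_ : (p - 1) * (p / (p - 1)) = p)%R; last by field; lra.
  move=> /(ler_wpM2r (w0 x)); rewrite mulrDl => h.
  by apply: le_trans (_ : f x * a `^ (p - 1) * w x <= _)%R; [rewrite le_eqVlt; apply/orP; left; apply/eqP; ring|apply: (le_trans h); rewrite le_eqVlt; apply/orP; left; apply/eqP; field; lra].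
have : \int[mu]_x (a `^ (p - 1) * (f x * w x))%:E <=
       \int[mu]_x (p^-1 * (f x `^ p * w x) + (p - 1) / p * a `^ p * w x)%:E.
  apply: le_int => //.
  - exact: measurable_funM.
  - by apply: measurable_funD; apply: measurable_funM.
  - by move=> x; rewrite mulr_ge0// powR_ge0.
have c0 : (0 <= (p - 1) / p * a `^ p)%R.
  by rewrite mulr_ge0 ?powR_ge0// divr_ge0//; lra.
rewrite intD//; last 4 first.
  exact: measurable_funM.
  exact: measurable_funM.
  by move=> x; rewrite mulr_ge0// invr_ge0 ltW.
  by move=> x; rewrite mulr_ge0.
rewrite intZ ?powR_ge0// intZ ?invr_ge0 ?(ltW p0)// intZ// w1 mule1.
rewrite -/A -(fineK Afin) -EFinM -EFinD => h.
have : ((a `^ (p - 1) * a)%:E <= (p^-1 * fine A + (p - 1) / p * a `^ p)%:E).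
  apply: le_trans h; rewrite EFinM; apply: lee_wpmul2l => //.
  by rewrite lee_fin powR_ge0.
rewrite !lee_fin mulrC mulr_powRB1// => h1.
have -> : (a `^ p = p * (a `^ p - (p - 1) / p * a `^ p))%R by field; lra.
have -> : (fine A = p * (p^-1 * fine A))%R by field; lra.
by apply: ler_wpM2l; [exact: ltW|lra].
Qed.

(** The sets [A k] cover the points where [g] is positive, so [g] lies below the series of the
    functions [c k] times the indicator of [A k], whose integral is at most a geometric sum. *)
Lemma int_dyadic_le g (A : nat -> set T) (c : nat -> R) (C th : R) :
  measurable_fun setT g -> (forall x, 0 <= g x)%R ->
  (forall k, measurable (A k)) -> (forall k, 0 <= c k)%R ->
  (0 < th < 1)%R -> (0 <= C)%R ->
  (forall x, 0 < g x -> exists2 k, A k x & g x <= c k)%R ->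
  (forall k, (c k)%:E * mu (A k) <= (C * th ^+ k)%:E) ->
  \int[mu]_x (g x)%:E <= (C / (1 - th))%:E.
Proof.
move=> mg g0 mA c0 /andP[th0 th1] C0 gA cA.
apply: (@le_trans _ _ (\int[mu]_x (\sum_(0 <= k <oo) (c k * \1_(A k) x)%:E))).
  apply: ge0_le_integral => //.
  - by move=> x _; rewrite lee_fin.
  - exact/measurable_EFinP.
  - apply: ge0_emeasurable_sum => // k; first by move=> x _ _; rewrite lee_fin mulr_ge0.
    by move=> _; apply/measurable_EFinP; apply: measurable_funM => //; exact: measurable_indic.
  - move=> x _; have [g0x|] := ltP 0%R (g x); last first.
      move=> gx0; apply: (@le_trans _ _ 0); first by rewrite lee_fin.
      by apply: nneseries_ge0 => k _ _; rewrite lee_fin mulr_ge0.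
    have [k Akx gck] := gA _ g0x.
    rewrite (nneseries_split_cond 0 k.+1) ?add0n; last first.
      by move=> i _; rewrite lee_fin mulr_ge0.
    rewrite big_nat_recr//= -[leLHS]adde0 leeD//; last first.
      by apply: nneseries_ge0 => i _ _; rewrite lee_fin mulr_ge0.
    apply: (@le_trans _ _ (c k * \1_(A k) x)%:E).
      by rewrite indicE mem_set// mulr1 lee_fin.
    by rewrite leeDr// sume_ge0// => i _; rewrite lee_fin mulr_ge0.
rewrite integral_nneseries//; last 2 first.
- by move=> k; apply/measurable_EFinP; apply: measurable_funM => //; exact: measurable_indic.
- by move=> k x _; rewrite lee_fin mulr_ge0.
apply: (@le_trans _ _ (\sum_(0 <= k <oo) (C * th ^+ k)%:E)).
  apply: lee_nneseries => k _; first by rewrite integral_ge0// => x _; rewrite lee_fin mulr_ge0.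
  by rewrite int_indic.
have := @cvg_geometric_series R C th.
rewrite ger0_norm ?(ltW th0)// => /(_ th1) h.
rewrite le_eqVlt; apply/orP; left; apply/eqP; apply: cvg_lim => //.
apply/fine_cvgP; split; first by apply: nearW => n; rewrite sumEFin.
by apply: cvg_trans h; apply: near_eq_cvg; apply: nearW => n; rewrite /= sumEFin.
Qed.

End nonneg_integrals.

(** * Closed cubes *)

Section cubes.
Context {R : realType} {N : nat}.
Local Notation V := 'rV[R]_N.
Local Notation leb := (measure_function_SigmaFiniteMeasure__to__measure_function_Measure (lebesgue_rV R N)).

Definition cube (c : V) (r : R) : set V := [set v | forall i, `|v ord0 i - c ord0 i| <= r].

Lemma cubeE c r : cube c r =
  [set v : V | forall i, `[c ord0 i - r, c ord0 i + r]%classic (v ord0 i)].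
Proof.
by apply/seteqP; split => v vc i; have := vc i; rewrite /= in_itv/= ler_distl.
Qed.

Lemma measurable_cube c r : measurable (cube c r).
Proof. by rewrite cubeE; apply: (@measurable_rV_forall _ _ (fun i => `[_, _]%classic)). Qed.

Lemma compact_cube c r : compact (cube c r).
Proof.
rewrite cubeE; apply: (@rV_compact _ _ (fun i => `[c ord0 i - r, c ord0 i + r]%classic)).
by move=> i; exact: segment_compact.
Qed.

Lemma leb_cube c (r : R) : 0 <= r -> leb (cube c r) = ((2 * r) ^+ N)%:E.
Proof.
move=> r0; rewrite cubeE.
rewrite (_ : [set v | _] = [set v : V | forall i,
    v ord0 i \in `[(c - const_mx r) ord0 i, (c + const_mx r) ord0 i]]).
  rewrite [LHS](@lebesgue_rV_box R N (c - const_mx r) (c + const_mx r)) => [|i]; last first.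
    by rewrite !mxE; lra.
  congr EFin; rewrite (eq_bigr (fun=> 2 * r)) => [|i _]; last by rewrite !mxE; ring.
  by rewrite prodr_const card_ord.
by apply/seteqP; split => v vc i; have := vc i; rewrite /= !mxE.
Qed.

Lemma cubeW c r s : r <= s -> cube c r `<=` cube c s.
Proof. by move=> rs v vc i; exact: le_trans (vc i) rs. Qed.

Lemma compact_sub_cube (K : set V) : compact K -> exists2 r, 0 < r & K `<=` cube 0 r.
Proof.
move=> /compact_bounded [M [_ KM]].
exists (`|M| + 1); first by rewrite ltr_wpDl.
move=> v Kv i; rewrite mxE subr0.
have Mv : `|v| <= `|M| + 1.
  by apply: KM => //; rewrite (le_lt_trans (ler_norm M))// ltrDl.
apply: le_trans Mv.
by rewrite [leRHS]/Num.norm /= mx_normrE; apply/bigmax_geP; right; exists (ord0, i).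
Qed.

Lemma continuous_bounded_cube (f : V -> R) c r : continuous f ->
  exists2 M : R, 0 < M & forall x, cube c r x -> `|f x| <= M.
Proof.
move=> cf.
have /compact_bounded [M [_ fM]] : compact (f @` cube c r).
  apply: continuous_compact; last exact: compact_cube.
  exact: continuous_subspaceT.
exists (`|M| + 1); first by rewrite ltr_wpDl.
by move=> x xc; apply: fM; [rewrite (le_lt_trans (ler_norm M))// ltrDl|exists x].
Qed.

Lemma integrable_cube (f : V -> R) (r M : R) : measurable_fun setT f ->
  (forall x, `|f x| <= M) -> (forall x, ~ cube 0 r x -> f x = 0) ->
  leb.-integrable setT (EFin \o f).
Proof.
move=> mf fM f0.
have M0 : 0 <= M by exact: le_trans (normr_ge0 _) (fM 0).
apply: (@le_integrable _ _ _ _ _ measurableT _ (fun x => (M * \1_(cube 0 `|r|) x)%:E)).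
- exact/measurable_EFinP.
- move=> x _ /=; rewrite indicE lee_fin.
  case: (boolP (x \in _)) => [_|]; first by rewrite mulr1 (ger0_norm M0).
  by rewrite notin_setE => xr; rewrite f0 ?normr0//; apply: contra_not xr; apply: cubeW; exact: ler_norm.
- apply/integrableP; split.
    apply/measurable_EFinP; apply: measurable_funM => //.
    by apply: measurable_indic; exact: measurable_cube.
  under eq_integral do rewrite gee0_abs ?lee_fin ?mulr_ge0//.
  rewrite int_indic//; last exact: measurable_cube.
  by rewrite leb_cube// -EFinM ltry.
Qed.

End cubes.

(** * Derivatives along lines *)

Section line_derivatives.
Context {R : realType}.

(** Functions of several variables carry only directional derivatives here. This equivalence imports
    the one-variable chain rule and mean value theorem along a line. *)
Lemma is_derive_lineP (V : normedModType R) (f : V -> R) (v x : V) (t df : R) :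
  is_derive (x + t *: v) v f df <-> is_derive t 1 (fun s => f (x + s *: v)) df.
Proof.
suff E : (fun h => h^-1 *: ((fun s => f (x + s *: v)) (h *: 1 + t) - f (x + t *: v))) =
    (fun h : R => h^-1 *: (f (h *: v + (x + t *: v)) - f (x + t *: v))).
  split => [[d1 d2]|[d1 d2]].
    by split; [rewrite /derivable E|rewrite /derive E].
  by split; [rewrite /derivable -E|rewrite /derive -E].
apply/funext => h; congr (_ *: (f _ - _)).
by rewrite scalerDl addrCA /GRing.scale /= mulr1.
Qed.

Lemma is_derive_scal_comp (V : normedModType R) (f : V -> R) (k : R -> R) (v x : V) (df dk : R) :
  is_derive x v f df -> is_derive (f x) 1 k dk -> is_derive x v (k \o f) (dk * df).
Proof.
move=> fx kx.
suff : is_derive (x + 0 *: v) v (k \o f) (dk * df) by rewrite scale0r addr0.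
apply: (is_derive_lineP _ _ _ _ _).2; apply: (@is_derive1_comp _ k (fun s => f (x + s *: v))).
  by rewrite scale0r addr0.
by apply: (is_derive_lineP _ _ _ _ _).1; rewrite scale0r addr0.
Qed.

Lemma mvt_line (V : normedModType R) (f df : V -> R) (v x : V) (t L : R) :
  (forall x, is_derive x v f (df x)) -> (forall s, `|s| <= `|t| -> `|df (x + s *: v)| <= L) ->
  `|f (x + t *: v) - f x| <= `|t| * L.
Proof.
move=> fd dL.
pose g s := f (x + s *: v).
have gd (s : R) : is_derive s 1 g (df (x + s *: v)) by apply: (is_derive_lineP _ _ _ _ _).1.
have cg : continuous g by move=> s; apply: differentiable_continuous; apply/derivable1_diffP; case: (gd s).
have g0 : f x = g 0 by rewrite /g scale0r addr0.
rewrite g0 -/(g t); have [t0|t0] := leP 0 t.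
  have [|c] := @MVT_segment _ g (fun s => df (x + s *: v)) _ _ t0 (fun s _ => gd s).
    exact: continuous_subspaceT.
  rewrite in_itv /= => /andP[c0 ct] ->; rewrite subr0 normrM mulrC ler_wpM2l// dL//.
  by rewrite !ger0_norm.
have [|c] := @MVT_segment _ g (fun s => df (x + s *: v)) _ _ (ltW t0) (fun s _ => gd s).
  exact: continuous_subspaceT.
rewrite in_itv /= => /andP[c0 ct]; rewrite distrC => ->.
rewrite sub0r normrM normrN mulrC ler_wpM2l// dL//.
by rewrite !ler0_norm ?(ltW t0)// lerN2.
Qed.

(** The quotients are taken along [1/(n+1)] because dominated convergence is about sequences. *)
Lemma is_derive_cvg_seq (V : normedModType R) (f : V -> R) (v x : V) (df : R) :
  is_derive x v f df ->
  (fun n => n.+1%:R * (f (x + n.+1%:R^-1 *: v) - f x)) @ \oo --> df.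
Proof.
move=> [d1 d2].
have /cvgr_dnbhsP : (fun h : R => h^-1 *: (f (h *: v + x) - f x)) @ 0^' --> df by rewrite -d2.
move=> /(_ (fun n => n.+1%:R^-1)) h.
have : (fun n : nat => (n.+1%:R^-1 : R)^-1 *: (f (n.+1%:R^-1 *: v + x) - f x)) @ \oo --> df.
  by apply: h; split=> [n|]; [rewrite invr_eq0 pnatr_eq0|exact: cvg_harmonic].
apply: cvg_trans; apply: near_eq_cvg; apply: nearW => n /=.
by rewrite invrK [_ *: v + x]addrC.
Qed.

End line_derivatives.

(** * Integrals of partial derivatives *)

Section integration_by_parts.
Context {R : realType} {N : nat}.
Local Notation V := 'rV[R]_N.
Local Notation leb := (measure_function_SigmaFiniteMeasure__to__measure_function_Measure (lebesgue_rV R N)).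
Local Notation e i := (delta_mx ord0 i : V).

(** Every difference quotient of [H] has integral zero by translation invariance. The quotients are
    uniformly bounded and live in one cube, so dominated convergence concludes without iterated
    integrals. *)
Lemma int_partial_eq0 (i : 'I_N) (H dH : V -> R) (r : R) :
  (forall x, is_derive x (e i) H (dH x)) -> continuous H -> continuous dH ->
  (forall x, ~ cube 0 r x -> H x = 0) -> (forall x, ~ cube 0 r x -> dH x = 0) ->
  leb.-integrable setT (EFin \o dH) /\ (\int[leb]_x (dH x)%:E = 0)%E.
Proof.
move=> Hd cH cdH H0 dH0.
have mH := continuous_measurable_rV cH; have mdH := continuous_measurable_rV cdH.
have bnd (f : V -> R) : continuous f -> (forall x, ~ cube 0 r x -> f x = 0) ->
    exists2 M : R, 0 < M & forall x, `|f x| <= M.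
  move=> cf f0; have [M M0 fM] := continuous_bounded_cube 0 r cf; exists M => // x.
  by have [/fM //|/f0 ->] := pselect (cube 0 r x); rewrite normr0 ltW.
have [M M0 HM] := bnd _ cH H0; have [L L0 dHL] := bnd _ cdH dH0.
have iH := integrable_cube mH HM H0.
pose g (n : nat) x := n.+1%:R * (H (x + n.+1%:R^-1 *: e i) - H x).
have mg n : measurable_fun setT (g n).
  apply: measurable_funM => //; apply: measurable_funB => //.
  exact: (measurableT_comp mH (measurable_rV_shift _)).
have ig n : (\int[leb]_x (g n x)%:E = 0)%E.
  have iHs := integrable_shift (n.+1%:R^-1 *: e i) iH.
  under eq_integral do rewrite EFinM.
  rewrite integralZl//; last by apply: eq_integrable (integrableB _ iHs iH).
  under eq_integral do rewrite EFinB.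
  rewrite integralB_EFin// (@integral_shift _ _ _ (EFin \o H)) ?subee ?mule0//.
    exact: integrable_fin_num.
  exact/measurable_EFinP.
have gL n x : `|g n x| <= L.
  rewrite /g normrM ger0_norm//.
  have := @mvt_line _ _ H dH (e i) x (n.+1%:R^-1) L Hd (fun s _ => dHL _).
  rewrite (@ger0_norm _ n.+1%:R^-1)// => h; apply: (le_trans (ler_wpM2l _ h)) => //.
  by rewrite mulrA divff ?mul1r.
(* The shifts are at most [1], so the cube enlarged by [1] contains the support of every
   quotient. *)
have g0 n x : ~ cube 0 (`|r| + 1) x -> g n x = 0.
  move=> xr; rewrite /g !H0 ?subrr ?mulr0//.
    by apply: contra_not xr; apply: cubeW; rewrite (le_trans (ler_norm r))// lerDl.
  apply: contra_not xr => xr j; have := xr j; rewrite !mxE /= !subr0 => h.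
  have : `|n.+1%:R^-1 * (j == i)%:R| <= 1 :> R.
    by rewrite normrM !ger0_norm//; case: (j == i); rewrite ?mulr1 ?mulr0// invf_le1// ler1n.
  set a := x ord0 j in h *; set b := _ * _ in h * => b1.
  have -> : a = (a + b) - b by ring.
  by rewrite (le_trans (ler_normB _ _))// lerD// (le_trans h)// ler_norm.
have iL : leb.-integrable setT (fun x => (L * \1_(cube 0 (`|r| + 1)) x)%:E).
  apply: (@integrable_cube _ _ (fun x => L * \1_(cube 0 (`|r| + 1)) x) (`|r| + 1) L).
  - by apply: measurable_funM => //; apply: measurable_indic; exact: measurable_cube.
  - by move=> x; rewrite indicE; case: (_ \in _); rewrite ?mulr1 ?mulr0 ?normr0 ?gtr0_norm// ltW.
  - by move=> x xr; rewrite indicE memNset// mulr0.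
have [] := @dominated_convergence _ _ _ leb setT measurableT (fun n x => (g n x)%:E)
   (EFin \o dH) (fun x => (L * \1_(cube 0 (`|r| + 1)) x)%:E).
- by move=> n; exact/measurable_EFinP.
- exact/measurable_EFinP.
- apply: aeW => x _ /=; apply/fine_cvgP; split; first exact: nearW.
  exact: is_derive_cvg_seq.
- exact: iL.
- apply: aeW => x n _ /=; rewrite lee_fin indicE.
  have [xr|xr] := pselect (cube 0 (`|r| + 1) x); first by rewrite mem_set// mulr1.
  by rewrite g0// memNset// normr0 mulr0.
move=> idH _ h; split => //; apply/esym/(cvg_unique _ _ h); first exact: ereal_hausdorff.
rewrite (_ : [sequence _]_n = fun=> 0%E); first exact: cvg_cst.
by apply/funext => n /=; exact: ig.
Qed.

End integration_by_parts.

Section pointwise_derivative_rules.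
Context {R : realType} {V : normedModType R}.
Implicit Types (f g : V -> R).

Lemma is_derive_mulf f g (x v : V) (df dg : R) :
  is_derive x v f df -> is_derive x v g dg ->
  is_derive x v (fun y => f y * g y) (f x * dg + g x * df).
Proof. exact: is_deriveM. Qed.

Lemma is_derive_addf f g (x v : V) (df dg : R) :
  is_derive x v f df -> is_derive x v g dg ->
  is_derive x v (fun y => f y + g y) (df + dg).
Proof. exact: is_deriveD. Qed.

Lemma is_derive_eqr f (x v : V) (df df' : R) :
  is_derive x v f df -> df = df' -> is_derive x v f df'.
Proof. by move=> + <-. Qed.

End pointwise_derivative_rules.

(** * Functions that are flat at the origin *)

Section flat_functions.
Context {R : realType}.
Implicit Types (p : {poly R}) (t : R).

(** The family [p(1/t) exp(-1/t)] extended by zero is closed under differentiation: [p] becomes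
    [X^2 (p - p')]. *)
Definition flat p t : R := if 0 < t then p.[t^-1] * expR (- t^-1) else 0.

Lemma flat_le0 p t : t <= 0 -> flat p t = 0.
Proof. by rewrite /flat leNgt; case: ifP. Qed.

Lemma flat1_ge0 t : 0 <= flat 1 t.
Proof. by rewrite /flat; case: ifP => // _; rewrite hornerC mul1r expR_ge0. Qed.

Lemma flat1_gt0 t : 0 < t -> 0 < flat 1 t.
Proof. by move=> t0; rewrite /flat t0 hornerC mul1r expR_gt0. Qed.

Lemma flat1_le1 t : flat 1 t <= 1.
Proof.
rewrite /flat; case: ifP => // t0; rewrite hornerC mul1r.
by rewrite -expR0 ler_expR oppr_le0 invr_ge0 ltW.
Qed.

Lemma flat1_le s t : s <= t -> flat 1 s <= flat 1 t.
Proof.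
move=> st; have [s0|s0] := ltP 0 s; last by rewrite flat_le0// flat1_ge0.
have t0 : 0 < t by exact: lt_le_trans st.
by rewrite /flat s0 t0 !hornerC !mul1r ler_expR lerN2 lef_pV2.
Qed.

(** With [s = 1/t >= 1], [|p(s)|] is at most a multiple of [s^k] while [exp(-s)] is at most
    [n! / s^n]; taking [n = k + 2] leaves [t^2]. Quadratic decay forces the derivative at the origin
    to be zero. *)
Lemma flat_quadratic p : exists2 C : R, 0 < C &
  forall t, `|t| <= 1 -> `|flat p t| <= C * t ^+ 2.
Proof.
pose k := size p; pose n := k.+2.
pose A : R := \sum_(i < k) `|p`_i|.
have A0 : 0 <= A by apply: sumr_ge0.
exists ((A + 1) * n`!%:R) => [|t t1].
  by rewrite mulr_gt0 ?ltr0n ?fact_gt0// ltr_wpDl.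
have [t0|t0] := ltP 0 t; last first.
  by rewrite flat_le0// normr0 mulr_ge0 ?sqr_ge0// mulr_ge0// addr_ge0.
have t1' : t <= 1 by rewrite gtr0_norm in t1.
rewrite /flat t0 normrM (ger0_norm (expR_ge0 _)).
set s := t^-1; have s0 : 0 < s by rewrite invr_gt0.
have s1 : 1 <= s by rewrite invf_ge1.
have pA : `|p.[s]| <= A * s ^+ k.
  rewrite horner_coef (le_trans (ler_norm_sum _ _ _))// mulr_suml ler_sum// => i _.
  rewrite normrM normrX (gtr0_norm s0) ler_wpM2l// ler_weXn2l// ltnW//.
have eN : expR (- s) <= n`!%:R * t ^+ n.
  have nf0 : (0 : R) < n`!%:R by rewrite ltr0n fact_gt0.
  have sn : s ^+ n / n`!%:R <= expR s.
    by apply: le_trans (@expR_ge1Dxn _ s k.+1 (ltW s0)); rewrite lerDr.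
  rewrite expRN -[leRHS]invrK lef_pV2 ?posrE ?expR_gt0//; last first.
    by rewrite invr_gt0 mulr_gt0// exprn_gt0.
  by rewrite invfM -exprVn mulrC.
apply: (@le_trans _ _ ((A * s ^+ k) * (n`!%:R * t ^+ n))).
  by apply: ler_pM => //; exact: expR_ge0.
rewrite (_ : t ^+ n = t ^+ k * t ^+ 2); last by rewrite -exprD addn2.
have -> : A * s ^+ k * (n`!%:R * (t ^+ k * t ^+ 2)) = A * n`!%:R * t ^+ 2 * (s * t) ^+ k.
  by rewrite exprMn; ring.
rewrite /s mulVf ?lt0r_neq0// expr1n mulr1 ler_wpM2r ?sqr_ge0// ler_wpM2r//.
by rewrite lerDl.
Qed.

Lemma is_derive_quadratic (f : R -> R) (C : R) : f 0 = 0 ->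
  (forall t, `|t| <= 1 -> `|f t| <= C * t ^+ 2) -> is_derive (0 : R) 1 f 0.
Proof.
move=> f0 fC.
have C0 : 0 <= C by have := fC 1; rewrite normr1 expr1n mulr1 => /(_ (lexx _)); exact: le_trans.
suff h : (fun h : R => h^-1 *: (f (h *: 1 + 0) - f 0)) @ 0^' --> (0 : R).
  split; last exact: cvg_lim h.
  by apply/cvg_ex; exists 0.
apply: (@squeeze_cvgr _ _ _ _ (fun h => - (C * `|h|)) (fun h => C * `|h|)).
- near=> h.
  have h1 : `|h| <= 1 by near: h; exact: (nbhs_dnbhs (@nbhs0_le R R 1 ltr01)).
  have hn0 : h != 0 by near: h; exact: nbhs_dnbhs_neq.
  rewrite -ler_norml f0 subr0 addr0 /GRing.scale /= mulr1 normrM.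
  have h2 := fC _ h1; rewrite normfV.
  rewrite mulrC ler_pdivrMr ?normr_gt0// (le_trans h2)//.
  by rewrite -mulrA -expr2 real_normK// num_real.
- rewrite -[X in _ --> X]oppr0; apply: cvgN; rewrite -[X in _ --> X](mulr0 C).
  apply: cvgM; first exact: cvg_cst.
  rewrite -[X in _ --> X](@normr0 _ R); apply: cvg_norm => A; exact: nbhs_dnbhs.
- rewrite -[X in _ --> X](mulr0 C).
  apply: cvgM; first exact: cvg_cst.
  rewrite -[X in _ --> X](@normr0 _ R); apply: cvg_norm => A; exact: nbhs_dnbhs.
Unshelve. all: end_near. Qed.

Lemma is_derive_flat p t : is_derive t 1 (flat p) (flat ('X^2 * (p - p^`())) t).
Proof.
have [t0|t0|<-] := ltgtP 0 t.
- have H : is_derive t 1 (fun t : R => p.[t^-1] * expR (- t^-1)) (flat ('X^2 * (p - p^`())) t).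
    have tn0 : t != 0 by rewrite gt_eqF.
    have dV : is_derive t 1 (fun t : R => t^-1) (- t ^- 2).
      by have := @is_deriveV R id t 1 1 tn0 (is_derive_id _ _); rewrite /GRing.scale /= mulr1.
    have dp : is_derive t 1 (fun t : R => p.[t^-1]) (p^`().[t^-1] * - t ^- 2).
      exact: (@is_derive1_comp _ (fun x => p.[x]) (fun t : R => t^-1) _ _ _ (is_derive_poly p _) dV).
    have dN : is_derive t 1 (fun t : R => - t^-1) (t ^- 2).
      by have := is_deriveN dV; rewrite opprK.
    have dE : is_derive t 1 (fun t : R => expR (- t^-1)) (expR (- t^-1) * t ^- 2).
      exact: (@is_derive1_comp _ expR (fun t : R => - t^-1) _ _ _ (is_derive_expR _) dN).
    apply: (is_derive_eqr (is_derive_mulf dp dE)).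
    by rewrite /flat t0 hornerM hornerXn hornerD hornerN exprVn; ring.
  apply: near_eq_is_derive H; near=> s; rewrite /flat ifT//.
  by near: s; exact: lt_nbhsr.
- rewrite flat_le0 ?(ltW t0)//.
  apply: (near_eq_is_derive _ (is_derive_cst (0 : R) t 1)).
  near=> s; rewrite flat_le0//= ltW//.
  by near: s; exact: lt_nbhsl.
- rewrite flat_le0//; have [C C0 fC] := flat_quadratic p.
  by apply: is_derive_quadratic fC; rewrite flat_le0.
Unshelve. all: end_near. Qed.

End flat_functions.

(** * Classes of functions closed under differentiation *)

Section smooth_classes.
Context {R : realType} {N : nat}.
Local Notation V := 'rV[R]_N.
Local Notation e i := (delta_mx ord0 i : V).

(** A syntactic class: the derivative of a member is again a member, so smoothness of every order
    follows by induction. Affine arguments provide the translates and reflections from which [bump]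
    is built. *)
Inductive flat_algebra : (R -> R) -> Prop :=
| FlatBase p (a b : R) : flat_algebra (fun t => flat p (a * t + b))
| FlatCst (c : R) : flat_algebra (fun=> c)
| FlatAdd f g : flat_algebra f -> flat_algebra g -> flat_algebra (fun t => f t + g t)
| FlatMul f g : flat_algebra f -> flat_algebra g -> flat_algebra (fun t => f t * g t).

Lemma flat_algebra_derive f : flat_algebra f ->
  exists2 df, flat_algebra df & forall t : R, is_derive t 1 f (df t).
Proof.
elim=> {f} [p a b|c|f g _ [df Ff fd] _ [dg Fg gd]|f g Ff0 [df Ff fd] Fg0 [dg Fg gd]].
- exists (fun t => flat ('X^2 * (p - p^`())) (a * t + b) * a).
    by apply: FlatMul; [exact: FlatBase|exact: FlatCst].
  move=> t; apply: (@is_derive1_comp _ (flat p) (fun t => a * t + b)).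
    exact: is_derive_flat.
  apply: (is_derive_eqr (is_derive_addf (is_derive_mulf (is_derive_cst a t 1)
    (is_derive_id t 1)) (is_derive_cst b t 1))).
  by rewrite /cst; ring.
- by exists (fun=> 0); [exact: FlatCst|move=> t; exact: is_derive_cst].
- exists (fun t => df t + dg t); first exact: FlatAdd.
  by move=> t; exact: is_derive_addf.
- exists (fun t => f t * dg t + g t * df t).
    by apply: FlatAdd; exact: FlatMul.
  by move=> t; exact: is_derive_mulf.
Qed.

Lemma flat_algebra_shift f (a : R) : flat_algebra f -> flat_algebra (fun t => f (t + a)).
Proof.
elim=> {f} [p c b|c|f g _ ? _ ?|f g _ ? _ ?].
- rewrite (_ : (fun _ => _) = (fun t => flat p (c * t + (c * a + b)))); first exact: FlatBase.
  by apply/funext => t; congr flat; ring.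
- exact: FlatCst.
- exact: FlatAdd.
- exact: FlatMul.
Qed.

(** The counterpart in several variables, generated by one-variable functions of single coordinates
    and closed under all partial derivatives. It contains the kernels and the test functions derived
    from them. *)
Inductive coord_algebra : (V -> R) -> Prop :=
| CoordBase f i : flat_algebra f -> coord_algebra (fun x => f (x ord0 i))
| CoordCst (c : R) : coord_algebra (fun=> c)
| CoordAdd f g : coord_algebra f -> coord_algebra g -> coord_algebra (fun x => f x + g x)
| CoordMul f g : coord_algebra f -> coord_algebra g -> coord_algebra (fun x => f x * g x).

Lemma is_derive_coord (x : V) (i j : 'I_N) :
  is_derive x (e j) (fun y : V => y ord0 i) (i == j)%:R.
Proof.
suff H : (fun h : R => h^-1 *: ((h *: e j + x) ord0 i - x ord0 i)) @ 0^' --> ((i == j)%:R : R).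
  split; last exact: cvg_lim H.
  by apply/cvg_ex; exists (i == j)%:R.
apply: cvg_near_cst; near=> h; have h0 : h != 0 by near: h; exact: nbhs_dnbhs_neq.
by rewrite !mxE /= addrK /GRing.scale/= mulrA mulVf// mul1r.
Unshelve. all: end_near. Qed.

Lemma coord_algebra_derive F j : coord_algebra F ->
  exists2 dF, coord_algebra dF & forall x, is_derive x (e j) F (dF x).
Proof.
elim=> {F} [f i|c|f g _ [df Ff fd] _ [dg Fg gd]|f g Ff0 [df Ff fd] Fg0 [dg Fg gd]].
- move=> /flat_algebra_derive[df Ff fd].
  exists (fun x => df (x ord0 i) * (i == j)%:R).
    by apply: CoordMul; [exact: CoordBase|exact: CoordCst].
  move=> x; apply: (@is_derive_scal_comp _ _ (fun y : V => y ord0 i) f) => //.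
  exact: is_derive_coord.
- by exists (fun=> 0); [exact: CoordCst|move=> t; exact: is_derive_cst].
- exists (fun t => df t + dg t); first exact: CoordAdd.
  by move=> t; exact: is_derive_addf.
- exists (fun t => f t * dg t + g t * df t).
    by apply: CoordAdd; exact: CoordMul.
  by move=> t; exact: is_derive_mulf.
Qed.

Lemma coord_algebra_continuous F : coord_algebra F -> continuous F.
Proof.
elim=> {F} [f i|c|f g _ cf _ cg|f g _ cf _ cg].
- move=> /flat_algebra_derive[df _ fd] x.
  apply: (@continuous_comp _ _ _ (fun y : V => y ord0 i) f); first exact: coord_continuous.
  by apply: differentiable_continuous; apply/derivable1_diffP; case: (fd (x ord0 i)).
- exact: cst_continuous.
- by move=> x; exact: (cvgD (cf x) (cg x)).
- by move=> x; exact: (cvgM (cf x) (cg x)).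
Qed.

Lemma coord_algebra_shift F (a : V) : coord_algebra F -> coord_algebra (fun x => F (x + a)).
Proof.
elim=> {F} [f i Ff|c|f g _ ? _ ?|f g _ ? _ ?].
- rewrite (_ : (fun _ => _) = (fun x : V => f (x ord0 i + a ord0 i))).
    exact: (@CoordBase (fun t => f (t + a ord0 i)) i (flat_algebra_shift _ Ff)).
  by apply/funext => x; rewrite mxE.
- exact: CoordCst.
- exact: CoordAdd.
- exact: CoordMul.
Qed.

Lemma coord_algebra_prod (f : 'I_N -> R -> R) : (forall i, flat_algebra (f i)) ->
  coord_algebra (fun x => \prod_(i < N) f i (x ord0 i)).
Proof.
move=> Ff; suff : forall s : seq 'I_N, coord_algebra (fun x => \prod_(i <- s) f i (x ord0 i)).
  by move=> /(_ (index_enum 'I_N)).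
elim=> [|i s IH].
  rewrite (_ : (fun _ => _) = fun=> 1); first exact: CoordCst.
  by apply/funext => x; rewrite big_nil.
rewrite (_ : (fun _ => _) = (fun x : V => f i (x ord0 i) * \prod_(j <- s) f j (x ord0 j))).
  by apply: CoordMul => //; exact: CoordBase.
by apply/funext => x; rewrite big_cons.
Qed.

Lemma coord_algebra_partials s F : coord_algebra F -> coord_algebra (partials s F).
Proof.
move=> FF; elim: s => [//|i s /(coord_algebra_derive i)[dF FdF Fd]] /=.
by rewrite (_ : (fun _ => _) = dF)//; apply/funext => x; case: (Fd x).
Qed.

Lemma coord_algebra_test F c r : coord_algebra F -> (forall x, ~ cube c r x -> F x = 0) ->
  test_function F.
Proof.
move=> FF F0; split.
  move=> s; have := coord_algebra_partials s FF => Fs; split.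
    exact: coord_algebra_continuous.
  by move=> i x; have [dF _ Fd] := coord_algebra_derive i Fs; case: (Fd x).
apply: (@subclosed_compact _ _ (cube c r)).
- exact: closed_closure.
- exact: compact_cube.
rewrite closureEbigcap => x /(_ (cube c r)); apply; split.
  by apply: compact_closed; [exact: norm_hausdorff|exact: compact_cube].
by move=> y /= Fy; apply: contrapT => /F0 Fy0; rewrite Fy0 eqxx in Fy.
Qed.

End smooth_classes.

(** * Bumps and mollifying kernels *)

Section mollifiers.
Context {R : realType} {N : nat}.
Local Notation V := 'rV[R]_N.
Local Notation leb := (measure_function_SigmaFiniteMeasure__to__measure_function_Measure (lebesgue_rV R N)).

(** For [k > 0] the function is positive exactly on the open box between [a] and [b]. The slope has
    two uses: [k = 1/eps] gives a kernel that scales with [eps], and [k] tending to infinity gives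
    the indicator of the box. *)
Definition bump (k : R) (a b : V) (x : V) : R :=
  \prod_(i < N) (flat 1 (k * (x ord0 i - a ord0 i)) * flat 1 (k * (b ord0 i - x ord0 i))).

Lemma coord_algebra_bump k a b : coord_algebra (bump k a b).
Proof.
apply: (@coord_algebra_prod _ _ (fun i t => flat 1 (k * (t - a ord0 i)) * flat 1 (k * (b ord0 i - t)))).
move=> i; apply: FlatMul.
  rewrite (_ : (fun _ => _) = (fun t => flat 1 (k * t + - (k * a ord0 i)))).
    exact: FlatBase.
  by apply/funext => t; congr flat; ring.
rewrite (_ : (fun _ => _) = (fun t => flat 1 (- k * t + (k * b ord0 i)))).
  exact: FlatBase.
by apply/funext => t; congr flat; ring.
Qed.

Lemma bump_ge0 k a b x : 0 <= bump k a b x.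
Proof. by apply: prodr_ge0 => i _; rewrite mulr_ge0// flat1_ge0. Qed.

Lemma bump_le1 k a b x : bump k a b x <= 1.
Proof.
rewrite (_ : 1 = \prod_(i < N) 1); last by rewrite big1_eq.
rewrite /bump; apply: ler_prod => i _; rewrite mulr_ge0 ?flat1_ge0//=.
by rewrite -[leRHS]mulr1 ler_pM ?flat1_ge0// flat1_le1.
Qed.

Lemma bump_eq0 (k : R) (a b x : V) : 0 <= k ->
  (exists i, ~~ (a ord0 i < x ord0 i < b ord0 i)) -> bump k a b x = 0.
Proof.
move=> k0 [i]; rewrite negb_and -!leNgt /bump (bigD1 i)//= => /orP[h|h].
  by rewrite [X in X * _ * _]flat_le0 ?mul0r// mulr_ge0_le0// subr_le0.
by rewrite [X in _ * X * _]flat_le0 ?mulr0 ?mul0r// mulr_ge0_le0// subr_le0.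
Qed.

(* lower bound for the product of the one-dimensional profiles on the half cube *)
Let c0 : R := flat 1 (2^-1 : R) * flat 1 (2^-1 : R).

Let c0_gt0 : 0 < c0.
Proof. by rewrite mulr_gt0// flat1_gt0// invr_gt0. Qed.

Definition kernel (eps : R) : V -> R := bump eps^-1 (const_mx (- eps)) (const_mx eps).

Lemma kernel_eq0 eps x : 0 < eps -> ~ cube 0 eps x -> kernel eps x = 0.
Proof.
move=> e0 /existsNP[i /negP xi]; apply: bump_eq0; first by rewrite invr_ge0 ltW.
by exists i; move: xi; rewrite !mxE subr0; apply: contra; rewrite -ltr_norml; exact: ltW.
Qed.

Lemma kernel_ge eps x : 0 < eps -> cube 0 (eps / 2) x -> c0 ^+ N <= kernel eps x.
Proof.
move=> e0 xe; rewrite /kernel /bump -[N in c0 ^+ N]card_ord -prodr_const.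
apply: ler_prod => i _; rewrite (ltW c0_gt0)/=.
have := xe i; rewrite !mxE subr0 ler_norml => /andP[x1 x2].
apply: ler_pM; rewrite ?flat1_ge0//; apply: flat1_le.
  by rewrite ler_pdivlMl//; lra.
by rewrite ler_pdivlMl//; lra.
Qed.

Lemma continuous_bump k a b : continuous (bump k a b).
Proof. by apply: coord_algebra_continuous; exact: coord_algebra_bump. Qed.

Lemma measurable_bump k a b : measurable_fun setT (bump k a b).
Proof. by apply: continuous_measurable_rV; exact: continuous_bump. Qed.

Definition mollifier (eps : R) (x : V) : R := kernel eps x / fine (\int[leb]_x (kernel eps x)%:E).

(** Independent of [eps]: the kernel is at most [1] and is at least [c0^N] on a cube of side [eps],
    so the normalized kernel is at most this constant times [eps^(-N)]. *)
Definition mollifier_bound : R := (c0 ^+ N)^-1.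

Lemma mollifier_bound_gt0 : 0 < mollifier_bound.
Proof. by rewrite invr_gt0 exprn_gt0. Qed.

Lemma kernel_mass (eps : R) : 0 < eps ->
  exists2 Z : R, c0 ^+ N * eps ^+ N <= Z & (\int[leb]_x (kernel eps x)%:E = Z%:E)%E.
Proof.
move=> e0.
have ub : (\int[leb]_x (kernel eps x)%:E <= ((2 * eps) ^+ N)%:E)%E.
  apply: (@le_trans _ _ (\int[leb]_x (1 * \1_(cube 0 eps) x)%:E)%E).
    apply: le_int; first exact: measurable_bump.
    - by apply: measurable_funM => //; apply: measurable_indic; exact: measurable_cube.
    - by move=> x; exact: bump_ge0.
    - move=> x; rewrite mul1r indicE.
      have [xe|xe] := pselect (cube 0 eps x); first by rewrite mem_set// bump_le1.
      by rewrite kernel_eq0.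
  by rewrite int_indic//; [rewrite mul1e leb_cube// ltW|exact: measurable_cube].
have lb : ((c0 ^+ N * eps ^+ N)%:E <= \int[leb]_x (kernel eps x)%:E)%E.
  have := @markov_int _ _ _ leb (kernel eps) (c0 ^+ N) (cube 0 (eps / 2))
    (@measurable_cube _ _ _ _) (measurable_bump _ _ _) (fun x => bump_ge0 _ _ _ x).
  rewrite leb_cube ?divr_ge0 ?(ltW e0)// (_ : 2 * (eps / 2) = eps); last by field.
  rewrite -EFinM; apply.
    by rewrite exprn_ge0// ltW.
  by move=> x; exact: kernel_ge.
move: ub lb; case: (integral _ _ _) => [Z||]//; rewrite !lee_fin => _ lb.
by exists Z.
Qed.

Lemma mollifierP eps : 0 < eps ->
  [/\ coord_algebra (mollifier eps), forall x, 0 <= mollifier eps x,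
      forall x, mollifier eps x <= mollifier_bound * (eps ^+ N)^-1,
      forall x, ~ cube 0 eps x -> mollifier eps x = 0
    & (\int[leb]_x (mollifier eps x)%:E = 1)%E].
Proof.
move=> e0; have [Z ZB ZE] := kernel_mass e0; rewrite /mollifier ZE /=.
have c0N : 0 < c0 ^+ N * eps ^+ N by rewrite mulr_gt0// exprn_gt0.
have Z0 : 0 < Z by exact: lt_le_trans ZB.
split.
- by apply: CoordMul; [exact: coord_algebra_bump|exact: CoordCst].
- by move=> x; rewrite divr_ge0 ?bump_ge0// ltW.
- move=> x; rewrite -invfM -[leRHS]mul1r ler_pM ?bump_ge0 ?bump_le1 ?invr_ge0 ?(ltW Z0)//.
  by rewrite lef_pV2.
- by move=> x xe; rewrite kernel_eq0// mul0r.
- under eq_integral do rewrite mulrC.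
  rewrite intZ ?invr_ge0 ?(ltW Z0)//; last 2 first.
    exact: measurable_bump.
    by move=> x; exact: bump_ge0.
  by rewrite ZE -EFinM mulVf// gt_eqF.
Qed.

End mollifiers.

(** * Lipschitz estimates by coordinates *)

Section coordinate_lipschitz.
Context {R : realType} {N : nat}.
Local Notation V := 'rV[R]_N.
Local Notation e i := (delta_mx ord0 i : V).

Lemma rV_sum_delta (z : V) : z = \sum_i z ord0 i *: e i.
Proof. exact: row_sum_delta. Qed.

(** The increment is made one coordinate at a time, so bounds on the partial derivatives suffice. *)
Lemma lipschitz_coord (f : V -> R) (df : 'I_N -> V -> R) (L : R) :
  (forall i x, is_derive x (e i) f (df i x)) -> (forall i x, `|df i x| <= L) ->
  forall x z, `|f (x + z) - f x| <= L * \sum_i `|z ord0 i|.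
Proof.
move=> fd dL x z; rewrite {1}(rV_sum_delta z).
elim: (index_enum _) x => [|i s IH] x; first by rewrite !big_nil addr0 subrr normr0 mulr0.
rewrite !big_cons addrA mulrDr.
rewrite (le_trans (ler_distD (f (x + z ord0 i *: e i)) _ _))// [leRHS]addrC lerD//.
rewrite mulrC; apply: (@mvt_line _ _ f (df i) (e i) x) => // s0 _; exact: dL.
Qed.

Lemma continuous_of_lipschitz (f : V -> R) :
  (forall x : V, exists L : R, forall z : V, (forall i, `|z ord0 i| <= 1) ->
    `|f (x + z) - f x| <= L * \sum_i `|z ord0 i|) -> continuous f.
Proof.
move=> H x; have [L HL] := H x.
apply/(@cvgrPdist_le _ _ _ (nbhs (x : V)) (nbhs_filter (x : V))) => eps e0.
pose d := Num.min 1 (eps / ((`|L| + 1) * (N%:R + 1))).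
have K0 : 0 < (`|L| + 1) * (N%:R + 1) by rewrite mulr_gt0// ltr_wpDl.
have d0 : 0 < d by rewrite lt_min ltr01 divr_gt0.
near=> y.
have yx : `|x - y| <= d.
  by near: y; apply/nbhs_ballP; exists d => //= y; rewrite -ball_normE /= => /ltW.
have hc i : `|(y - x) ord0 i| <= d.
  apply: le_trans yx; rewrite distrC [leRHS]/Num.norm /= mx_normrE.
  by apply/bigmax_geP; right; exists (ord0, i).
have hc1 i : `|(y - x) ord0 i| <= 1 by apply: le_trans (hc i) _; rewrite /d ge_min lexx.
have := HL (y - x) hc1; rewrite [x + _]addrC subrK distrC => h; apply: (le_trans h).
have S : \sum_i `|(y - x) ord0 i| <= N%:R * d.
  rewrite -[N in N%:R]card_ord -sum1_card natr_sum mulr_suml ler_sum// => i _.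
  by rewrite mul1r.
have S0 : 0 <= \sum_i `|(y - x) ord0 i| by apply: sumr_ge0.
apply: (@le_trans _ _ ((`|L| + 1) * (N%:R + 1) * d)).
  apply: (@le_trans _ _ (`|L| * (N%:R * d))).
    by apply: le_trans (ler_wpM2r S0 (ler_norm L)) _; apply: ler_wpM2l.
  rewrite mulrA ler_wpM2r ?(ltW d0)// ler_pM//; first by rewrite lerDl.
  by rewrite lerDl.
rewrite mulrC -ler_pdivlMr//; by rewrite ge_min lexx orbT.
Unshelve. all: end_near. Qed.

End coordinate_lipschitz.

(** * Mollification and weak derivatives *)

Section mollification.
Context {R : realType} {N : nat}.
Local Notation V := 'rV[R]_N.
Local Notation e i := (delta_mx ord0 i : V).
Implicit Types (psi u g h : V -> R) (c x y z : V) (r : R).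
Local Notation leb := (measure_function_SigmaFiniteMeasure__to__measure_function_Measure (lebesgue_rV R N)).

Lemma coord_algebra_bounded psi r : coord_algebra psi -> (forall x, ~ cube 0 r x -> psi x = 0) ->
  exists2 M : R, 0 < M & forall x, `|psi x| <= M.
Proof.
move=> /coord_algebra_continuous cpsi psi0.
have [M M0 fM] := continuous_bounded_cube 0 r cpsi; exists M => // x.
by have [/fM //|/psi0 ->] := pselect (cube 0 r x); rewrite normr0 ltW.
Qed.

Lemma derive_supp (F dF : V -> R) i r : (forall x, is_derive x (e i) F (dF x)) ->
  (forall x, ~ cube 0 r x -> F x = 0) -> forall x, ~ cube 0 r x -> dF x = 0.
Proof.
move=> Fd F0 x xr.
have oc : open (~` cube (0 : V) r).
  by apply: closed_openC; apply: compact_closed; [exact: norm_hausdorff|exact: compact_cube].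
have : is_derive x (e i) F 0.
  apply: (near_eq_is_derive _ (is_derive_cst (0 : R) x (e i))).
  have : nbhs x (~` cube (0 : V) r) by exact: open_nbhs_nbhs.
  by apply: filterS => y /F0.
by move=> [_ <-]; case: (Fd x).
Qed.

Lemma cube_shift (c : V) (r : R) (x z : V) : cube c r (x - z) <-> cube (c + z) r x.
Proof.
by split=> h i; have := h i; rewrite !mxE opprD; congr (`|_| <= _); ring.
Qed.

(** A correlation rather than a convolution: as a function of [y], the factor [psi (y - x)] is
    itself a test function, and differentiation in [x] produces the sign that the definition of a
    weak derivative cancels. *)
Definition mol psi u (x : V) : R := \int[leb]_y (u y * psi (y - x)).

Lemma loc_integrable_int_cube u c r : loc_integrable u ->
  exists2 A : R, 0 <= A & (\int[leb]_y (`|u y| * \1_(cube c r) y)%:E = A%:E)%E.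
Proof.
move=> [mu iu]; have := iu _ (@compact_cube _ _ c r).
move=> /integrableP[_ h].
have E : (\int[leb]_y (`|u y| * \1_(cube c r) y)%:E = \int[leb]_(y in cube c r) `|(u y)%:E|)%E.
  rewrite [RHS]integral_mkcond; apply: eq_integral => y _; rewrite patchE indicE.
  by case: ifP; rewrite ?mulr1 ?mulr0.
have ge0 : (0 <= \int[leb]_y (`|u y| * \1_(cube c r) y)%:E)%E.
  by apply: integral_ge0 => y _; rewrite lee_fin mulr_ge0.
exists (fine (\int[leb]_y (`|u y| * \1_(cube c r) y)%:E)); first exact: fine_ge0.
by rewrite fineK// ge0_fin_numE// E.
Qed.

Lemma loc_integrable_mul u h c r (M : R) : loc_integrable u -> measurable_fun setT h ->
  (forall y, `|h y| <= M) -> (forall y, ~ cube c r y -> h y = 0) ->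
  leb.-integrable setT (fun y => (u y * h y)%:E).
Proof.
move=> lu mh hM h0.
have [A A0 AE] := loc_integrable_int_cube c r lu; case: lu => mu _.
have M0 : 0 <= M by exact: le_trans (normr_ge0 _) (hM 0).
have mc : measurable_fun setT (fun y => `|u y| * \1_(cube c r) y).
  apply: measurable_funM; first exact: measurableT_comp.
  by apply: measurable_indic; exact: measurable_cube.
apply/integrableP; split; first by apply/measurable_EFinP; exact: measurable_funM.
apply: (@le_lt_trans _ _ (\int[leb]_y (M * (`|u y| * \1_(cube c r) y))%:E)%E).
  apply: le_int.
  - by apply: measurableT_comp => //; exact: measurable_funM.
  - exact: measurable_funM.
  - by [].
  - move=> y; rewrite normrM indicE.
    have [yc|/h0 ->] := pselect (cube c r y).
      by rewrite mem_set// mulr1 mulrC ler_wpM2r.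
    by rewrite normr0 mulr0 mulr_ge0// mulr_ge0.
by rewrite intZ// AE -EFinM ltry.
Qed.

Lemma mol_integrable psi u x r : loc_integrable u -> coord_algebra psi ->
  (forall x, ~ cube 0 r x -> psi x = 0) ->
  leb.-integrable setT (fun y => (u y * psi (y - x))%:E).
Proof.
move=> lu cpsi psi0; have [M M0 psiM] := coord_algebra_bounded cpsi psi0.
apply: (@loc_integrable_mul u _ x r M) => // [|y yx].
  apply: continuous_measurable_rV; apply: coord_algebra_continuous.
  exact: coord_algebra_shift.
by apply: psi0 => /cube_shift; rewrite add0r.
Qed.

(** [psi] is Lipschitz because its partial derivatives are bounded, and [u] is integrable on the
    cube of radius [|r| + 1], which contains all supports involved for increments at most [1]. So
    [mol psi u] is locally Lipschitz. *)
Lemma continuous_mol psi u r : loc_integrable u -> coord_algebra psi ->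
  (forall x, ~ cube 0 r x -> psi x = 0) -> continuous (mol psi u).
Proof.
move=> lu cpsi psi0.
have /choice[dpsi dpsiP] : forall i, exists dF, coord_algebra dF /\ forall x, is_derive x (e i) psi (dF x).
  by move=> i; have [dF ? ?] := coord_algebra_derive i cpsi; exists dF.
have /choice[L LP] : forall i, exists L : R, 0 < L /\ forall x, `|dpsi i x| <= L.
  move=> i; have [cd pd] := dpsiP i.
  by have [L ? ?] := coord_algebra_bounded cd (derive_supp pd psi0); exists L.
have sL i : L i <= \sum_j L j.
  by rewrite (bigD1 i)//= lerDl sumr_ge0// => j _; apply: ltW; case: (LP j).
have psiL := lipschitz_coord (fun i x => (dpsiP i).2 x) (fun i x => le_trans ((LP i).2 x) (sL i)).
have L0 : 0 <= \sum_j L j by apply: sumr_ge0 => j _; apply: ltW; case: (LP j).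
apply: continuous_of_lipschitz => x.
have [A A0 AE] := loc_integrable_int_cube x (`|r| + 1) lu.
exists ((\sum_j L j) * A) => z z1.
set S := \sum_i `|z ord0 i|.
have S0 : 0 <= S by apply: sumr_ge0.
have mpsi : measurable_fun setT psi.
  by apply: continuous_measurable_rV; exact: coord_algebra_continuous.
have ms a : measurable_fun setT (fun y : V => psi (y - a)).
  exact: (measurableT_comp mpsi (measurable_rV_shift (- a))).
rewrite /mol -RintegralB//; [|exact: (mol_integrable _ lu cpsi psi0)|exact: (mol_integrable _ lu cpsi psi0)].
have mu : measurable_fun setT u by case: lu.
have iB : leb.-integrable setT (EFin \o (fun y => u y * psi (y - (x + z)) - u y * psi (y - x))).
  apply: (@eq_integrable _ _ _ _ setT measurableT _ _ _ (integrableB _ (mol_integrable (x + z) lu cpsi psi0) (mol_integrable x lu cpsi psi0))) => //.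
apply: (le_trans (le_normr_Rintegral _ _)) => //.
rewrite -lee_fin /Rintegral fineK; last first.
  by apply: integrable_fin_num => //; apply: integrable_norm.
apply: (@le_trans _ _ (\int[leb]_y (((\sum_j L j) * S) * (`|u y| * \1_(cube x (`|r| + 1)) y))%:E)%E); last first.
  rewrite intZ ?mulr_ge0//.
    by rewrite AE -EFinM lee_fin mulrAC.
  apply: measurable_funM; first exact: measurableT_comp.
  by apply: measurable_indic; exact: measurable_cube.
apply: le_int => //.
- apply: measurableT_comp => //; apply: measurable_funB; exact: measurable_funM.
- apply: measurable_funM => //; apply: measurable_funM; first exact: measurableT_comp.
  by apply: measurable_indic; exact: measurable_cube.
move=> y; rewrite -mulrBr normrM indicE.
have [yc|yc] := pselect (cube x (`|r| + 1) y).
  rewrite mem_set// mulr1 mulrC ler_wpM2r//.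
  have := psiL (y - (x + z)) z; rewrite opprD addrA subrK distrC => h; apply: (le_trans h).
  exact: lexx.
rewrite memNset// mulr0 mulr0 !psi0 ?subrr ?normr0 ?mulr0//.
  move=> /cube_shift; rewrite add0r => yx; apply: yc; apply: cubeW yx.
  by rewrite (le_trans (ler_norm r))// lerDl.
move=> yx; apply: yc => i; have := yx i; rewrite !mxE subr0 opprD addrA => h.
rewrite -[X in `|X|](subrK (z ord0 i)) (le_trans (ler_normD _ _))// lerD//.
by rewrite (le_trans h)// ler_norm.
Qed.

(** Differentiation under the integral sign in the line parameter, restricted to []-1, 1[] so that
    one multiple of [|u|] on an enlarged cube dominates. *)
Lemma is_derive_mol psi dpsi u i r x : loc_integrable u ->
  coord_algebra psi -> coord_algebra dpsi ->
  (forall x, is_derive x (e i) psi (dpsi x)) ->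
  (forall x, ~ cube 0 r x -> psi x = 0) ->
  is_derive x (e i) (mol psi u) (- mol dpsi u x).
Proof.
move=> lu cpsi cd pd psi0.
have d0 := derive_supp pd psi0.
have [L L0 dL] := coord_algebra_bounded cd d0.
pose f (s : R) (y : V) := u y * psi (y - (x + s *: e i)).
have fd (s : R) y : is_derive s 1 (f ^~ y) (- (u y * dpsi (y - (x + s *: e i)))).
  have gd (t : R) : is_derive t 1 (fun t => psi (y - x + t *: e i)) (dpsi (y - x + t *: e i)).
    by apply: (is_derive_lineP _ _ _ _ _).1.
  have hd : is_derive s 1 (fun s => psi (y - x + (- s) *: e i)) (dpsi (y - x + (- s) *: e i) * -1).
    exact: (@is_derive1_comp _ (fun t => psi (y - x + t *: e i)) -%R _ _ _ (gd _)).
  rewrite (_ : f ^~ y = fun s => u y * psi (y - x + (- s) *: e i)); last first.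
    by apply/funext => t; rewrite /f scaleNr opprD addrA.
  apply: (is_derive_eqr (is_derive_mulf (is_derive_cst (u y) s 1) hd)).
  by rewrite /cst scaleNr opprD addrA; ring.
have md : measurable_fun setT dpsi.
  by apply: continuous_measurable_rV; exact: coord_algebra_continuous.
pose G y := L * (`|u y| * \1_(cube x (`|r| + 1)) y).
have [A A0 AE] := loc_integrable_int_cube x (`|r| + 1) lu.
have mu : measurable_fun setT u by case: lu.
have mc : measurable_fun setT (fun y => `|u y| * \1_(cube x (`|r| + 1)) y).
  apply: measurable_funM; first exact: measurableT_comp.
  by apply: measurable_indic; exact: measurable_cube.
have G0 y : 0 <= G y by rewrite !mulr_ge0// ltW.
have iG : leb.-integrable setT (EFin \o G).
  apply/integrableP; split; first by apply/measurable_EFinP; exact: measurable_funM.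
  under eq_integral do rewrite /= ger0_norm//.
  by rewrite intZ ?(ltW L0)// AE -EFinM ltry.
have I0 : `](-1 : R), 1[%classic 0 by rewrite /= in_itv/=; apply/andP; split; lra.
have fi (s : R) : `](-1 : R), 1[%classic s -> leb.-integrable setT (EFin \o f s).
  by move=> _; exact: (mol_integrable _ lu cpsi psi0).
have f1 (s : R) y : `](-1 : R), 1[%classic s -> setT y -> derivable (f ^~ y) s 1.
  by move=> _ _; case: (fd s y).
have d1E s y : partial1of2 f s y = - (u y * dpsi (y - (x + s *: e i))).
  by rewrite partial1of2E; case: (fd s y).
have fG (s : R) y : `](-1 : R), 1[%classic s -> setT y -> `|partial1of2 f s y| <= G y.
  rewrite /= in_itv/= => /andP[s1 s2] _; rewrite d1E normrN normrM /G mulrCA indicE.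
  have [yc|yc] := pselect (cube x (`|r| + 1) y); first by rewrite mem_set// mulr1 ler_wpM2l.
  rewrite d0 ?normr0 ?mulr0//; first by rewrite !mulr_ge0// ltW.
  move=> yx; apply: yc => j; have := yx j; rewrite !mxE subr0 opprD addrA => h.
  rewrite -[X in `|X|](subrK (s * (true && (j == i))%:R)) (le_trans (ler_normD _ _))// lerD//.
    by rewrite (le_trans h)// ler_norm.
  case: (j == i); rewrite /= ?mulr1 ?mulr0 ?normr0// ler_norml; apply/andP; split; lra.
have D1 := derivable_under_integral measurableT I0 fi f1 G0 iG fG.
have D2 := differentiation_under_integral measurableT I0 fi f1 G0 iG fG.
have D : is_derive (0 : R) 1 (fun s => mol psi u (x + s *: e i)) (- mol dpsi u x).
  split => //; rewrite -derive1E [LHS]D2 /mol.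
  rewrite -[RHS]mulN1r -RintegralZl//; last exact: (mol_integrable _ lu cd d0).
  by apply: eq_Rintegral => y _; rewrite d1E scale0r addr0 mulN1r.
have := (is_derive_lineP (mol psi u) (e i) x 0 (- mol dpsi u x)).2 D.
by rewrite scale0r addr0.
Qed.

Lemma is_weak_partials_mol s psi u g r x : is_weak_partials s u g ->
  coord_algebra psi -> (forall x, ~ cube 0 r x -> psi x = 0) ->
  mol (partials s psi) u x = (-1) ^+ size s * mol psi g x.
Proof.
move=> [lu lg ug] cpsi psi0.
have psit : test_function (fun y => psi (y - x)).
  apply: (@coord_algebra_test _ _ _ x r); first exact: coord_algebra_shift.
  by move=> y yx; apply: psi0 => /cube_shift; rewrite add0r.
rewrite /mol -ug//; apply: eq_Rintegral => y _; congr (_ * _).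
suff : partials s (fun y => psi (y - x)) = (fun y => partials s psi (y - x)) by move=> ->.
elim: s {ug} => [//|i s IH] /=; rewrite IH; apply/funext => w.
rewrite /derive.
rewrite (_ : (fun k : R => k^-1 *: (partials s psi (k *: e i + w - x) - partials s psi (w - x))) =
  (fun k : R => k^-1 *: (partials s psi (k *: e i + (w - x)) - partials s psi (w - x)))) //.
by apply/funext => k; rewrite addrA.
Qed.

Lemma weak_partial_mol i psi u g r x : is_weak_partials [:: i] u g ->
  coord_algebra psi -> (forall x, ~ cube 0 r x -> psi x = 0) ->
  is_derive x (e i) (mol psi u) (mol psi g x).
Proof.
move=> ug cpsi psi0; have [dpsi cd pd] := coord_algebra_derive i cpsi.
have lu : loc_integrable u by case: ug.
apply: (is_derive_eqr (is_derive_mol x lu cpsi cd pd psi0)).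
have := is_weak_partials_mol x ug cpsi psi0.
rewrite /= expr1 mulN1r (_ : (fun _ => _) = dpsi); first by move=> ->; rewrite opprK.
by apply/funext => y; case: (pd y).
Qed.

(** The hypothesis on [h] speaks of [u], not of [g]. Hence [mol psi g] is first rewritten as
    [- mol dpsi u], both derivatives fall on [psi], and the second weak derivative of [u] takes them
    back. *)
Lemma weak_second_partial_mol i psi u g h r x : is_weak_partials [:: i] u g ->
  is_weak_partials [:: i; i] u h ->
  coord_algebra psi -> (forall x, ~ cube 0 r x -> psi x = 0) ->
  is_derive x (e i) (mol psi g) (mol psi h x).
Proof.
move=> ug uh cpsi psi0; have [dpsi cd pd] := coord_algebra_derive i cpsi.
have [ddpsi cdd pdd] := coord_algebra_derive i cd.
have lu : loc_integrable u by case: ug.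
have d0 := derive_supp pd psi0.
have dE : (fun y => 'D_(e i) psi y) = dpsi by apply/funext => y; case: (pd y).
have ddE : (fun y => 'D_(e i) dpsi y) = ddpsi by apply/funext => y; case: (pdd y).
have gE : mol psi g = (fun y => - mol dpsi u y).
  apply/funext => y; have := is_weak_partials_mol y ug cpsi psi0.
  by rewrite /= expr1 mulN1r dE => ->; rewrite opprK.
rewrite gE; apply: (is_derive_eqr (is_deriveN (is_derive_mol x lu cd cdd pdd d0))).
rewrite opprK; have := is_weak_partials_mol x uh cpsi psi0.
by rewrite /= dE ddE sqrrN expr1n mul1r.
Qed.

End mollification.

(** * Elementary inequalities for powers *)

Section powR_inequalities.
Context {R : realType}.
Implicit Types (a b p : R).

Lemma powR_add_le p a b : 0 <= p -> 
  `|a + b| `^ p <= 2 `^ p * (`|a| `^ p + `|b| `^ p).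
Proof.
move=> p0; wlog ab : a b / `|a| <= `|b|.
  move=> H; have [/H//|/ltW /H] := leP `|a| `|b|.
  by rewrite addrC [X in _ <= _ * X]addrC.
have h : `|a + b| <= 2 * `|b| by rewrite (le_trans (ler_normD _ _))//; lra.
apply: le_trans (ge0_ler_powR p0 _ _ h) _; rewrite ?nnegrE// ?mulr_ge0//.
by rewrite powRM// ler_wpM2l ?powR_ge0// lerDr powR_ge0.
Qed.

(** Depending on whether [b <= k * a], one of the two terms alone dominates. The constants are not
    sharp, but the coefficient of [a^p] can be made as small as desired. *)
Lemma young_split p a b (k : R) : 1 < p -> 0 <= a -> 0 <= b -> 0 < k ->
  a `^ (p - 1) * b <= k * a `^ p + k `^ (1 - p) * b `^ p.
Proof.
move=> p1 a0 b0 k0; have [bka|kab] := leP b (k * a).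
  apply: (@le_trans _ _ (k * a `^ p)); last by rewrite lerDl mulr_ge0// powR_ge0.
  rewrite -(@mulr_powRB1 _ a p)//; last by lra.
  by rewrite mulrA mulrC ler_wpM2r ?powR_ge0.
apply: (@le_trans _ _ (k `^ (1 - p) * b `^ p)); last by rewrite lerDr mulr_ge0 ?powR_ge0// ltW.
rewrite -(@mulr_powRB1 _ b p)//; last by lra.
rewrite [b * _]mulrC mulrA ler_wpM2r//.
have ab : a <= b / k by rewrite ler_pdivlMr// mulrC ltW.
apply: le_trans (ge0_ler_powR _ _ _ ab) _; rewrite ?nnegrE ?divr_ge0 ?(ltW k0)//; first by lra.
rewrite powRM ?invr_ge0 ?(ltW k0)// mulrC -powR_inv1 ?(ltW k0)// -powRrM.
by rewrite (_ : -1 * (p - 1) = 1 - p)//; ring.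
Qed.

End powR_inequalities.

(** * Power-mean estimates for mollifications and increments *)

Section kernel_averages.
Context {R : realType} {N : nat}.
Local Notation V := 'rV[R]_N.
Local Notation leb := (measure_function_SigmaFiniteMeasure__to__measure_function_Measure (lebesgue_rV R N)).
Local Notation e i := (delta_mx ord0 i : V).
Implicit Types (psi phi u v g h : V -> R) (r p : R).

Lemma measurable_rV_add :
  measurable_fun setT (fun xz : V * V => xz.1 + xz.2).
Proof.
apply: measurable_fun_rV => i.
rewrite (_ : (fun _ => _) = (fun xz : V * V => xz.1 ord0 i + xz.2 ord0 i)); last first.
  by apply/funext => xz; rewrite mxE.
by apply: measurable_funD; [exact: (measurableT_comp (@measurable_rV_coord _ _ _ i) measurable_fst)|
  exact: (measurableT_comp (@measurable_rV_coord _ _ _ i) measurable_snd)].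
Qed.

Lemma measurable_powR_norm d (T : measurableType d) (f : T -> R) p :
  measurable_fun setT f -> measurable_fun setT (fun x => `|f x| `^ p).
Proof.
move=> mf; apply: (measurableT_comp (@measurable_powR R p)).
exact: measurableT_comp.
Qed.

(** Exchanging the integrals bounds a [w]-average of integrals by their common bound. It serves two
    averages: over the shifts of a kernel and over the points of a segment. *)
Lemma weighted_tonelli_le d (T : measurableType d) (m : {sigma_finite_measure set T -> \bar R})
    (F : V * T -> R) (w : T -> R) (C : \bar R) :
  measurable_fun setT F -> measurable_fun setT w ->
  (forall xz, 0 <= F xz) -> (forall z, 0 <= w z) ->
  (\int[m]_z (w z)%:E = 1)%E ->
  (forall z, 0 < w z -> (\int[leb]_x (F (x, z))%:E <= C)%E) ->
  (\int[leb]_x \int[m]_z (F (x, z) * w z)%:E <= C)%E.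
Proof.
move=> mF mw F0 w0 w1 FC.
have mFw : measurable_fun setT (fun xz : V * T => (F xz * w xz.2)%:E).
  apply/measurable_EFinP; apply: measurable_funM => //.
  exact: (measurableT_comp mw measurable_snd).
rewrite (@fubini_tonelli _ _ _ _ _ (lebesgue_rV R N) m (fun xz => (F xz * w xz.2)%:E)) //; last first.
  by move=> xz; rewrite lee_fin mulr_ge0.
(* The total mass is [1], so some [z] has positive weight, and its bound shows that [C] is
   nonnegative. *)
have C0 : (0 <= C)%E.
  have [z wz] : exists z, 0 < w z.
    apply: contrapT => /forallNP w_le0.
    have : (\int[m]_z (w z)%:E = 0)%E.
      apply: integral0_eq => z _; have := w_le0 z; move/negP; rewrite -leNgt => wz.
      by congr EFin; apply/eqP; rewrite eq_le wz w0.
    by rewrite w1 => /eqP; rewrite onee_eq0.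
  by apply: le_trans (FC z wz); apply: integral_ge0 => x _; rewrite lee_fin.
have mFs z : measurable_fun setT (fun x : V => F (x, z)).
  apply: (measurableT_comp mF); exact: pair2_measurable.
apply: (@le_trans _ _ (\int[m]_z (C * (w z)%:E))%E); last first.
  by rewrite ge0_integralZl//= ?w1 ?mule1//; [exact/measurable_EFinP|by move=> z _; rewrite lee_fin].
apply: ge0_le_integral => //.
- by move=> z _; apply: integral_ge0 => x _; rewrite lee_fin mulr_ge0.
- apply: (@measurable_fun_fubini_tonelli_G _ _ _ _ _ (lebesgue_rV R N) (fun xz => (F xz * w xz.2)%:E)) => //.
  by move=> xz; rewrite lee_fin mulr_ge0.
- by apply: emeasurable_funM => //; exact/measurable_EFinP.
move=> z _ /=; under eq_integral do rewrite mulrC.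
rewrite intZ//; have [wz|] := ltP 0 (w z).
  by rewrite muleC lee_wpmul2r// ?lee_fin ?FC.
move=> wz; have -> : w z = 0 by apply/eqP; rewrite eq_le wz w0.
by rewrite mule0 mul0e.
Qed.

Definition averaging psi r := [/\ coord_algebra psi, forall x, 0 <= psi x,
  forall x, ~ cube 0 r x -> psi x = 0 & (\int[leb]_x (psi x)%:E = 1)%E].

Lemma averaging_mollifier (eps : R) : 0 < eps -> averaging (mollifier eps) eps.
Proof. by move=> /(@mollifierP R N)[]. Qed.

Lemma mol_shiftE psi u (x : V) : measurable_fun setT (fun y => u y * psi (y - x)) ->
  mol psi u x = \int[leb]_z (u (x + z) * psi z).
Proof.
move=> mf; rewrite /mol /Rintegral -(@integral_shift _ _ x (fun y => (u y * psi (y - x))%:E)).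
  by congr fine; apply: eq_integral => z _; rewrite addrK addrC.
exact/measurable_EFinP.
Qed.

(** Jensen with the kernel as density. The choice [a = 0] leads to the contraction of [p]-th power
    integrals, [a = u x] to the approximation error. *)
Lemma mol_powR_le psi r u (x : V) (a p : R) : loc_integrable u -> averaging psi r -> 1 < p ->
  ((`|mol psi u x - a| `^ p)%:E <= \int[leb]_z (`|u (x + z) - a| `^ p * psi z)%:E)%E.
Proof.
move=> lu [cpsi psi0 psir psi1] p1.
have mu : measurable_fun setT u by case: lu.
have mpsi : measurable_fun setT psi.
  by apply: continuous_measurable_rV; exact: coord_algebra_continuous.
have iu := mol_integrable x lu cpsi psir.
have mupsi : measurable_fun setT (fun y => u y * psi (y - x)).
  by apply/measurable_EFinP; case/integrableP: iu.
have mus : measurable_fun setT (fun z => u (x + z)).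
  rewrite (_ : (fun _ => _) = (fun z => u (z + x))); last by apply/funext => z; rewrite addrC.
  exact: (measurableT_comp mu (measurable_rV_shift x)).
have ius : leb.-integrable setT (fun z => (u (x + z) * psi z)%:E).
  have := integrable_shift x iu; apply: eq_integrable => // z _ /=.
  by rewrite addrK addrC.
have ipsi : leb.-integrable setT (EFin \o psi).
  apply/integrableP; split; first exact/measurable_EFinP.
  by under eq_integral do rewrite /= ger0_norm//; rewrite psi1 ltry.
have iapsi : leb.-integrable setT (EFin \o (fun z => a * psi z)).
  exact: (integrableZl measurableT a ipsi).
apply: jensen_powR => //.
  by apply: measurableT_comp => //; exact: measurable_funB.
rewrite mol_shiftE//.
have -> : a = \int[leb]_z (a * psi z) by rewrite RintegralZl// /Rintegral psi1/= mulr1.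
rewrite -RintegralB//.
have ib : leb.-integrable setT (EFin \o (fun z => u (x + z) * psi z - a * psi z)).
  exact: (integrableB _ ius iapsi).
rewrite EFin_normr_Rintegral//; apply: le_trans (le_abse_integral _ _ _) _ => //.
  by case/integrableP: ib.
rewrite le_eqVlt; apply/orP; left; apply/eqP; apply: eq_integral => z _ /=.
rewrite RintegralZl// /Rintegral psi1/= mulr1 -mulrBl normrM.
by rewrite (ger0_norm (psi0 z)).
Qed.

Lemma int_mol_powR psi r u p : loc_integrable u -> averaging psi r -> 1 < p ->
  (\int[leb]_x (`|mol psi u x| `^ p)%:E <= \int[leb]_x (`|u x| `^ p)%:E)%E.
Proof.
move=> lu av p1; have [cpsi psi0 psir psi1] := av.
have mu : measurable_fun setT u by case: lu.
have mpsi : measurable_fun setT psi.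
  by apply: continuous_measurable_rV; exact: coord_algebra_continuous.
have mF : measurable_fun setT (fun xz : V * V => `|u (xz.1 + xz.2)| `^ p).
  by apply: measurable_powR_norm; exact: (measurableT_comp mu measurable_rV_add).
apply: (@le_trans _ _ (\int[leb]_x \int[leb]_z (`|u (x + z)| `^ p * psi z)%:E)%E).
  apply: ge0_le_integral => //.
  - apply/measurable_EFinP; apply: measurable_powR_norm; apply: continuous_measurable_rV.
    exact: (continuous_mol lu cpsi psir).
  - apply: (@measurable_fun_fubini_tonelli_F _ _ _ _ _ (lebesgue_rV R N)
      (fun xz : V * V => (`|u (xz.1 + xz.2)| `^ p * psi xz.2)%:E)) => //.
      apply/measurable_EFinP; apply: measurable_funM => //.
      exact: (measurableT_comp mpsi measurable_snd).
    by move=> xz; rewrite lee_fin mulr_ge0// powR_ge0.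
  move=> x _; have := mol_powR_le x 0 lu av p1; rewrite subr0.
  by under [X in (_ <= X)%E -> _]eq_integral do rewrite subr0.
apply: (@weighted_tonelli_le _ _ (lebesgue_rV R N) (fun xz : V * V => `|u (xz.1 + xz.2)| `^ p)) => //.
move=> z _; rewrite (@ge0_integral_shift _ _ z (fun x => (`|u x| `^ p)%:E))//.
by apply/measurable_EFinP; exact: measurable_powR_norm.
Qed.

Lemma int_mol_sub_powR psi r u p C : loc_integrable u -> averaging psi r -> 1 < p ->
  (forall z, cube 0 r z -> (\int[leb]_x (`|u (x + z) - u x| `^ p)%:E <= C)%E) ->
  (\int[leb]_x (`|mol psi u x - u x| `^ p)%:E <= C)%E.
Proof.
move=> lu av p1 uC; have [cpsi psi0 psir psi1] := av.
have mu : measurable_fun setT u by case: lu.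
have mpsi : measurable_fun setT psi.
  by apply: continuous_measurable_rV; exact: coord_algebra_continuous.
have mF : measurable_fun setT (fun xz : V * V => `|u (xz.1 + xz.2) - u xz.1| `^ p).
  apply: measurable_powR_norm; apply: measurable_funB.
    exact: (measurableT_comp mu measurable_rV_add).
  exact: (measurableT_comp mu measurable_fst).
apply: (@le_trans _ _ (\int[leb]_x \int[leb]_z (`|u (x + z) - u x| `^ p * psi z)%:E)%E).
  apply: ge0_le_integral => //.
  - apply/measurable_EFinP; apply: measurable_powR_norm; apply: measurable_funB => //.
    by apply: continuous_measurable_rV; exact: (continuous_mol lu cpsi psir).
  - apply: (@measurable_fun_fubini_tonelli_F _ _ _ _ _ (lebesgue_rV R N)
      (fun xz : V * V => (`|u (xz.1 + xz.2) - u xz.1| `^ p * psi xz.2)%:E)) => //.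
      apply/measurable_EFinP; apply: measurable_funM => //.
      exact: (measurableT_comp mpsi measurable_snd).
    by move=> xz; rewrite lee_fin mulr_ge0// powR_ge0.
  by move=> x _; exact: (mol_powR_le x (u x) lu av p1).
apply: (@weighted_tonelli_le _ _ (lebesgue_rV R N) (fun xz : V * V => `|u (xz.1 + xz.2) - u xz.1| `^ p)) => //.
move=> z psiz; apply: uC; apply: contrapT => /psir zr.
by rewrite zr ltxx in psiz.
Qed.

(** The increment is the mean of [t * g] over the segment. Jensen brings the power inside, the
    integrals are exchanged, and each shifted integral equals the unshifted one. *)
Lemma int_line_increment v g i (t p : R) : 1 < p ->
  (forall x, is_derive x (e i) v (g x)) -> continuous v -> continuous g ->
  (\int[leb]_x (`|v (x + t *: e i) - v x| `^ p)%:E <=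
   (`|t| `^ p)%:E * \int[leb]_x (`|g x| `^ p)%:E)%E.
Proof.
move=> p1 vd cv cg.
have mv := continuous_measurable_rV cv; have mg := continuous_measurable_rV cg.
pose w (s : measurableTypeR R) : R := \1_(`[0, 1]%classic) s.
have mw : measurable_fun setT w by apply: measurable_indic; exact: measurable_itv.
have w0 s : 0 <= w s by [].
have w1 : (\int[lebesgue_measure]_s (w s)%:E = 1)%E.
  have -> : (\int[lebesgue_measure]_s (w s)%:E = lebesgue_measure (`[0%R, 1%R]%classic `&` setT))%E.
    by rewrite -integral_indic.
  by rewrite setIT lebesgue_measure_itv/= lte_fin ltr01 oppr0 adde0.
have mline : measurable_fun setT (fun xs : V * measurableTypeR R => xs.1 + (xs.2 * t) *: e i).
  apply: measurable_fun_rV => j.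
  rewrite (_ : (fun _ => _) = (fun xs : V * measurableTypeR R =>
      xs.1 ord0 j + xs.2 * (t * e i ord0 j) : R)); last first.
    by apply/funext => xs; rewrite !mxE mulrA.
  apply: measurable_funD; first exact: (measurableT_comp (@measurable_rV_coord _ _ _ j) measurable_fst).
  apply: measurable_funM => //; exact: measurable_snd.
have mF : measurable_fun setT (fun xs : V * measurableTypeR R => `|t * g (xs.1 + (xs.2 * t) *: e i)| `^ p).
  apply: measurable_powR_norm; apply: measurable_funM => //.
  exact: (measurableT_comp mg mline).
have tgE : (\int[leb]_x (`|t * g x| `^ p)%:E = (`|t| `^ p)%:E * \int[leb]_x (`|g x| `^ p)%:E)%E.
  rewrite -intZ ?powR_ge0//; last exact: measurable_powR_norm.
  by apply: eq_integral => x _; rewrite normrM powRM.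
rewrite -tgE.
apply: (@le_trans _ _ (\int[leb]_x \int[lebesgue_measure]_s (`|t * g (x + (s * t) *: e i)| `^ p * w s)%:E)%E).
  apply: ge0_le_integral => //.
  - apply/measurable_EFinP; apply: measurable_powR_norm; apply: measurable_funB => //.
    exact: (measurableT_comp mv (measurable_rV_shift _)).
  - apply: (@measurable_fun_fubini_tonelli_F _ _ _ _ _ lebesgue_measure
      (fun xs : V * measurableTypeR R => (`|t * g (xs.1 + (xs.2 * t) *: e i)| `^ p * w xs.2)%:E)) => //.
      apply/measurable_EFinP; apply: measurable_funM => //.
      exact: (measurableT_comp mw measurable_snd).
    by move=> xs; rewrite lee_fin mulr_ge0// powR_ge0.
  move=> x _.
  pose G (s : R) := t * g (x + (s * t) *: e i).
  have Gd (s : R) : is_derive s 1 (fun s : R => v (x + (s * t) *: e i)) (G s).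
    have h1 : is_derive (s * t) 1 (fun a : R => v (x + a *: e i)) (g (x + (s * t) *: e i)).
      by apply: (is_derive_lineP _ _ _ _ _).1.
    have h2 : is_derive s 1 (fun s : R => s * t) t.
      apply: (is_derive_eqr (is_derive_mulf (is_derive_id s 1) (is_derive_cst t s 1))).
      by rewrite /cst mulr0 add0r mulr1.
    by rewrite /G mulrC; exact: (@is_derive1_comp _ (fun a : R => v (x + a *: e i)) (fun s => s * t)).
  have cG : continuous G.
    move=> s; apply: cvgM; first exact: cvg_cst.
    apply: (@continuous_comp _ _ _ (fun s : R => x + (s * t) *: e i) g); last exact: cg.
    apply: cvgD; first exact: cvg_cst.
    apply: cvgZr_tmp; apply: cvgMl; exact: cvg_id.
  have mG : measurable_fun setT G by exact: continuous_measurable_fun.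
  have FTC : (\int[lebesgue_measure]_(s in `[0%R, 1%R]) (G s)%:E = (v (x + t *: e i))%:E - (v x)%:E)%E.
    rewrite (@continuous_FTC2 _ G (fun s : R => v (x + (s * t) *: e i)) 0 1)//.
    - by rewrite mul1r mul0r scale0r addr0.
    - exact: continuous_subspaceT.
    - have cv' (s : R) : {for s, continuous (fun s : R => v (x + (s * t) *: e i))}.
        by apply: differentiable_continuous; apply/derivable1_diffP; case: (Gd s).
      split.
      + by move=> s _; case: (Gd s).
      + by apply: cvg_at_right_filter; exact: cv'.
      + by apply: cvg_at_left_filter; exact: cv'.
    - by move=> s _; rewrite derive1E; case: (Gd s).
  apply: (@jensen_powR _ _ _ lebesgue_measure p `|v (x + t *: e i) - v x| (fun s : measurableTypeR R => `|G s|) w) => //.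
    exact: measurableT_comp.
  have -> : (`|v (x + t *: e i) - v x|%:E = `|\int[lebesgue_measure]_(s in `[0%R, 1%R]) (G s)%:E|)%E.
    by rewrite FTC -EFinB.
  apply: le_trans (le_abse_integral _ _ _) _ => //.
    by apply/measurable_EFinP; exact: measurable_funS mG.
  rewrite integral_mkcond le_eqVlt; apply/orP; left; apply/eqP; apply: eq_integral => s _.
  by rewrite patchE /w indicE; case: ifP; rewrite ?mulr1 ?mulr0.
apply: (@weighted_tonelli_le _ _ lebesgue_measure
  (fun xs : V * measurableTypeR R => `|t * g (xs.1 + (xs.2 * t) *: e i)| `^ p)) => //.
move=> s _ /=; rewrite (@ge0_integral_shift _ _ ((s * t) *: e i) (fun x => (`|t * g x| `^ p)%:E))//.
by apply/measurable_EFinP; apply: measurable_powR_norm; exact: measurable_funM.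
Qed.

Lemma continuous_loc_integrable v : continuous v -> loc_integrable v.
Proof.
move=> cv; have mv := continuous_measurable_rV cv; split => // K cK.
have [r _ Kr] := compact_sub_cube cK.
have [M M0 vM] := continuous_bounded_cube 0 r cv.
have mK := compact_measurable_rV cK.
apply: measurable_bounded_integrable => //.
- apply: (@le_lt_trans _ _ (leb (cube 0 `|r|))).
    apply: le_measure; rewrite ?inE//; first exact: measurable_cube.
    by apply: (subset_trans Kr); apply: cubeW; exact: ler_norm.
  by rewrite leb_cube// ltry.
- exact: measurable_funS mv.
- exists M; split; first exact: num_real.
  by move=> t Mt x Kx /=; rewrite (le_trans (vM _ (Kr _ Kx)))// ltW.
Qed.

(** One coordinate step at a time; every step costs a factor [2^p] through [powR_add_le], hence
    [(2^p)^N]. *)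
Lemma int_increment v (g : 'I_N -> V -> R) p r (z : V) : 1 < p ->
  (forall i x, is_derive x (e i) v (g i x)) -> continuous v ->
  (forall i, continuous (g i)) -> cube 0 r z ->
  (\int[leb]_x (`|v (x + z) - v x| `^ p)%:E <=
   ((2 `^ p) ^+ N * r `^ p)%:E * \sum_i \int[leb]_x (`|g i x| `^ p)%:E)%E.
Proof.
move=> p1 vd cv cg zr.
have mv := continuous_measurable_rV cv.
have p0 : 0 <= p by lra.
have pn0 : p != 0 by rewrite gt_eqF//; lra.
have p2 : 1 <= 2 `^ p by rewrite -[leLHS](powRr0 2) ler_powR//; lra.
have r0 (i : 'I_N) : 0 <= r by apply: le_trans (zr i).
pose G i := (\int[leb]_x (`|g i x| `^ p)%:E)%E.
have G0 i : (0 <= G i)%E by apply: integral_ge0 => x _; rewrite lee_fin.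
suff H : forall s : seq 'I_N, (\int[leb]_x (`|v (x + \sum_(i <- s) z ord0 i *: e i) - v x| `^ p)%:E <=
    ((2 `^ p) ^+ size s * r `^ p)%:E * \sum_(i <- s) G i)%E.
  have := H (index_enum 'I_N); rewrite -rV_sum_delta.
  by rewrite -sum1_size sum1_card card_ord.
elim=> [|i s IH].
  rewrite !big_nil mule0 integral0_eq// => x _.
  by rewrite addr0 subrr normr0 powR0.
pose a : V := z ord0 i *: e i; pose b : V := \sum_(j <- s) z ord0 j *: e j.
have mb : measurable_fun setT (fun x : V => `|v (x + b) - v x| `^ p).
  apply: measurable_powR_norm; apply: measurable_funB => //.
  exact: (measurableT_comp mv (measurable_rV_shift _)).
have ma : measurable_fun setT (fun x : V => `|v (x + a) - v x| `^ p).
  apply: measurable_powR_norm; apply: measurable_funB => //.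
  exact: (measurableT_comp mv (measurable_rV_shift _)).
have mba : measurable_fun setT (fun x : V => `|v (x + a + b) - v (x + a)| `^ p).
  exact: (measurableT_comp mb (measurable_rV_shift a)).
have tri (x : V) : `|v (x + (a + b)) - v x| `^ p <=
    2 `^ p * (`|v (x + a + b) - v (x + a)| `^ p + `|v (x + a) - v x| `^ p).
  apply: le_trans (powR_add_le _ _ p0).
  by rewrite addrA subrKA.
rewrite !big_cons -/a -/b.
apply: (@le_trans _ _ (\int[leb]_x (2 `^ p * (`|v (x + a + b) - v (x + a)| `^ p + `|v (x + a) - v x| `^ p))%:E)%E).
  apply: le_int => //.
  - apply: measurable_powR_norm; apply: measurable_funB => //.
    exact: (measurableT_comp mv (measurable_rV_shift _)).
  - by apply: measurable_funM => //; exact: measurable_funD.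
rewrite intZ//; last exact: measurable_funD.
rewrite intD// (@ge0_integral_shift _ _ a (fun x => (`|v (x + b) - v x| `^ p)%:E))//; last exact/measurable_EFinP.
have ha : (\int[leb]_x (`|v (x + a) - v x| `^ p)%:E <= (r `^ p)%:E * G i)%E.
  apply: le_trans (int_line_increment _ p1 (vd i) cv (cg i)) _.
  apply: lee_wpmul2r; first exact: G0.
  rewrite lee_fin ge0_ler_powR ?nnegrE//; first exact: r0.
  by have := zr i; rewrite mxE subr0.
rewrite exprS -mulrA EFinM -muleA lee_wpmul2l ?lee_fin//.
rewrite ge0_muleDr//; last by apply: sume_ge0.
rewrite addeC leeD//.
apply: (le_trans ha); rewrite lee_wpmul2r// lee_fin ler_peMl ?powR_ge0//.
exact: exprn_ege1.
Qed.

Lemma int_mol_increment psi v (g : 'I_N -> V -> R) p r : 1 < p ->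
  averaging psi r ->
  (forall i x, is_derive x (e i) v (g i x)) -> continuous v ->
  (forall i, continuous (g i)) ->
  (\int[leb]_x (`|mol psi v x - v x| `^ p)%:E <=
   ((2 `^ p) ^+ N * r `^ p)%:E * \sum_i \int[leb]_x (`|g i x| `^ p)%:E)%E.
Proof.
move=> p1 av vd cv cg; apply: int_mol_sub_powR av _ _ => //.
  exact: continuous_loc_integrable.
by move=> z zr; exact: int_increment.
Qed.

Lemma EFin_Rintegral d (T : measurableType d) (m : {measure set T -> \bar R}) (f : T -> R) :
  m.-integrable setT (EFin \o f) -> ((\int[m]_x f x)%:E = \int[m]_x (f x)%:E)%E.
Proof. by move=> fi; rewrite /Rintegral fineK//; exact: integrable_fin_num. Qed.

(** Both sides are the double integral of [u (x + z) * psi z * phi x], in which the two kernels play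
    symmetric roles. The work lies in the integrability that permits the exchange. *)
Lemma mol_pairing psi phi u r (s M : R) (c : V) : loc_integrable u -> 0 <= s ->
  coord_algebra psi -> (forall x, ~ cube 0 r x -> psi x = 0) ->
  measurable_fun setT phi -> (forall x, `|phi x| <= M) ->
  (forall x, ~ cube c s x -> phi x = 0) ->
  \int[leb]_x (mol psi u x * phi x) = \int[leb]_z (psi z * mol phi u z).
Proof.
move=> lu s0 cpsi psir mphi phiM phis.
have mu : measurable_fun setT u by case: lu.
have mpsi : measurable_fun setT psi.
  by apply: continuous_measurable_rV; exact: coord_algebra_continuous.
have [L L0 psiL] := coord_algebra_bounded cpsi psir.
have M0 : 0 <= M by exact: le_trans (phiM 0).
have [A A0 AE] := loc_integrable_int_cube c (r + s) lu.
pose f (xz : V * V) := u (xz.1 + xz.2) * psi xz.2 * phi xz.1.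
have mf : measurable_fun setT f.
  apply: measurable_funM; last exact: (measurableT_comp mphi measurable_fst).
  apply: measurable_funM; last exact: (measurableT_comp mpsi measurable_snd).
  exact: (measurableT_comp mu measurable_rV_add).
have mEf : measurable_fun setT (EFin \o f) by exact/measurable_EFinP.
have mc : measurable_fun setT (fun y => `|u y| * \1_(cube c (r + s)) y).
  apply: measurable_funM; first exact: measurableT_comp.
  by apply: measurable_indic; exact: measurable_cube.
have fle x z : `|f (x, z)| <= L * M * \1_(cube c s) x * (`|u (z + x)| * \1_(cube c (r + s)) (z + x)).
  rewrite /f/= !normrM [z + x]addrC !indicE.
  have [xs|/phis ->] := pselect (cube c s x); last by rewrite normr0 mulr0 !mulr_ge0// ltW.
  have [zr|/psir ->] := pselect (cube 0 r z); last by rewrite normr0 mulr0 mul0r !mulr_ge0// ltW.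
  rewrite !mem_set//.
    by rewrite !mulr1 mulrC [L * M]mulrC -mulrA ler_pM// [L * _]mulrC ler_pM.
  move=> i; have := xs i; have := zr i; rewrite !mxE subr0 => h1 h2.
  rewrite (_ : _ + _ - _ = z ord0 i + (x ord0 i - c ord0 i)); last by ring.
  by rewrite (le_trans (ler_normD _ _))// lerD.
have intf x : (\int[leb]_z `|(EFin \o f) (x, z)| <= (L * M * A * \1_(cube c s) x)%:E)%E.
  apply: (@le_trans _ _ (\int[leb]_z ((L * M * \1_(cube c s) x) * (`|u (z + x)| * \1_(cube c (r + s)) (z + x)))%:E)%E).
    apply: le_int => //.
    - by apply: measurableT_comp => //; apply: (measurableT_comp mf); exact: pair1_measurable.
    - by apply: measurable_funM => //; exact: (measurableT_comp mc (measurable_rV_shift x)).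
  rewrite intZ//; last 2 first.
    exact: (measurableT_comp mc (measurable_rV_shift x)).
    by rewrite !mulr_ge0// ltW.
  rewrite (@ge0_integral_shift _ _ x (fun y => (`|u y| * \1_(cube c (r + s)) y)%:E))//.
    by rewrite AE -EFinM lee_fin mulrAC.
  exact/measurable_EFinP.
have fi : (lebesgue_rV R N \x lebesgue_rV R N)%E.-integrable setT (EFin \o f).
  apply/integrable12ltyP => //.
  apply: (@le_lt_trans _ _ (\int[leb]_x (L * M * A * \1_(cube c s) x)%:E)%E).
    apply: ge0_le_integral => //.
    - by move=> x _; apply: integral_ge0.
    - apply: (@measurable_fun_fubini_tonelli_F _ _ _ _ _ (lebesgue_rV R N) (abse \o (EFin \o f))) => //.
        exact: measurableT_comp.
      by move=> xz; exact: abse_ge0.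
    - apply/measurable_EFinP; apply: measurable_funM => //.
      by apply: measurable_indic; exact: measurable_cube.
  rewrite int_indic; [|exact: measurable_cube|by rewrite !mulr_ge0// ltW].
  by rewrite leb_cube// -EFinM ltry.
have E1 x : (mol psi u x * phi x)%:E = (\int[leb]_z (f (x, z))%:E)%E.
  have iu := mol_integrable x lu cpsi psir.
  have ius : leb.-integrable setT (fun z => (u (x + z) * psi z)%:E).
    have := integrable_shift x iu; apply: eq_integrable => // z _ /=.
    by rewrite addrK addrC.
  rewrite mol_shiftE; last by apply/measurable_EFinP; case/integrableP: iu.
  rewrite mulrC -RintegralZl// EFin_Rintegral.
    by apply: eq_integral => z _; rewrite /f/= mulrC.
  exact: (integrableZl measurableT (phi x) ius).
have E2 z : (psi z * mol phi u z)%:E = (\int[leb]_x (f (x, z))%:E)%E.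
  have ip : leb.-integrable setT (fun y => (u y * phi (y - z))%:E).
    apply: (@loc_integrable_mul _ _ u (fun y => phi (y - z)) (c + z) s M) => //.
      exact: (measurableT_comp mphi (measurable_rV_shift (- z))).
    by move=> y yc; apply: phis => /cube_shift.
  have ips : leb.-integrable setT (fun x => (u (x + z) * phi x)%:E).
    have := integrable_shift z ip; apply: eq_integrable => // x _ /=.
    by rewrite addrK.
  rewrite mol_shiftE; last by apply/measurable_EFinP; case/integrableP: ip.
  rewrite -RintegralZl//; last first.
    by apply: eq_integrable ips => // x _; rewrite addrC.
  rewrite EFin_Rintegral.
    by apply: eq_integral => x _; rewrite /f/= addrC mulrCA mulrA.
  have := integrableZl measurableT (psi z) ips.
  by apply: eq_integrable => // x _ /=; rewrite addrC.
rewrite /Rintegral; congr fine.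
rewrite (eq_integral _ _ (fun x _ => E1 x)) (eq_integral _ _ (fun z _ => E2 z)).
by rewrite (integral12_prod_meas1 fi) (integral21_prod_meas1 fi).
Qed.

(** The pairing identity with [psi1 (y - x)] as the second kernel. Commutation makes a double
    mollification the same from either scale, which is how different scales are compared later. *)
Lemma mol_comm psi1 psi2 u r1 r2 (x : V) : loc_integrable u -> 0 <= r1 ->
  coord_algebra psi1 -> (forall x, ~ cube 0 r1 x -> psi1 x = 0) ->
  coord_algebra psi2 -> (forall x, ~ cube 0 r2 x -> psi2 x = 0) ->
  mol psi1 (mol psi2 u) x = mol psi2 (mol psi1 u) x.
Proof.
move=> lu r10 c1 s1 c2 s2.
have [M M0 M1] := coord_algebra_bounded c1 s1.
have m1 : measurable_fun setT (fun y : V => psi1 (y - x)).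
  apply: continuous_measurable_rV; apply: coord_algebra_continuous.
  exact: coord_algebra_shift.
have s1x y : ~ cube x r1 y -> psi1 (y - x) = 0.
  by move=> yx; apply: s1 => /cube_shift; rewrite add0r.
rewrite {1}/mol (@mol_pairing psi2 (fun y : V => psi1 (y - x)) u r2 r1 M x)//.
have c1u := continuous_mol lu c1 s1.
have i2 := mol_integrable x (continuous_loc_integrable c1u) c2 s2.
rewrite [RHS]mol_shiftE; last by apply/measurable_EFinP; case/integrableP: i2.
apply: eq_Rintegral => z _; rewrite mulrC; congr (_ * _).
by rewrite /mol; apply: eq_Rintegral => y _; rewrite opprD addrA addrAC.
Qed.

End kernel_averages.

(** * Continuity rules for explicit functions *)

Section pointwise_continuity_rules.
Context {R : realType} {T : topologicalType}.
Implicit Types (f g : T -> R).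

Lemma continuous_addf f g : continuous f -> continuous g -> continuous (fun x => f x + g x).
Proof. by move=> cf cg x; exact: (cvgD (cf x) (cg x)). Qed.

Lemma continuous_mulf f g : continuous f -> continuous g -> continuous (fun x => f x * g x).
Proof. by move=> cf cg x; exact: (cvgM (cf x) (cg x)). Qed.

Lemma continuous_oppf f : continuous f -> continuous (fun x => - f x).
Proof. by move=> cf x; exact: (cvgN (cf x)). Qed.

Lemma continuous_sumf (I : Type) (s : seq I) (f : I -> T -> R) :
  (forall i, continuous (f i)) -> continuous (fun x => \sum_(i <- s) f i x).
Proof.
move=> cf; elim: s => [|i s IH].
  rewrite (_ : (fun _ => _) = fun=> 0); first exact: cst_continuous.
  by apply/funext => x; rewrite big_nil.
rewrite (_ : (fun _ => _) = fun x => f i x + \sum_(j <- s) f j x).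
  exact: continuous_addf.
by apply/funext => x; rewrite big_cons.
Qed.

Lemma derive_continuous (k dk : R -> R) : (forall s : R, is_derive s 1 k (dk s)) -> continuous k.
Proof.
move=> kd s; apply: differentiable_continuous; apply/derivable1_diffP.
by case: (kd s).
Qed.

Lemma continuous_compf (k : R -> R) f : continuous k -> continuous f ->
  continuous (fun x => k (f x)).
Proof. by move=> ck cf x; apply: (@continuous_comp _ _ _ f k); [exact: cf|exact: ck]. Qed.

Lemma is_derive_powR_gt0 (b x : R) : 0 < x -> is_derive x 1 (fun t => t `^ b) (b * x `^ (b - 1)).
Proof. exact: is_derive1_powR. Qed.

Lemma continuous_powRf f (b : R) : continuous f -> (forall x, 0 < f x) ->
  continuous (fun x => f x `^ b).
Proof.
move=> cf f0 x; apply: (@continuous_comp _ _ _ f (fun t => t `^ b)); first exact: cf.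
apply: differentiable_continuous; apply/derivable1_diffP.
by case: (is_derive_powR_gt0 b (f0 x)).
Qed.

End pointwise_continuity_rules.

(** * A smooth cutoff with its first two derivatives *)

Section cutoff.
Context {R : realType}.

Let c : R := flat 1 1.
Let K : R := flat 1 c.
Let c_gt0 : 0 < c. Proof. exact: flat1_gt0. Qed.
Let K_gt0 : 0 < K. Proof. exact: flat1_gt0. Qed.
Let d1 : {poly R} := 'X^2 * (1 - 1^`()).
Let d2 : {poly R} := 'X^2 * (d1 - d1^`()).

(** Nesting two flat profiles makes the plateaus exact: for [s <= 1] the inner one vanishes and the
    value is [K / K], for [s >= 2] the outer argument is nonpositive. Two explicit derivatives are
    kept because the Rellich argument differentiates the truncated weight twice. *)
Definition eta (s : R) : R := flat 1 (c - flat 1 (s - 1)) / K.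
Definition eta1 (s : R) : R := - (flat d1 (c - flat 1 (s - 1)) * flat d1 (s - 1)) / K.
Definition eta2 (s : R) : R :=
  (flat d2 (c - flat 1 (s - 1)) * flat d1 (s - 1) ^+ 2 -
   flat d1 (c - flat 1 (s - 1)) * flat d2 (s - 1)) / K.

Let is_derive_flat_sub p (s : R) :
  is_derive s 1 (fun s : R => flat p (s - 1)) (flat ('X^2 * (p - p^`())) (s - 1)).
Proof.
have h : is_derive s 1 (fun s : R => s - 1) 1.
  apply: (is_derive_eqr (is_derive_addf (is_derive_id s 1) (is_derive_cst (-1 : R) s 1))).
  by rewrite addr0.
rewrite -[X in is_derive _ _ _ X]mulr1.
exact: (@is_derive1_comp _ (flat p) (fun s : R => s - 1) _ _ _ (is_derive_flat _ _) h).
Qed.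

Let is_derive_flat_flat p (s : R) :
  is_derive s 1 (fun s : R => flat p (c - flat 1 (s - 1)))
    (- (flat ('X^2 * (p - p^`())) (c - flat 1 (s - 1)) * flat d1 (s - 1))).
Proof.
have h : is_derive s 1 (fun s : R => c - flat 1 (s - 1)) (- flat d1 (s - 1)).
  apply: (is_derive_eqr (is_derive_addf (is_derive_cst c s 1) (is_deriveN (is_derive_flat_sub 1 s)))).
  by rewrite add0r.
rewrite -mulrN.
exact: (@is_derive1_comp _ (flat p) (fun s : R => c - flat 1 (s - 1)) _ _ _ (is_derive_flat _ _) h).
Qed.

Lemma is_derive_eta (s : R) : is_derive s 1 eta (eta1 s).
Proof.
apply: (is_derive_eqr (is_derive_mulf (is_derive_flat_flat 1 s) (is_derive_cst K^-1 s 1))).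
by rewrite /cst mulr0 add0r mulrC.
Qed.

Lemma is_derive_eta1 (s : R) : is_derive s 1 eta1 (eta2 s).
Proof.
apply: (is_derive_eqr (is_derive_mulf (is_deriveN (is_derive_mulf (is_derive_flat_flat d1 s)
  (is_derive_flat_sub d1 s))) (is_derive_cst K^-1 s 1))).
by rewrite /cst mulr0 add0r /eta2 -/d2; ring.
Qed.

Lemma continuous_eta : continuous eta.
Proof. by apply: derive_continuous => s; exact: is_derive_eta. Qed.

Lemma continuous_eta1 : continuous eta1.
Proof. by apply: derive_continuous => s; exact: is_derive_eta1. Qed.

Lemma continuous_eta2 : continuous eta2.
Proof.
have c1 p : continuous (fun s : R => flat p (s - 1)).
  by apply: derive_continuous => s; exact: is_derive_flat_sub.
have c2 p : continuous (fun s : R => flat p (c - flat 1 (s - 1))).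
  by apply: derive_continuous => s; exact: is_derive_flat_flat.
apply: continuous_mulf; last exact: cst_continuous.
apply: continuous_addf; first by apply: continuous_mulf => //; apply: continuous_mulf.
by apply: continuous_oppf; apply: continuous_mulf.
Qed.

Lemma eta_ge0 (s : R) : 0 <= eta s.
Proof. by rewrite divr_ge0 ?flat1_ge0// ltW. Qed.

Lemma eta_le1 (s : R) : eta s <= 1.
Proof. by rewrite ler_pdivrMr// mul1r flat1_le// gerBl flat1_ge0. Qed.

Lemma eta_eq1 (s : R) : s <= 1 -> eta s = 1.
Proof.
by move=> s1; rewrite /eta (@flat_le0 _ 1 (s - 1)) ?subr_le0// subr0 divff// gt_eqF.
Qed.

Let flat_high p (s : R) : 2 <= s -> flat p (c - flat 1 (s - 1)) = 0.
Proof. by move=> s2; rewrite flat_le0// subr_le0 /c flat1_le//; lra. Qed.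

Lemma eta_eq0 (s : R) : 2 <= s -> eta s = 0.
Proof. by move=> s2; rewrite /eta flat_high// mul0r. Qed.

Lemma eta1_eq0 (s : R) : ~~ (1 < s < 2) -> eta1 s = 0.
Proof.
rewrite negb_and -!leNgt /eta1 => /orP[s1|s2].
  by rewrite (@flat_le0 _ d1 (s - 1)) ?subr_le0// mulr0 oppr0 mul0r.
by rewrite flat_high// mul0r oppr0 mul0r.
Qed.

Lemma eta2_eq0 (s : R) : ~~ (1 < s < 2) -> eta2 s = 0.
Proof.
rewrite negb_and -!leNgt /eta2 => /orP[s1|s2].
  by rewrite (@flat_le0 _ d1 (s - 1)) ?(@flat_le0 _ d2 (s - 1)) ?subr_le0// expr0n /= !mulr0 subrr mul0r.
by rewrite !flat_high// !mul0r subrr mul0r.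
Qed.

Lemma eta_bound : exists2 B : R, 0 < B & forall s : R, `|eta1 s| <= B /\ `|eta2 s| <= B.
Proof.
have bd (f : R -> R) : continuous f -> (forall s, ~~ (1 < s < 2) -> f s = 0) ->
    exists2 B : R, 0 < B & forall s, `|f s| <= B.
  move=> cf f0; have /compact_bounded [M [_ fM]] : compact (f @` `[1, 2]%classic).
    apply: continuous_compact; last exact: segment_compact.
    exact: continuous_subspaceT.
  exists (`|M| + 1) => [|s]; first by rewrite ltr_wpDl.
  have [/andP[s1 s2]|/f0 ->] := boolP (1 < s < 2); last by rewrite normr0 addr_ge0.
  apply: fM; first by rewrite (le_lt_trans (ler_norm M))// ltrDl.
  by exists s => //=; rewrite in_itv/= !ltW.
have [B1 B10 b1] := bd _ continuous_eta1 eta1_eq0.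
have [B2 B20 b2] := bd _ continuous_eta2 eta2_eq0.
exists (B1 + B2) => [|s]; first by rewrite addr_gt0.
by split; [rewrite (le_trans (b1 s))// lerDl ltW|rewrite (le_trans (b2 s))// lerDr ltW].
Qed.

End cutoff.

(** * Pointwise form of the Hardy and Rellich inequalities *)

Section hardy_algebra.
Context {R : realType}.
Implicit Types (A B v k w rho a b m x : R).

Lemma powRS1 x a : 0 < x -> x `^ (a - 1) * x = x `^ a.
Proof.
by move=> x0; rewrite -{2}(powRr1 (ltW x0)) -powRD ?subrK// (gt_eqF x0) implybT.
Qed.

(** Smooth substitute for [|s|^(2b)], since the exponents [p] and [q] may lie below [2]. The
    parameter [k] is chosen by [critical_split] in terms of the cutoff radius. *)
Definition reg k b (s : R) : R := (s ^+ 2 + k) `^ b.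
Definition reg1 k b (s : R) : R := 2 * b * s * reg k (b - 1) s.
Definition reg2 k b (s : R) : R := 2 * b * (reg k (b - 1) s + s * reg1 k (b - 1) s).

Lemma reg_base_gt0 k (s : R) : 0 < k -> 0 < s ^+ 2 + k.
Proof. by move=> k0; rewrite ltr_wpDl ?sqr_ge0. Qed.

Lemma is_derive_reg k b (s : R) : 0 < k -> is_derive s 1 (reg k b) (reg1 k b s).
Proof.
move=> k0.
have h : is_derive s 1 (fun s : R => s ^+ 2 + k) (2 * s).
  apply: (is_derive_eqr (is_derive_addf (is_derive_mulf (is_derive_id s 1) (is_derive_id s 1))
    (is_derive_cst k s 1))).
  by rewrite /cst /id; ring.
have e : reg1 k b s = b * (s ^+ 2 + k) `^ (b - 1) * (2 * s) by rewrite /reg1 /reg; ring.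
rewrite e; exact: (@is_derive1_comp _ (fun t => t `^ b) (fun s : R => s ^+ 2 + k) _ _ _
  (is_derive_powR_gt0 _ (reg_base_gt0 s k0)) h).
Qed.

Lemma is_derive_reg1 k b (s : R) : 0 < k -> is_derive s 1 (reg1 k b) (reg2 k b s).
Proof.
move=> k0.
have h : is_derive s 1 (fun s : R => 2 * b * s) (2 * b).
  apply: (is_derive_eqr (is_derive_mulf (is_derive_cst (2 * b) s 1) (is_derive_id s 1))).
  by rewrite /cst /id; ring.
apply: (is_derive_eqr (is_derive_mulf h (is_derive_reg (b - 1) s k0))).
by rewrite /reg2; ring.
Qed.

Lemma continuous_reg k b : 0 < k -> continuous (reg k b).
Proof. by move=> k0; apply: derive_continuous => s; exact: is_derive_reg. Qed.

Lemma continuous_reg1 k b : 0 < k -> continuous (reg1 k b).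
Proof. by move=> k0; apply: derive_continuous => s; exact: is_derive_reg1. Qed.

Lemma continuous_reg2 k b : 0 < k -> continuous (reg2 k b).
Proof.
move=> k0; apply: continuous_mulf; first exact: cst_continuous.
apply: continuous_addf; first exact: continuous_reg.
by apply: continuous_mulf; [by move=> ?|exact: continuous_reg1].
Qed.

Lemma reg_ge0 k b s : 0 <= reg k b s. Proof. exact: powR_ge0. Qed.

(** With [reg k 2^-1 s] in the role of [|s|], this is the bound [2b |s|^(2b-1)] for the derivative
    of [|s|^(2b)], in the shape to which Young's inequality applies. *)
Lemma reg1_le k b s : 0 < k -> 0 <= b ->
  `|reg1 k b s| <= 2 * b * (reg k 2^-1 s) `^ (2 * b - 1).
Proof.
move=> k0 b0; rewrite /reg1 !normrM normr_nat (ger0_norm b0) (ger0_norm (reg_ge0 _ _ _)).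
have A0 := reg_base_gt0 s k0.
rewrite -mulrA ler_wpM2l ?mulr_ge0// /reg -powRrM.
have -> : 2^-1 * (2 * b - 1) = 2^-1 + (b - 1) by lra.
rewrite [leRHS]powRD ?(gt_eqF A0) ?implybT// ler_wpM2r ?powR_ge0//.
rewrite -sqrtr_sqr -powR12_sqrt ?sqr_ge0//.
by apply: ge0_ler_powR; rewrite ?nnegrE ?invr_ge0 ?sqr_ge0 ?(ltW A0)// lerDl ltW.
Qed.

Lemma reg_half_pow k b s : (reg k 2^-1 s) `^ (2 * b) = reg k b s.
Proof. by rewrite /reg -powRrM mulrA mulVf ?mul1r. Qed.

(** Convexity of the regularized power: factoring out the lowest power leaves [k + (2b - 1) s^2]. *)
Lemma reg2_ge0 k b s : 0 < k -> 1 <= 2 * b -> 0 <= reg2 k b s.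
Proof.
move=> k0 b1; rewrite /reg2 /reg1 /reg.
have A0 := reg_base_gt0 s k0.
have e := powRS1 (b - 1) A0.
have [s2 P0] := (sqr_ge0 s, powR_ge0 (s ^+ 2 + k) (b - 1 - 1)).
rewrite -e; set P := _ `^ _ in P0 *.
have -> : 2 * b * (P * (s ^+ 2 + k) + s * (2 * (b - 1) * s * P)) =
  (2 * b) * (P * (k + (2 * b - 1) * s ^+ 2)) by ring.
have b0 : 0 <= 2 * b by lra.
have h : 0 <= (2 * b - 1) * s ^+ 2 by rewrite mulr_ge0// subr_ge0.
by apply: mulr_ge0 => //; apply: mulr_ge0 => //; rewrite addr_ge0// ltW.
Qed.

(* [w^-m] truncated at [w = 2 rho], with its first two derivatives in [w]. *)
Definition cutw rho m w : R := w `^ (- m) * eta (w / rho).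
Definition cutw1 rho m w : R :=
  - m * w `^ (- m - 1) * eta (w / rho) + w `^ (- m) * eta1 (w / rho) / rho.
Definition cutw2 rho m w : R :=
  m * (m + 1) * w `^ (- m - 1 - 1) * eta (w / rho)
  - 2 * m * w `^ (- m - 1) * eta1 (w / rho) / rho + w `^ (- m) * eta2 (w / rho) / rho ^+ 2.

Lemma is_derive_rescale (f : R -> R) df rho w : is_derive (w / rho) 1 f df ->
  is_derive w 1 (fun t : R => f (t / rho)) (df / rho).
Proof.
move=> fd.
have h : is_derive w 1 (fun t : R => t / rho) rho^-1.
  apply: (is_derive_eqr (is_derive_mulf (is_derive_id w 1) (is_derive_cst rho^-1 w 1))).
  by rewrite /cst /id; ring.
exact: (@is_derive1_comp _ f (fun t : R => t / rho) _ _ _ fd h).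
Qed.

Lemma is_derive_cutw rho m w : 0 < w -> is_derive w 1 (cutw rho m) (cutw1 rho m w).
Proof.
move=> w0; apply: (is_derive_eqr (is_derive_mulf (is_derive_powR_gt0 (- m) w0)
  (is_derive_rescale (is_derive_eta (w / rho))))).
by rewrite /cutw1; ring.
Qed.

Lemma is_derive_cutw1 rho m w : 0 < w -> is_derive w 1 (cutw1 rho m) (cutw2 rho m w).
Proof.
move=> w0.
have h0 := is_derive_powR_gt0 (- m) w0.
have h1 := is_derive_powR_gt0 (- m - 1) w0.
apply: (is_derive_eqr (is_derive_addf
  (is_derive_mulf (is_derive_mulf (is_derive_cst (- m) w 1) h1)
     (is_derive_rescale (is_derive_eta (w / rho))))
  (is_derive_mulf (is_derive_mulf h0 (is_derive_rescale (is_derive_eta1 (w / rho))))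
     (is_derive_cst rho^-1 w 1)))).
by rewrite /cst /cutw2 -exprVn; ring.
Qed.

(** Marks the region outside which the derivatives of [eta (w / rho)] vanish; every cutoff error is
    confined to it. *)
Definition in_ring rho w : R := (rho <= w <= 2 * rho)%R%:R.

Lemma in_ringP rho w : 0 < rho -> [/\ 0 <= in_ring rho w <= 1,
  in_ring rho w * w <= 2 * rho &
  forall m, 0 <= m -> in_ring rho w * w `^ (- m) <= in_ring rho w * rho `^ (- m)].
Proof.
move=> r0; rewrite /in_ring; have [|_] := boolP (rho <= w <= 2 * rho); last first.
  by split; rewrite ?lexx ?ler01 ?mul0r// ?mulr_ge0// ?ltW// => m; rewrite !mul0r.
move=> /andP[rw w2]; split; rewrite ?lexx ?ler01 ?mul1r// => m m0; rewrite !mul1r.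
have w0 := lt_le_trans r0 rw.
by rewrite !powRN lef_pV2 ?posrE ?powR_gt0// ge0_ler_powR// nnegrE ltW.
Qed.

Lemma eta_ring (B : R) rho w : 0 < rho -> (forall s : R, `|eta1 s| <= B /\ `|eta2 s| <= B) ->
  `|eta1 (w / rho)| <= B * in_ring rho w /\ `|eta2 (w / rho)| <= B * in_ring rho w.
Proof.
move=> r0 bB; rewrite /in_ring; have [|/negP nw] := boolP (rho <= w <= 2 * rho).
  by rewrite mulr1.
have n1 : ~~ (1 < w / rho < 2).
  apply/negP => /andP[]; rewrite ltr_pdivlMr// mul1r ltr_pdivrMr// => w1 w2.
  by apply: nw; rewrite !ltW.
by rewrite eta1_eq0// eta2_eq0// normr0 mulr0.
Qed.

Lemma le_mul_norm (x y X Y : R) : `|x| <= X -> `|y| <= Y -> - (X * Y) <= x * y.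
Proof.
move=> hx hy; rewrite lerNl; apply: (le_trans (ler_norm _)); rewrite normrN normrM.
by rewrite ler_pM.
Qed.

(** Young's inequality with the weight distributed over its factors. It is used with [tau = 1/2] for
    Hardy and [tau = 1] for Rellich, as [w] stands for a squared distance. *)
Lemma hardy_young p a w eps b : 1 < p -> 0 <= a -> 0 < w -> 0 < eps -> 0 <= b ->
  forall tau : R, 0 < tau ->
  a `^ (p - 1) * (w `^ (- (tau * (p - 1))) * b) <=
    eps * (a `^ p * w `^ (- (tau * p))) + eps `^ (1 - p) * b `^ p.
Proof.
move=> p1 a0 w0 e0 b0 tau t0.
have := @young_split R p (a * w `^ (- tau)) b eps p1 (mulr_ge0 a0 (powR_ge0 _ _)) b0 e0.
by rewrite !powRM ?powR_ge0// -!powRrM !mulNr -!mulrA.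
Qed.

Variables (N : nat).

(** The first sum on the right is the divergence of the field with components [z i * cutw * reg].
    Its main part is at least [N - p] times the weighted power because the squares of the [z i] sum
    to at most [w]; Young absorbs the terms with [g], and the derivative of the cutoff gives the
    last term. *)
Lemma hardy_pointwise p k rho B v w (z g : 'I_N -> R) : 1 < p -> p < N%:R -> 0 < k ->
  0 < rho -> 0 < w -> (forall s : R, `|eta1 s| <= B /\ `|eta2 s| <= B) ->
  \sum_i z i ^+ 2 <= w ->
  (N%:R - p) / 2 * (reg k (p / 2) v * w `^ (- (p / 2)) * eta (w / rho)) <=
    \sum_i (z i * cutw rho (p / 2) w * (reg1 k (p / 2) v * g i) +
      reg k (p / 2) v * (cutw rho (p / 2) w + z i * (cutw1 rho (p / 2) w * (2 * z i))))
    + p * ((N%:R - p) / (2 * p * N%:R)) `^ (1 - p) * \sum_i `|g i| `^ p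
    + 4 * B * (reg k (p / 2) v * rho `^ (- (p / 2)) * in_ring rho w).
Proof.
move=> p1 pN k0 r0 w0 bB zw.
have N0 : 0 < N%:R :> R by lra.
have p2 : 2 * (p / 2) = p by lra.
(* Chosen so that the [N] cross terms together consume [p * N * eps = (N - p) / 2], half of the main
   term. *)
set eps := (N%:R - p) / (2 * p * N%:R).
have e0 : 0 < eps by rewrite divr_gt0 ?subr_gt0 ?mulr_gt0//; lra.
set Ph := reg k (p / 2) v; set P := w `^ (- (p / 2)); set E := eta (w / rho).
have P0 : 0 <= P by exact: powR_ge0.
have Ph0 : 0 <= Ph by exact: reg_ge0.
have [E0 E1] : 0 <= E /\ E <= 1 by rewrite eta_ge0 eta_le1.
set P' := w `^ (- (p / 2) - 1); have PP' : P' * w = P by exact: powRS1.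
have P'0 : 0 <= P' by exact: powR_ge0.
have Z0 : 0 <= \sum_i z i ^+ 2 by apply: sumr_ge0 => i _; exact: sqr_ge0.
have zi (i : 'I_N) : `|z i| <= w `^ 2^-1.
  rewrite powR12_sqrt ?(ltW w0)// -sqrtr_sqr ler_sqrt ?(ltW w0)//.
  apply: le_trans zw; rewrite (bigD1 i)//= lerDl; apply: sumr_ge0 => j _; exact: sqr_ge0.
have cross (i : 'I_N) : - (p * (eps * (Ph * P * E)) + p * eps `^ (1 - p) * `|g i| `^ p) <=
    z i * (P * E) * (reg1 k (p / 2) v * g i).
  have h1 := @reg1_le k (p / 2) v k0 ltac:(lra).
  have -> : z i * (P * E) * (reg1 k (p / 2) v * g i) = (z i * reg1 k (p / 2) v) * (P * E * g i) by ring.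
  have h2 : `|z i * reg1 k (p / 2) v| <= w `^ 2^-1 * (p * reg k 2^-1 v `^ (p - 1)).
    by rewrite normrM ler_pM// (le_trans h1)// p2.
  apply: le_trans (le_mul_norm h2 (lexx _)); rewrite lerN2 (normrM (P * E)) (normrM P) (ger0_norm P0) (ger0_norm E0).
  have hy := @hardy_young p (reg k 2^-1 v) w eps `|g i| p1 (reg_ge0 _ _ _) w0 e0 (normr_ge0 _) 2^-1 ltac:(lra).
  have e1 : reg k 2^-1 v `^ p = Ph.
    by rewrite /Ph -[p in LHS]p2 reg_half_pow.
  have e2 : w `^ (- (2^-1 * p)) = P by rewrite /P; congr (_ `^ _); lra.
  have e3 : w `^ (- (2^-1 * (p - 1))) = w `^ 2^-1 * P.
    rewrite /P -powRD ?(gt_eqF w0) ?implybT//; congr (_ `^ _); lra.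
  rewrite e1 e2 e3 in hy.
  set X := eps `^ (1 - p) * `|g i| `^ p in hy.
  have X0 : 0 <= X by rewrite mulr_ge0 ?powR_ge0.
  have -> : w `^ 2^-1 * (p * reg k 2^-1 v `^ (p - 1)) * (P * E * `|g i|) =
    p * E * (reg k 2^-1 v `^ (p - 1) * (w `^ 2^-1 * P * `|g i|)) by ring.
  have pE : 0 <= p * E by rewrite mulr_ge0//; lra.
  apply: (le_trans (ler_wpM2l pE hy)).
  have XE : E * X <= X by rewrite ler_piMl.
  have p0 : 0 <= p by lra.
  have := ler_wpM2l p0 XE.
  rewrite -(mulrA p (eps `^ _)) -/X; lra.
have crossS : - (p * N%:R * (eps * (Ph * P * E)) + p * eps `^ (1 - p) * \sum_i `|g i| `^ p) <=
    \sum_i z i * (P * E) * (reg1 k (p / 2) v * g i).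
  apply: le_trans (ler_sum _ (fun i _ => cross i)).
  rewrite sumrN lerN2 big_split /= sumr_const card_ord -mulr_sumr -(mulr_natr (p * _)).
  by rewrite le_eqVlt; apply/orP; left; apply/eqP; ring.
have -> : \sum_i (z i * cutw rho (p / 2) w * (reg1 k (p / 2) v * g i) +
      Ph * (cutw rho (p / 2) w + z i * (cutw1 rho (p / 2) w * (2 * z i)))) =
   \sum_i z i * (P * E) * (reg1 k (p / 2) v * g i) + N%:R * Ph * (P * E) +
   2 * Ph * cutw1 rho (p / 2) w * \sum_i z i ^+ 2.
  have -> : cutw rho (p / 2) w = P * E by [].
  have sN (x : R) : \sum_(i < N) x = N%:R * x by rewrite sumr_const card_ord mulr_natl.
  rewrite mulr_sumr -(mulrA N%:R) -sN -!big_split /=; apply: eq_bigr => i _.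
  move: (cutw1 _ _ _) (reg1 _ _ _) => t1 t2; clear; ring.
set Z := \sum_i z i ^+ 2 in zw Z0 *.
rewrite /cutw1 -/P -/E -/P'.
have t1 : p * Ph * (P' * Z * E) <= p * Ph * (P * E).
  rewrite ler_wpM2l ?mulr_ge0//; first lra.
  by rewrite ler_wpM2r// -PP' ler_wpM2l.
have [bJ _] := @eta_ring B rho w r0 bB.
have [/andP[J0 J1] Jw Jp] := @in_ringP rho w r0.
set J := in_ring rho w in bJ J0 J1 Jw Jp *.
have JP : J * P <= J * rho `^ (- (p / 2)) by apply: Jp; lra.
(* Idempotence lets [J] be spent twice: once to bound [Z / rho] by [2], once to replace [w] by [rho]
   in the power. *)
have JJ : J * J = J by rewrite /J /in_ring; case: (rho <= w <= 2 * rho); rewrite ?mulr1 ?mulr0.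
have B0 : 0 <= B by exact: le_trans (normr_ge0 _) (bB 0).1.
clearbody Z J P P' Ph E.
have t2 : - (4 * B * (Ph * rho `^ (- (p / 2)) * J)) <= 2 * Ph * (P * eta1 (w / rho) / rho) * Z.
  have -> : 2 * Ph * (P * eta1 (w / rho) / rho) * Z = (2 * Ph * P * (Z / rho)) * eta1 (w / rho) by ring.
  have Zr : 0 <= Z / rho by rewrite divr_ge0// ltW.
  have JZ : J * (Z / rho) <= 2.
    rewrite mulrA ler_pdivrMr//; apply: le_trans Jw; exact: ler_wpM2l.
  move: (Z / rho) Zr JZ => Zr Zr0 JZ.
  have := le_mul_norm (lexx `|2 * Ph * P * Zr|) bJ.
  have X0 : 0 <= 2 * Ph * P * Zr by rewrite !mulr_ge0.
  rewrite (ger0_norm X0); apply: le_trans; rewrite lerN2.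
  have -> : 2 * Ph * P * Zr * (B * J) = 2 * B * Ph * (J * Zr * P) by ring.
  have h : J * Zr * P <= 2 * (J * rho `^ (- (p / 2))).
    have -> : J * Zr * P = (J * Zr) * (J * P) by rewrite -{1}JJ; ring.
    by apply: ler_pM; rewrite ?mulr_ge0.
  have b : 0 <= 2 * B * Ph by rewrite !mulr_ge0.
  have := ler_wpM2l b h; lra.
have ee : p * N%:R * eps = (N%:R - p) / 2.
  by rewrite /eps; field; apply/andP; split; lra.
have ee2 : p * N%:R * (eps * (Ph * P * E)) = (N%:R - p) / 2 * (Ph * P * E) by rewrite -ee; ring.
rewrite ee2 in crossS.
set S1 := \sum_i z i * (P * E) * _ in crossS *; set S2 := \sum_i `|g i| `^ p in crossS *.
set c1 := p * eps `^ (1 - p) in crossS *.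
lra.
Qed.

(** The sum is the divergence of [cutw] times the gradient of [reg v] minus [reg v] times the
    gradient of [cutw]. Where the cutoff is [1], minus the Laplacian of [w^(1-q)] is at least
    [2 (q - 1) (N - 2q) w^(-q)]. Young spends half of it against the Laplacian of [v], and by
    convexity the term with the squared gradient has the favourable sign. *)
Lemma rellich_pointwise q k rho B v w (z g h : 'I_N -> R) : 1 < q -> 2 * q < N%:R -> 0 < k ->
  0 < rho -> 0 < w -> (forall s : R, `|eta1 s| <= B /\ `|eta2 s| <= B) ->
  \sum_i z i ^+ 2 <= w ->
  (q - 1) * (N%:R - 2 * q) * (reg k (q / 2) v * w `^ (- q) * eta (w / rho)) <=
    \sum_i ((reg1 k (q / 2) v * h i + reg2 k (q / 2) v * (g i * g i)) * cutw rho (q - 1) w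
      - reg k (q / 2) v * (cutw2 rho (q - 1) w * (2 * z i) * (2 * z i) + cutw1 rho (q - 1) w * 2))
    + q * ((q - 1) * (N%:R - 2 * q) / q) `^ (1 - q) * `|\sum_i h i| `^ q
    + B * (16 * q + 4 * N%:R) * (reg k (q / 2) v * rho `^ (- q) * in_ring rho w).
Proof.
move=> q1 qN k0 r0 w0 bB zw.
have N0 : 0 < N%:R :> R by lra.
have q2 : 2 * (q / 2) = q by lra.
have q0 : 0 < q by lra.
have qN0 : 0 < (q - 1) * (N%:R - 2 * q) by rewrite mulr_gt0//; lra.
set eps := (q - 1) * (N%:R - 2 * q) / q.
have e0 : 0 < eps by rewrite divr_gt0.
set Ph := reg k (q / 2) v; set E := eta (w / rho).
set Q := w `^ (- q); set Q1 := w `^ (- (q - 1)); set Q0 := w `^ (- q - 1).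
have eQ : - (q - 1) - 1 = - q by lra.
have Q0w : Q0 * w = Q by exact: powRS1.
have Qw : Q * w = Q1 by rewrite /Q -eQ; exact: powRS1.
have [Q_ge0 Q0_ge0] : 0 <= Q /\ 0 <= Q0 by split; exact: powR_ge0.
have Q1_ge0 : 0 <= Q1 by exact: powR_ge0.
have Ph0 : 0 <= Ph by exact: reg_ge0.
have [E0 E1] : 0 <= E /\ E <= 1 by rewrite eta_ge0 eta_le1.
have Z0 : 0 <= \sum_i z i ^+ 2 by apply: sumr_ge0 => i _; exact: sqr_ge0.
have cross : - (q * (eps * (Ph * Q * E)) + q * eps `^ (1 - q) * `|\sum_i h i| `^ q) <=
    reg1 k (q / 2) v * (\sum_i h i) * (Q1 * E).
  have h1 := @reg1_le k (q / 2) v k0 ltac:(lra).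
  rewrite q2 in h1.
  have hy := @hardy_young q (reg k 2^-1 v) w eps `|\sum_i h i| q1 (reg_ge0 _ _ _) w0 e0 (normr_ge0 _) 1 ltac:(lra).
  have e1 : reg k 2^-1 v `^ q = Ph by rewrite /Ph -[q in LHS]q2 reg_half_pow.
  rewrite e1 !mul1r -/Q -/Q1 in hy.
  have -> : reg1 k (q / 2) v * (\sum_i h i) * (Q1 * E) = reg1 k (q / 2) v * (Q1 * E * (\sum_i h i)) by ring.
  apply: le_trans (le_mul_norm h1 (lexx _)).
  rewrite lerN2 (normrM (Q1 * E)) (normrM Q1) (ger0_norm Q1_ge0) (ger0_norm E0).
  set X := eps `^ (1 - q) * _ in hy.
  have X0 : 0 <= X by rewrite mulr_ge0 ?powR_ge0.
  rewrite -(mulrA q (eps `^ _)) -/X.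
  move: `|\sum_i h i| (reg k 2^-1 v `^ (q - 1)) X X0 hy => H a X X0 hy.
  clearbody Q1 Ph Q E.
  have -> : q * a * (Q1 * E * H) = q * E * (a * (Q1 * H)) by ring.
  have qE : 0 <= q * E by rewrite mulr_ge0// ltW.
  apply: (le_trans (ler_wpM2l qE hy)).
  have XE : E * X <= X by rewrite ler_piMl.
  have := ler_wpM2l (ltW q0) XE; lra.
have convex : 0 <= reg2 k (q / 2) v * (\sum_i g i * g i) * (Q1 * E).
  have r2 : 0 <= reg2 k (q / 2) v by apply: reg2_ge0 => //; rewrite q2 ltW.
  have gg : 0 <= \sum_i g i * g i by apply: sumr_ge0 => i _; rewrite -expr2 sqr_ge0.
  by apply: mulr_ge0; apply: mulr_ge0.
set T1 := cutw1 _ _ _; set T2 := cutw2 _ _ _.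
have -> : \sum_i ((reg1 k (q / 2) v * h i + reg2 k (q / 2) v * (g i * g i)) * cutw rho (q - 1) w
      - Ph * (T2 * (2 * z i) * (2 * z i) + T1 * 2)) =
  reg1 k (q / 2) v * (\sum_i h i) * (Q1 * E) + reg2 k (q / 2) v * (\sum_i g i * g i) * (Q1 * E)
  - Ph * T2 * 4 * (\sum_i z i ^+ 2) - N%:R * (2 * Ph * T1).
  have -> : cutw rho (q - 1) w = Q1 * E by [].
  have sN (x : R) : \sum_(i < N) x = N%:R * x by rewrite sumr_const card_ord mulr_natl.
  rewrite -sN !mulr_sumr !mulr_suml -big_split -sumrB -sumrB /=; apply: eq_bigr => i _.
  move: T1 T2 (reg1 _ _ _) (reg2 _ _ _) => T1 T2 t1 t2; clear; ring.
have [bJ1 bJ2] := @eta_ring B rho w r0 bB.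
have [/andP[J0 J1] Jw Jp] := @in_ringP rho w r0.
rewrite /T1 /T2 /cutw1 /cutw2 !eQ -/E -/Q0 -/Q1 -/Q.
set J := in_ring rho w in bJ1 bJ2 J0 J1 Jw Jp *.
have JP : J * Q <= J * rho `^ (- q) by apply: Jp; lra.
have JJ : J * J = J by rewrite /J /in_ring; case: (rho <= w <= 2 * rho); rewrite ?mulr1 ?mulr0.
have B0 : 0 <= B by exact: le_trans (normr_ge0 _) (bB 0).1.
have ee : q * eps = (q - 1) * (N%:R - 2 * q) by rewrite /eps mulrC divfK// gt_eqF.
set Z := \sum_i z i ^+ 2 in zw Z0 *.
have Zr0 : 0 <= Z / rho by rewrite divr_ge0// ltW.
have wr0 : 0 <= w / rho by rewrite divr_ge0// ltW.
have JZ : J * (Z / rho) <= 2.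
  by rewrite mulrA ler_pdivrMr//; apply: le_trans Jw; exact: ler_wpM2l.
have Jwr : J * (w / rho) <= 2 by rewrite mulrA ler_pdivrMr.
clearbody Z J Q Q1 Q0 Ph E T1 T2.
have t1 : (q - 1) * q * Ph * (Q0 * Z * E) <= (q - 1) * q * Ph * (Q * E).
  have c0 : 0 <= (q - 1) * q * Ph by rewrite !mulr_ge0//; lra.
  by rewrite ler_wpM2l// ler_wpM2r// -Q0w ler_wpM2l.
(* Each derivative of the cutoff comes with factors [Z / rho] or [w / rho], at most [2] on the ring.
   In units of [B] the three errors are [16 (q - 1)], [16] and [4 N], the constant of the
   statement. *)
have cut (c X e : R) : 0 <= c -> 0 <= X -> J * X <= c -> `|e| <= B * J ->
    - (c * B * (Ph * rho `^ (- q) * J)) <= Ph * Q * X * e /\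
    Ph * Q * X * e <= c * B * (Ph * rho `^ (- q) * J).
  move=> c0 X0 JX eJ; apply/andP; rewrite -ler_norml normrM ger0_norm ?mulr_ge0//.
  have PQX : 0 <= Ph * Q * X by rewrite !mulr_ge0.
  apply: le_trans (ler_wpM2l PQX eJ) _.
  have -> : Ph * Q * X * (B * J) = B * Ph * (J * X * (J * Q)) by rewrite -{1}JJ; ring.
  have -> : c * B * (Ph * rho `^ (- q) * J) = B * Ph * (c * (J * rho `^ (- q))) by ring.
  by apply: ler_wpM2l; rewrite ?mulr_ge0//; apply: ler_pM; rewrite ?mulr_ge0.
have [_ u1] := @cut 2 (Z / rho) (eta1 (w / rho)) ltac:(lra) Zr0 JZ bJ1.
have [u1' _] := @cut 2 (Z / rho) (eta1 (w / rho)) ltac:(lra) Zr0 JZ bJ1.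
have [_ u2] := @cut 2 (w / rho) (eta1 (w / rho)) ltac:(lra) wr0 Jwr bJ1.
have u3 : Ph * Q * ((Z / rho) * (w / rho)) * eta2 (w / rho) <= 4 * B * (Ph * rho `^ (- q) * J).
  have := @cut 4 ((Z / rho) * (w / rho)) (eta2 (w / rho)) ltac:(lra) (mulr_ge0 Zr0 wr0) _ bJ2.
  case=> //.
  have -> : J * (Z / rho * (w / rho)) = (J * (Z / rho)) * (J * (w / rho)) by rewrite -{1}JJ; ring.
  have -> : 4 = 2 * 2 :> R by ring.
  by rewrite ler_pM// mulr_ge0.
set S1 := reg1 k (q / 2) v * _ * _ in cross *.
set S2 := reg2 k (q / 2) v * _ * _ in convex *.
rewrite -!exprVn -Qw.
have ce : q * (eps * (Ph * Q * E)) = (q - 1) * (N%:R - 2 * q) * (Ph * Q * E).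
  by rewrite -ee; ring.
rewrite {}ce in cross.
set c1 := q * eps `^ (1 - q) * _ in cross *.
set Y := Ph * rho `^ (- q) * J in u1 u1' u2 u3 *.
have v1 : (q - 1) * 8 * (- (2 * B * Y)) <= (q - 1) * 8 * (Ph * Q * (Z / rho) * eta1 (w / rho)).
  by rewrite ler_wpM2l//; lra.
have v2 : 2 * N%:R * (Ph * Q * (w / rho) * eta1 (w / rho)) <= 2 * N%:R * (2 * B * Y).
  by rewrite ler_wpM2l//; lra.
clearbody S1 S2 c1 Y.
have -> : S1 + S2 - Ph * ((q - 1) * (q - 1 + 1) * Q0 * E
    - 2 * (q - 1) * Q * eta1 (w / rho) / rho + Q * w * eta2 (w / rho) * rho^-1 ^+ 2) * 4 * Z
   - N%:R * (2 * Ph * (- (q - 1) * Q * E + Q * w * eta1 (w / rho) / rho)) =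
  S1 + S2 - 4 * ((q - 1) * q * Ph * (Q0 * Z * E)) + (q - 1) * 8 * (Ph * Q * (Z / rho) * eta1 (w / rho))
  - 4 * (Ph * Q * ((Z / rho) * (w / rho)) * eta2 (w / rho))
  + 2 * N%:R * (q - 1) * (Ph * Q * E) - 2 * N%:R * (Ph * Q * (w / rho) * eta1 (w / rho)).
  ring.
have -> : B * (16 * q + 4 * N%:R) * Y = (q - 1) * 8 * (2 * B * Y) + 4 * (4 * B * Y) + 2 * N%:R * (2 * B * Y) by ring.
lra.
Qed.

End hardy_algebra.

(** * Comparison of integrals modulo a divergence *)

Section integral_comparisons.
Context d (T : measurableType d) (R : realType) (mu : {measure set T -> \bar R}).
Implicit Types (f g w D : T -> R).

(** How integration by parts enters: a pointwise inequality up to a function [D] of mean zero.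
    Unless the right side is infinite, [D + g] is integrable and dominates [f]. *)
Lemma le_int_mean0 f g D : measurable_fun setT f -> measurable_fun setT g ->
  (forall x, 0 <= f x) -> (forall x, 0 <= g x) ->
  mu.-integrable setT (EFin \o D) -> (\int[mu]_x (D x)%:E = 0)%E ->
  (forall x, f x <= D x + g x) ->
  (\int[mu]_x (f x)%:E <= \int[mu]_x (g x)%:E)%E.
Proof.
move=> mf mg f0 g0 iD D0 fDg.
have ig0 : (0 <= \int[mu]_x (g x)%:E)%E by apply: integral_ge0 => x _; rewrite lee_fin.
have [goo|] := ltP (\int[mu]_x (g x)%:E)%E +oo%E; last by rewrite leye_eq => /eqP ->; rewrite leey.
have ig : mu.-integrable setT (EFin \o g).
  apply/integrableP; split; first exact/measurable_EFinP.
  by under eq_integral do rewrite /= ger0_norm//.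
have iDg : mu.-integrable setT (fun x => (D x)%:E + (g x)%:E)%E by exact: integrableD.
rewrite -[leRHS]add0e -D0 -integralD//; apply: le_integral => //.
  apply: le_integrable iDg => //; first exact/measurable_EFinP.
  by move=> x _ /=; rewrite lee_fin ger0_norm// (le_trans (fDg x))// ler_norm.
by move=> x _; rewrite -EFinD lee_fin.
Qed.

Lemma int_tail_small f w (eps : R) : measurable_fun setT f -> measurable_fun setT w ->
  (forall x, 0 <= f x) -> (\int[mu]_x (f x)%:E < +oo)%E -> 0 < eps ->
  exists2 M : R, 0 < M & (\int[mu]_x (f x * \1_[set x | M <= w x] x)%:E <= eps%:E)%E.
Proof.
move=> mf mw f0 foo e0.
pose h (n : nat) x := f x * \1_[set x | n.+1%:R <= w x] x.
have mle (n : nat) : measurable [set x | n.+1%:R <= w x].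
  rewrite -[X in measurable X]setTI.
  have := mw measurableT `[n.+1%:R, +oo[%classic (measurable_itv _).
  by congr (measurable (_ `&` _)); apply/seteqP; split => x /=; rewrite in_itv/= andbT.
have mh n : measurable_fun setT (h n).
  by apply: measurable_funM => //; exact: measurable_indic.
have ig : mu.-integrable setT (EFin \o f).
  apply/integrableP; split; first exact/measurable_EFinP.
  by under eq_integral do rewrite /= ger0_norm//.
have : (\int[mu]_x (h n x)%:E @[n --> \oo] --> 0%:E)%E.
  rewrite -[X in _ --> X](integral0 mu setT).
  apply: (@dominated_cvg _ _ _ mu setT measurableT (fun n x => (h n x)%:E) _ (EFin \o f)) => //.
  - by move=> n; exact/measurable_EFinP.
  - move=> x _; apply: cvg_near_cst; exists (Num.truncn (w x)) => // n /= wn.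
    rewrite /h indicE memNset ?mulr0//= => hw.
    by move: wn; rewrite leqNgt truncn_gt_nat hw.
  - by move=> n x _ /=; rewrite lee_fin /h indicE; case: (_ \in _); rewrite ?mulr1 ?mulr0 ger0_norm.
move=> /fine_cvgP[hfin hcv].
have [n [hn1 hn2]] := filter_ex (filterI hfin (cvgr_lt (0:R) hcv eps e0)).
by exists n.+1%:R => //; rewrite -(fineK hn1) lee_fin ltW.
Qed.

End integral_comparisons.

(** * Weighted Hardy and Rellich inequalities for smooth functions *)

Section weight.
Context {R : realType} {N : nat}.
Local Notation V := 'rV[R]_N.
Local Notation e i := (delta_mx ord0 i : V).
Local Notation leb := (measure_function_SigmaFiniteMeasure__to__measure_function_Measure (lebesgue_rV R N)).
Implicit Types (x y : V) (del : R).

Lemma is_derive_sumf (I : Type) (s : seq I) (f : I -> V -> R) (df : I -> R) x (v : V) :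
  (forall i, is_derive x v (f i) (df i)) ->
  is_derive x v (fun y => \sum_(i <- s) f i y) (\sum_(i <- s) df i).
Proof.
move=> fd; elim: s => [|i s IH].
  rewrite big_nil (_ : (fun _ => _) = cst 0); first exact: is_derive_cst.
  by apply/funext => y; rewrite big_nil.
rewrite big_cons (_ : (fun _ => _) = fun y => f i y + \sum_(j <- s) f j y).
  exact: is_derive_addf.
by apply/funext => y; rewrite big_cons.
Qed.

(** The shift [del] keeps negative powers of the squared distance differentiable at [y]. *)
Definition wt y del x : R := del + \sum_i (x ord0 i - y ord0 i) ^+ 2.

Lemma is_derive_wt y del x i : is_derive x (e i) (wt y del) (2 * (x ord0 i - y ord0 i)).
Proof.
have h (j : 'I_N) : is_derive x (e i) (fun x : V => (x ord0 j - y ord0 j) ^+ 2)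
    ((j == i)%:R * (2 * (x ord0 j - y ord0 j))).
  have h1 := is_derive_addf (is_derive_coord x j i) (is_derive_cst (- y ord0 j) x (e i)).
  apply: (is_derive_eqr (is_derive_mulf h1 h1)); rewrite /cst; ring.
apply: (is_derive_eqr (is_derive_addf (is_derive_cst del x (e i)) (is_derive_sumf _ h))).
rewrite add0r (bigD1 i)//= eqxx mul1r big1 ?addr0// => j /negPf ->.
by rewrite mul0r.
Qed.

Lemma continuous_coord i : continuous (fun x : V => x ord0 i).
Proof. exact: coord_continuous. Qed.

Lemma continuous_wt y del : continuous (wt y del).
Proof.
apply: continuous_addf; first exact: cst_continuous.
apply: continuous_sumf => i.
by apply: continuous_mulf; apply: continuous_addf; (exact: continuous_coord || exact: cst_continuous).
Qed.

Lemma wt_gt0 y del x : 0 < del -> 0 < wt y del x.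
Proof. by move=> d0; rewrite ltr_wpDr// sumr_ge0// => i _; exact: sqr_ge0. Qed.

Lemma wt_sum_le y del x : 0 <= del -> \sum_i (x ord0 i - y ord0 i) ^+ 2 <= wt y del x.
Proof. by move=> d0; rewrite lerDr. Qed.

Lemma wt_cube y del x (r : R) : 0 <= del -> 0 <= r -> wt y del x <= 2 * r ^+ 2 -> cube y (2 * r) x.
Proof.
move=> d0 r0 wr i; rewrite -(@ler_pXn2r _ 2)// ?nnegrE ?mulr_ge0//.
rewrite -normrX ger0_norm ?sqr_ge0// exprMn.
have := wt_sum_le y x d0; rewrite (bigD1 i)//=.
have : 0 <= \sum_(j < N | j != i) (x ord0 j - y ord0 j) ^+ 2 by apply: sumr_ge0 => j _; exact: sqr_ge0.
have := sqr_ge0 r; lra.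
Qed.

Lemma powR_sqr (a b : R) : 0 <= a -> (a ^+ 2) `^ (b / 2) = a `^ b.
Proof. by move=> a0; rewrite -powR_mulrn// -powRrM mulrC divfK. Qed.

Lemma reg_ge_powR (k s v : R) : 0 <= k -> 0 <= s -> `|v| `^ s <= reg k (s / 2) v.
Proof.
move=> k0 s0; rewrite /reg -(@powR_sqr _ _ (normr_ge0 v)) -normrX ger0_norm ?sqr_ge0//.
by apply: ge0_ler_powR; rewrite ?nnegrE ?divr_ge0 ?addr_ge0 ?sqr_ge0 ?lerDl.
Qed.

(* Where [|v|] is large, [|v|^s rho^-m] is absorbed by the critical power of [v];
   where it is small, it is at most [eps] times the inverse volume. *)
Lemma critical_split (s m eps rho : R) (n := N%:R : R) :
  0 < s -> 0 < m -> 2 * m < n -> 0 < eps -> 0 < rho ->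
  exists2 k : R, 0 < k & forall v, reg k (s / 2) v * rho `^ (- m) <=
    2 `^ s * (2 * eps * rho `^ (- (n / 2)) +
              eps `^ (- (2 * m / (n - 2 * m))) * `|v| `^ (n * s / (n - 2 * m))).
Proof.
move=> s0 m0 mn e0 r0.
pose X := eps * rho `^ (m - n / 2); pose kap := X `^ s^-1.
have X0 : 0 < X by rewrite mulr_gt0// powR_gt0.
have k0 : 0 < kap by rewrite powR_gt0.
have kX : kap `^ s = X by rewrite -powRrM mulVf ?gt_eqF// powRr1// ltW.
exists (kap ^+ 2) => [|v]; first by rewrite exprn_gt0.
have Xr : X * rho `^ (- m) = eps * rho `^ (- (n / 2)).
  by rewrite -mulrA -powRD ?(gt_eqF r0) ?implybT//; congr (_ * _ `^ _); lra.
have h1 : reg (kap ^+ 2) (s / 2) v <= 2 `^ s * (`|v| `^ s + X).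
  have := @powR_add_le R s `|v| kap (ltW s0).
  rewrite normr_id (gtr0_norm k0) kX; apply: le_trans.
  rewrite -(@powR_sqr _ s (normr_ge0 (`|v| + kap))) /reg.
  apply: ge0_ler_powR; rewrite ?nnegrE ?divr_ge0 ?(ltW s0) ?sqr_ge0 ?addr_ge0 ?sqr_ge0//.
  rewrite real_normK ?num_real// sqrrD real_normK ?num_real//.
  have : 0 <= `|v| * kap *+ 2 by rewrite mulrn_wge0// mulr_ge0// ltW.
  lra.
have P0 : 0 <= rho `^ (- m) by exact: powR_ge0.
apply: le_trans (ler_wpM2r P0 h1) _.
rewrite -[leLHS]mulrA ler_wpM2l ?powR_ge0// mulrDl Xr.
have h2 : `|v| `^ s * rho `^ (- m) <= eps * rho `^ (- (n / 2)) +
    eps `^ (- (2 * m / (n - 2 * m))) * `|v| `^ (n * s / (n - 2 * m)).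
  have [vk|kv] := leP `|v| kap.
    rewrite -Xr -kX -[leLHS]addr0 lerD ?mulr_ge0 ?powR_ge0//.
    by rewrite ler_wpM2r// ge0_ler_powR// ?nnegrE ltW.
  rewrite -[leLHS]add0r lerD ?mulr_ge0 ?powR_ge0// ?(ltW e0)//.
  set b := n * s / (n - 2 * m).
  have v0 : 0 < `|v| by exact: lt_trans kv.
  have sb : s - b = s * (- (2 * m / (n - 2 * m))) by rewrite /b; field; lra.
  have sbn : s - b <= 0.
    by rewrite sb mulrN oppr_le0 mulr_ge0 ?divr_ge0//; lra.
  rewrite -{1}(subrK b s) powRD ?(gt_eqF v0) ?implybT// mulrAC ler_wpM2r ?powR_ge0//.
  apply: (@le_trans _ _ (kap `^ (s - b) * rho `^ (- m))).
    rewrite ler_wpM2r// -[s - b]opprK !(powRN _ (- (s - b))) lef_pV2 ?posrE ?powR_gt0//.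
    by rewrite ge0_ler_powR// ?nnegrE ?oppr_ge0// ltW.
  rewrite sb powRrM kX powRM ?(ltW e0) ?powR_ge0// -powRrM -mulrA -powRD ?(gt_eqF r0) ?implybT//.
  rewrite (_ : _ + - m = 0) ?powRr0 ?mulr1//.
  by field; lra.
lra.
Qed.

(** Removes the cutoff. The critical exponent is [sobolev1 N p] for [s = p], [m = p / 2] and
    [sobolev2 N q] for [s = q], [m = q]. Its mere integrability makes the ring error smaller than
    any [e] once [rho] is large, and Fatou's lemma recovers the full weight. *)
Lemma absorb (v F : V -> R) y (del s m c C1 C2 : R) (n := N%:R : R) :
  continuous v -> measurable_fun setT F -> (forall x, 0 <= F x) ->
  0 < del -> 0 < s -> 0 < m -> 2 * m < n -> 0 <= c -> 0 <= C1 -> 0 <= C2 ->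
  (\int[leb]_x (`|v x| `^ (n * s / (n - 2 * m)))%:E < +oo)%E ->
  (forall k rho : R, 0 < k -> 0 < rho -> exists D : V -> R,
    [/\ leb.-integrable setT (EFin \o D), (\int[leb]_x (D x)%:E = 0)%E &
      forall x, c * (reg k (s / 2) (v x) * wt y del x `^ (- m) * eta (wt y del x / rho)) <=
        D x + C1 * F x + C2 * (reg k (s / 2) (v x) * rho `^ (- m) * in_ring rho (wt y del x))]) ->
  (c%:E * \int[leb]_x (`|v x| `^ s * wt y del x `^ (- m))%:E <= C1%:E * \int[leb]_x (F x)%:E)%E.
Proof.
move=> cv mF F0 d0 s0 m0 mn c0 C10 C20 voo H.
set b := n * s / (n - 2 * m).
have mv := continuous_measurable_rV cv.
have cw := @continuous_wt y del; have mw := continuous_measurable_rV cw.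
have w0 x : 0 < wt y del x by exact: wt_gt0.
have mwm : measurable_fun setT (fun x => wt y del x `^ (- m)).
  exact: (measurableT_comp (@measurable_powR R (- m)) mw).
have mvs : measurable_fun setT (fun x => `|v x| `^ s) by exact: measurable_powR_norm.
have mvb : measurable_fun setT (fun x => `|v x| `^ b) by exact: measurable_powR_norm.
apply/lee_addgt0Pr => e e0.
(* Constant of the ring error: [4 ^+ N] is the volume of [cube y (2 * r j)] divided by [r j ^+ N],
   and the summand [1] comes from the tail of the critical power. *)
pose K : R := C2 * (2 `^ s * (2 * 4 ^+ N + 1)).
have K0 : 0 <= K by rewrite !mulr_ge0 ?powR_ge0// addr_ge0// mulr_ge0// exprn_ge0.
pose eps := e / (K + 1).
have eps0 : 0 < eps by rewrite divr_gt0// ltr_wpDl.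
pose Ce := eps `^ (- (2 * m / (n - 2 * m))).
have Ce0 : 0 < Ce by rewrite powR_gt0.
have [M M0 tail] := int_tail_small mvb mw (fun x => powR_ge0 _ _) voo (divr_gt0 eps0 Ce0).
rewrite -intZ//; last 2 first.
- by apply: measurable_funM.
- by move=> x; rewrite mulr_ge0 ?powR_ge0.
(* With [rho j = r j ^+ 2 >= M] the ring lies both in the tail region [M <= wt] and in the cube of
   radius [2 * r j]. *)
pose r (j : nat) : R := j.+1%:R + M.
have r1 j : 1 <= r j by apply: (@le_trans _ _ j.+1%:R); rewrite ?ler1n// lerDl ltW.
have r0 j : 0 < r j by exact: lt_le_trans (r1 j).
pose rho j := r j ^+ 2.
have rho0 j : 0 < rho j by rewrite exprn_gt0.
have Mrho j : M <= rho j.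
  apply: (@le_trans _ _ (r j)); first by rewrite lerDr.
  by rewrite /rho expr2 ler_peMr// ltW.
have meta j : measurable_fun setT (fun x => eta (wt y del x / rho j)).
  apply: continuous_measurable_rV; apply: (@continuous_compf _ _ eta); first exact: continuous_eta.
  by apply: continuous_mulf => //; exact: cst_continuous.
apply: (@fatou_bound _ _ _ _ (fun j x => c * (`|v x| `^ s * wt y del x `^ (- m) * eta (wt y del x / rho j)))).
- by move=> j; apply: measurable_funM => //; apply: measurable_funM => //; exact: measurable_funM.
- by apply: measurable_funM => //; exact: measurable_funM.
- by move=> j x; rewrite mulr_ge0// mulr_ge0 ?eta_ge0// mulr_ge0 ?powR_ge0.
- by move=> x; rewrite !mulr_ge0 ?powR_ge0.
- apply: aeW => x; apply: cvg_near_cst; exists (Num.truncn (wt y del x)) => // j /= wj.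
  rewrite eta_eq1 ?mulr1// ler_pdivrMr// mul1r.
  apply: (@le_trans _ _ (r j)); last by rewrite /rho expr2 ler_peMr// ltW.
  apply: (@le_trans _ _ j.+1%:R); last by rewrite lerDl ltW.
  by move: wj; rewrite leqNgt truncn_gt_nat -ltNge => /ltW.
move=> j.
pose Err x := 2 `^ s * (2 * eps * rho j `^ (- (n / 2)) * \1_(cube y (2 * r j)) x +
   Ce * (`|v x| `^ b * \1_[set x | M <= wt y del x] x)).
have [k k0 hk] := critical_split s0 m0 mn eps0 (rho0 j).
have mE : measurable_fun setT Err.
  apply: measurable_funM => //; apply: measurable_funD; apply: measurable_funM => //.
    by apply: measurable_indic; exact: measurable_cube.
  apply: measurable_funM => //; apply: measurable_indic.
  rewrite -[X in measurable X]setTI.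
  have := mw measurableT `[M, +oo[%classic (measurable_itv _).
  by congr (measurable (_ `&` _)); apply/seteqP; split => x /=; rewrite in_itv/= andbT.
have a0 : 0 <= 2 * eps * rho j `^ (- (n / 2)) by rewrite mulr_ge0 ?powR_ge0// mulr_ge0// ltW.
have t0 x : 0 <= `|v x| `^ b * \1_[set x | M <= wt y del x] x by rewrite mulr_ge0 ?powR_ge0.
have E0 x : 0 <= Err x.
  by rewrite mulr_ge0 ?powR_ge0// addr_ge0// mulr_ge0// ltW.
have [D [iD D0 HD]] := H k (rho j) k0 (rho0 j).
apply: (@le_trans _ _ (\int[leb]_x (C1 * F x + C2 * Err x)%:E)%E).
  apply: (@le_int_mean0 _ _ _ _ _ _ D) => //.
  - by apply: measurable_funM => //; apply: measurable_funM => //; exact: measurable_funM.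
  - by apply: measurable_funD; exact: measurable_funM.
  - by move=> x; rewrite mulr_ge0// mulr_ge0 ?eta_ge0// mulr_ge0 ?powR_ge0.
  - by move=> x; rewrite addr_ge0// mulr_ge0.
  move=> x; apply: (@le_trans _ _ (c * (reg k (s / 2) (v x) * wt y del x `^ (- m) * eta (wt y del x / rho j)))).
    by rewrite ler_wpM2l// ler_wpM2r ?eta_ge0// ler_wpM2r ?powR_ge0// reg_ge_powR// ltW.
  apply: (le_trans (HD x)); rewrite addrA lerD// ler_wpM2l//.
  rewrite /in_ring; have [/andP[wl wu]|_] := boolP (rho j <= wt y del x <= 2 * rho j); last first.
    by rewrite mulr0.
  rewrite mulr1; apply: (le_trans (hk (v x))).
  rewrite /Err !indicE !mem_set ?mulr1//=; last by apply: (wt_cube (ltW d0) (ltW (r0 j))).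
  exact: le_trans (Mrho j) wl.
rewrite intD//; last 4 first.
- exact: measurable_funM.
- exact: measurable_funM.
- by move=> x; rewrite mulr_ge0.
- by move=> x; rewrite mulr_ge0.
rewrite (intZ leb mF)// (intZ leb mE)//; apply: leeD => //.
have : (\int[leb]_x (Err x)%:E <= (2 `^ s * (2 * 4 ^+ N + 1) * eps)%:E)%E.
  have i1 : measurable (cube y (2 * r j)) by exact: measurable_cube.
  have mt : measurable_fun setT (fun x => `|v x| `^ b * \1_[set x | M <= wt y del x] x).
    apply: measurable_funM => //; apply: measurable_indic.
    rewrite -[X in measurable X]setTI.
    have := mw measurableT `[M, +oo[%classic (measurable_itv _).
    by congr (measurable (_ `&` _)); apply/seteqP; split => x /=; rewrite in_itv/= andbT.
  rewrite /Err intZ ?powR_ge0//; last 2 first.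
  - apply: measurable_funD; apply: measurable_funM => //; exact: measurable_indic.
  - by move=> x; rewrite addr_ge0// mulr_ge0// ltW.
  rewrite intD; last 4 first.
  - by apply: measurable_funM => //; exact: measurable_indic.
  - exact: measurable_funM.
  - by move=> x; rewrite mulr_ge0.
  - by move=> x; rewrite mulr_ge0// ltW.
  rewrite int_indic// (intZ leb mt); last 2 first.
  - exact: t0.
  - exact: ltW.
  rewrite -(mulrA (2 `^ s)) (EFinM (2 `^ s)) lee_pmul2l ?lte_fin ?powR_gt0//.
  have -> : (2 * 4 ^+ N + 1) * eps = 2 * 4 ^+ N * eps + eps by ring.
  rewrite (EFinD _ eps); apply: leeD.
    rewrite leb_cube ?mulr_ge0 ?(ltW (r0 j))// -EFinM lee_fin.
    have -> : rho j `^ (- (n / 2)) = (r j ^+ N)^-1.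
      by rewrite powRN powR_sqr ?(ltW (r0 j))// powR_mulrn// ltW.
    rewrite mulrA exprMn -natrM.
    by rewrite le_eqVlt; apply/orP; left; apply/eqP; field; rewrite expf_neq0// gt_eqF.
  have -> : eps%:E = (Ce%:E * (eps / Ce)%:E)%E by rewrite -EFinM mulrC divfK ?gt_eqF.
  by rewrite lee_pmul2l// lte_fin.
move=> hE; apply: le_trans (lee_wpmul2l _ hE) _; first by rewrite lee_fin.
rewrite -EFinM lee_fin (_ : C2 * _ = K * eps); last by rewrite /K; ring.
rewrite /eps mulrA ler_pdivrMr ?ltr_wpDl// mulrC ler_wpM2l ?(ltW e0)// lerDl//.
Qed.

Lemma int_div_eq0 (H dH : 'I_N -> V -> R) (r : R) :
  (forall i x, is_derive x (e i) (H i) (dH i x)) -> (forall i, continuous (H i)) ->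
  (forall i, continuous (dH i)) -> (forall i x, ~ cube 0 r x -> H i x = 0) ->
  leb.-integrable setT (EFin \o (fun x => \sum_i dH i x)) /\
  (\int[leb]_x (\sum_i dH i x)%:E = 0)%E.
Proof.
move=> Hd cH cdH H0.
have part i : leb.-integrable setT (EFin \o dH i) /\ (\int[leb]_x (dH i x)%:E = 0)%E.
  by apply: (int_partial_eq0 (Hd i) (cH i) (cdH i) (H0 i)); exact: derive_supp (Hd i) (H0 i).
elim: (index_enum _) => [|i s [IH1 IH2]].
  split; first by apply: eq_integrable (integrable0 _ _) => // x _; rewrite /= big_nil.
  by rewrite integral0_eq// => x _; rewrite big_nil.
have E (x : V) : (\sum_(j <- i :: s) dH j x)%:E = ((dH i x)%:E + (\sum_(j <- s) dH j x)%:E)%E.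
  by rewrite big_cons EFinD.
have [i1 i2] := part i.
split; first by apply: eq_integrable (integrableD _ i1 IH1) => // x _; rewrite /= E.
by under eq_integral do rewrite E; rewrite integralD// i2 IH2 adde0.
Qed.

Lemma lee_divl (c C : R) (a b : \bar R) : 0 < c ->
  (c%:E * a <= C%:E * b)%E -> (a <= (C / c)%:E * b)%E.
Proof. by move=> c0 h; rewrite mulrC EFinM -muleA lee_pdivlMl. Qed.

Section truncated_weight.
Variables (y : V) (del rho m : R).
Hypotheses (del0 : 0 < del) (rho0 : 0 < rho).
Local Notation w := (wt y del).

Let cpow b : continuous (fun x => w x `^ b).
Proof. by apply: continuous_powRf; [exact: continuous_wt|move=> x; exact: wt_gt0]. Qed.

Let cscale (f : R -> R) : continuous f -> continuous (fun x => f (w x / rho)).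
Proof.
move=> cf; apply: (continuous_compf cf); apply: continuous_mulf; first exact: continuous_wt.
exact: cst_continuous.
Qed.

Lemma continuous_cutw_wt : continuous (fun x => cutw rho m (w x)).
Proof. by apply: continuous_mulf; [exact: cpow|apply: cscale; exact: continuous_eta]. Qed.

Lemma continuous_cutw1_wt : continuous (fun x => cutw1 rho m (w x)).
Proof.
apply: continuous_addf.
  apply: continuous_mulf; last by apply: cscale; exact: continuous_eta.
  by apply: continuous_mulf; [exact: cst_continuous|exact: cpow].
apply: continuous_mulf; last exact: cst_continuous.
by apply: continuous_mulf; [exact: cpow|apply: cscale; exact: continuous_eta1].
Qed.

Lemma continuous_cutw2_wt : continuous (fun x => cutw2 rho m (w x)).
Proof.
apply: continuous_addf; first apply: continuous_addf.
- apply: continuous_mulf; last by apply: cscale; exact: continuous_eta.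
  by apply: continuous_mulf; [exact: cst_continuous|exact: cpow].
- apply: continuous_oppf; apply: continuous_mulf; last exact: cst_continuous.
  apply: continuous_mulf; last by apply: cscale; exact: continuous_eta1.
  by apply: continuous_mulf; [exact: cst_continuous|exact: cpow].
- apply: continuous_mulf; last exact: cst_continuous.
  by apply: continuous_mulf; [exact: cpow|apply: cscale; exact: continuous_eta2].
Qed.

Lemma is_derive_cutw_wt x i : is_derive x (e i) (fun x => cutw rho m (w x))
  (cutw1 rho m (w x) * (2 * (x ord0 i - y ord0 i))).
Proof.
exact: (is_derive_scal_comp (is_derive_wt y del x i) (is_derive_cutw rho m (wt_gt0 y x del0))).
Qed.

Lemma is_derive_cutw1_wt x i : is_derive x (e i) (fun x => cutw1 rho m (w x))
  (cutw2 rho m (w x) * (2 * (x ord0 i - y ord0 i))).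
Proof.
exact: (is_derive_scal_comp (is_derive_wt y del x i) (is_derive_cutw1 rho m (wt_gt0 y x del0))).
Qed.

Lemma cutw_wt_supp : exists r : R, forall x, ~ cube 0 r x ->
  cutw rho m (w x) = 0 /\ cutw1 rho m (w x) = 0.
Proof.
have [r _ yr] := compact_sub_cube (@compact_cube _ _ y (2 * Num.sqrt rho)).
exists r => x xr.
have wl : 2 <= w x / rho.
  rewrite ler_pdivlMr// leNgt; apply/negP => wlt; apply: xr; apply: yr.
  apply: (@wt_cube y del x (Num.sqrt rho)); rewrite ?sqrtr_ge0 ?(ltW del0)//.
  by rewrite sqr_sqrtr ltW.
have n12 : ~~ (1 < w x / rho < 2) by rewrite negb_and -!leNgt wl orbT.
by rewrite /cutw /cutw1 eta_eq0// eta1_eq0// !mulr0 mul0r addr0.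
Qed.

End truncated_weight.

Section weighted_inequalities.
Variables (v : V -> R) (g : 'I_N -> V -> R) (y : V) (del : R).
Hypotheses (del0 : 0 < del) (cv : continuous v) (cg : forall i, continuous (g i))
  (vg : forall i x, is_derive x (e i) v (g i x)).

Let creg k b : 0 < k -> continuous (fun x => reg k b (v x)).
Proof. by move=> k0; apply: (continuous_compf (continuous_reg k0) cv). Qed.

Let creg1 k b : 0 < k -> continuous (fun x => reg1 k b (v x)).
Proof. by move=> k0; apply: (continuous_compf (continuous_reg1 k0) cv). Qed.

Let creg2 k b : 0 < k -> continuous (fun x => reg2 k b (v x)).
Proof. by move=> k0; apply: (continuous_compf (continuous_reg2 k0) cv). Qed.

Let is_derive_reg_v k b x i : 0 < k ->
  is_derive x (e i) (fun x => reg k b (v x)) (reg1 k b (v x) * g i x).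
Proof. by move=> k0; exact: (is_derive_scal_comp (vg i x) (is_derive_reg b (v x) k0)). Qed.

Let is_derive_reg1_v k b x i : 0 < k ->
  is_derive x (e i) (fun x => reg1 k b (v x)) (reg2 k b (v x) * g i x).
Proof. by move=> k0; exact: (is_derive_scal_comp (vg i x) (is_derive_reg1 b (v x) k0)). Qed.

Let cz i : continuous (fun x : V => x ord0 i - y ord0 i).
Proof. by apply: continuous_addf; [exact: continuous_coord|exact: cst_continuous]. Qed.

Let is_derive_z x i : is_derive x (e i) (fun x : V => x ord0 i - y ord0 i) 1.
Proof.
apply: (is_derive_eqr (is_derive_addf (is_derive_coord x i i) (is_derive_cst (- y ord0 i) x (e i)))).
by rewrite eqxx addr0.
Qed.

(** The Young constant of [hardy_pointwise] divided by what remains of its main coefficient. *)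
Definition hardy_const (p : R) : R :=
  p * ((N%:R - p) / (2 * p * N%:R)) `^ (1 - p) / ((N%:R - p) / 2).

(** The constant depends neither on the centre [y] nor on [del]. Freedom of the centre is what later
    yields the weak Sobolev bound. *)
Lemma hardy_ineq (p : R) : 1 < p -> p < N%:R ->
  (\int[leb]_x (`|v x| `^ (sobolev1 N p))%:E < +oo)%E ->
  (\int[leb]_x (`|v x| `^ p * wt y del x `^ (- (p / 2)))%:E <=
   (hardy_const p)%:E * \sum_i \int[leb]_x (`|g i x| `^ p)%:E)%E.
Proof.
move=> p1 pN voo.
have [B B0 bB] := @eta_bound R.
have p0 : 0 < p by lra.
have p2 : 2 * (p / 2) = p by lra.
have pm : 0 < p / 2 by lra.
have c0 : 0 < (N%:R - p) / 2 by lra.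
have mgp i : measurable_fun setT (fun x => `|g i x| `^ p).
  by apply: measurable_powR_norm; exact: continuous_measurable_rV.
have B4 : 0 <= 4 * B by rewrite mulr_ge0// ltW.
have C10 : 0 <= p * ((N%:R - p) / (2 * p * N%:R)) `^ (1 - p) by rewrite mulr_ge0 ?powR_ge0// ltW.
have := @absorb v (fun x => \sum_i `|g i x| `^ p) y del p (p / 2) ((N%:R - p) / 2)
   (p * ((N%:R - p) / (2 * p * N%:R)) `^ (1 - p)) (4 * B) cv.
rewrite p2 -/(sobolev1 N p) => /(_ _ _ del0 p0 pm pN (ltW c0) C10 B4 voo).
rewrite int_sum//.
move=> h; apply: (lee_divl c0); apply: h.
- by apply: measurable_sum => i; exact: mgp.
- by move=> x; apply: sumr_ge0 => i _; exact: powR_ge0.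
move=> k rho k0 rho0.
have [r supp] := @cutw_wt_supp y del rho (p / 2) del0 rho0.
(* Regularized and truncated form of the field [|v|^p (x - y) / |x - y|^p]. *)
pose H i x := (x ord0 i - y ord0 i) * cutw rho (p / 2) (wt y del x) * reg k (p / 2) (v x).
pose dH i x := (x ord0 i - y ord0 i) * cutw rho (p / 2) (wt y del x) * (reg1 k (p / 2) (v x) * g i x) +
  reg k (p / 2) (v x) * (cutw rho (p / 2) (wt y del x) + (x ord0 i - y ord0 i) *
   (cutw1 rho (p / 2) (wt y del x) * (2 * (x ord0 i - y ord0 i)))).
have [] := @int_div_eq0 H dH r.
- move=> i x; apply: (is_derive_eqr (is_derive_mulf (is_derive_mulf (is_derive_z x i)
    (is_derive_cutw_wt y rho (p / 2) del0 x i)) (is_derive_reg_v (p / 2) x i k0))).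
  by rewrite /dH; ring.
- move=> i; apply: continuous_mulf; last exact: creg.
  by apply: continuous_mulf; [exact: cz|exact: continuous_cutw_wt].
- have ct := @continuous_cutw_wt y del rho (p / 2) del0.
  have ct1 := @continuous_cutw1_wt y del rho (p / 2) del0.
  move=> i; apply: continuous_addf; apply: continuous_mulf.
  + exact: continuous_mulf.
  + by apply: continuous_mulf => //; exact: creg1.
  + exact: creg.
  + apply: continuous_addf => //; apply: continuous_mulf => //; apply: continuous_mulf => //.
    by apply: continuous_mulf => //; exact: cst_continuous.
- by move=> i x /supp[t0 _]; rewrite /H t0 mulr0 mul0r.
move=> iD D0; exists (fun x => \sum_i dH i x); split => // x.
exact: (@hardy_pointwise R N p k rho B (v x) (wt y del x) (fun i => x ord0 i - y ord0 i)
  (fun i => g i x) p1 pN k0 rho0 (wt_gt0 y x del0) bB (wt_sum_le y x (ltW del0))).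
Qed.

Definition rellich_const (q : R) : R :=
  q * ((q - 1) * (N%:R - 2 * q) / q) `^ (1 - q) / ((q - 1) * (N%:R - 2 * q)).

Lemma rellich_ineq (h : 'I_N -> V -> R) (q : R) : 1 < q -> 2 * q < N%:R ->
  (forall i, continuous (h i)) -> (forall i x, is_derive x (e i) (g i) (h i x)) ->
  (\int[leb]_x (`|v x| `^ (sobolev2 N q))%:E < +oo)%E ->
  (\int[leb]_x (`|v x| `^ q * wt y del x `^ (- q))%:E <=
   (rellich_const q)%:E * \int[leb]_x (`|\sum_i h i x| `^ q)%:E)%E.
Proof.
move=> q1 qN ch gh voo.
have [B B0 bB] := @eta_bound R.
have q0 : 0 < q by lra.
have c0 : 0 < (q - 1) * (N%:R - 2 * q) by rewrite mulr_gt0//; lra.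
have mh : measurable_fun setT (fun x => `|\sum_i h i x| `^ q).
  apply: measurable_powR_norm; apply: continuous_measurable_rV; exact: continuous_sumf.
have B4 : 0 <= B * (16 * q + 4 * N%:R).
  by rewrite mulr_ge0 ?(ltW B0)// addr_ge0// mulr_ge0// ltW.
have C10 : 0 <= q * ((q - 1) * (N%:R - 2 * q) / q) `^ (1 - q) by rewrite mulr_ge0 ?powR_ge0// ltW.
have := @absorb v (fun x => `|\sum_i h i x| `^ q) y del q q ((q - 1) * (N%:R - 2 * q))
   (q * ((q - 1) * (N%:R - 2 * q) / q) `^ (1 - q)) (B * (16 * q + 4 * N%:R)) cv mh
   (fun x => powR_ge0 _ _) del0 q0 q0 qN (ltW c0) C10 B4 voo.
move=> hh; apply: (lee_divl c0); apply: hh.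
move=> k rho k0 rho0.
have [r supp] := @cutw_wt_supp y del rho (q - 1) del0 rho0.
pose T x := cutw rho (q - 1) (wt y del x).
pose T1 x := cutw1 rho (q - 1) (wt y del x).
pose T2 x := cutw2 rho (q - 1) (wt y del x).
pose z i x := 2 * (x ord0 i - y ord0 i).
(* Green's field for [reg (v)] and [T]: its divergence is [T] times the Laplacian of the first minus
   the first times the Laplacian of [T]. *)
pose H i x := reg1 k (q / 2) (v x) * g i x * T x + - (reg k (q / 2) (v x) * (T1 x * z i x)).
pose dH i x := (reg1 k (q / 2) (v x) * h i x + reg2 k (q / 2) (v x) * (g i x * g i x)) * T x +
  - (reg k (q / 2) (v x) * (T2 x * z i x * z i x + T1 x * 2)).
have zd i x : is_derive x (e i) (z i) 2.
  apply: (is_derive_eqr (is_derive_mulf (is_derive_cst (2:R) x (e i)) (is_derive_z x i))).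
  by rewrite /cst mulr0 addr0 mulr1.
have cT : continuous T by exact: continuous_cutw_wt.
have cT1 : continuous T1 by exact: continuous_cutw1_wt.
have cT2 : continuous T2 by exact: continuous_cutw2_wt.
have czi i : continuous (z i) by apply: continuous_mulf => //; exact: cst_continuous.
have [] := @int_div_eq0 H dH r.
- move=> i x.
  have d1 := is_derive_mulf (is_derive_mulf (is_derive_reg1_v (q / 2) x i k0) (gh i x))
    (is_derive_cutw_wt y rho (q - 1) del0 x i).
  have d2 := is_derive_mulf (is_derive_reg_v (q / 2) x i k0)
    (is_derive_mulf (is_derive_cutw1_wt y rho (q - 1) del0 x i) (zd i x)).
  apply: (is_derive_eqr (is_derive_addf d1 (is_deriveN d2))).
  by rewrite /dH /T /T1 /T2 /z; ring.
- move=> i; apply: continuous_addf; first by apply: continuous_mulf => //; apply: continuous_mulf => //; exact: creg1.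
  by apply: continuous_oppf; apply: continuous_mulf; [exact: creg|exact: continuous_mulf].
- move=> i; apply: continuous_addf.
    apply: continuous_mulf => //; apply: continuous_addf; apply: continuous_mulf => //.
    + exact: creg1.
    + exact: creg2.
    + exact: continuous_mulf.
  apply: continuous_oppf; apply: continuous_mulf; first exact: creg.
  apply: continuous_addf; first by apply: continuous_mulf => //; exact: continuous_mulf.
  by apply: continuous_mulf => //; exact: cst_continuous.
- by move=> i x /supp[t0 t1]; rewrite /H /T /T1 t0 t1 mulr0 mul0r mulr0 oppr0 addr0.
move=> iD D0; exists (fun x => \sum_i dH i x); split => // x.
exact: (@rellich_pointwise R N q k rho B (v x) (wt y del x) (fun i => x ord0 i - y ord0 i)
  (fun i => g i x) (fun i => h i x) q1 qN k0 rho0 (wt_gt0 y x del0) bB (wt_sum_le y x (ltW del0))).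
Qed.

End weighted_inequalities.

End weight.

Section sublevel_sets.
Context d (T : measurableType d) (R : realType).
Implicit Types (f : T -> R) (a : R).

Lemma measurable_set_gt f a : measurable_fun setT f -> measurable [set x | a < f x].
Proof.
move=> mf; rewrite -[X in measurable X]setTI.
have := mf measurableT _ (measurable_itv `]a, +oo[).
by congr (measurable (_ `&` _)); apply/seteqP; split => x /=; rewrite in_itv/= andbT.
Qed.

Lemma measurable_set_lt f a : measurable_fun setT f -> measurable [set x | f x < a].
Proof.
move=> mf; rewrite -[X in measurable X]setTI.
have := mf measurableT _ (measurable_itv `]-oo, a[).
by congr (measurable (_ `&` _)); apply/seteqP; split => x /=; rewrite in_itv.
Qed.

Lemma measurable_set_gt_norm f a : measurable_fun setT f -> measurable [set x | a < `|f x|].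
Proof. by move=> mf; apply: measurable_set_gt; apply: measurableT_comp. Qed.

End sublevel_sets.

(** * Weights without regularization and the weak Sobolev bound *)

Section smooth_bounds.
Context {R : realType} {N : nat}.
Local Notation V := 'rV[R]_N.
Local Notation e i := (delta_mx ord0 i : V).
Local Notation leb := (measure_function_SigmaFiniteMeasure__to__measure_function_Measure (lebesgue_rV R N)).
Implicit Types (x y : V) (p q eps : R).

Lemma enorm_ge0 x : 0 <= enorm x. Proof. exact: sqrtr_ge0. Qed.

Lemma wt0_enorm del x : wt 0 del x = del + enorm x ^+ 2.
Proof.
rewrite /wt /enorm sqr_sqrtr; last by apply: sumr_ge0 => i _; exact: sqr_ge0.
by congr (_ + _); apply: eq_bigr => i _; rewrite mxE subr0.
Qed.

Lemma measurable_enorm : measurable_fun setT (@enorm R N).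
Proof.
apply: continuous_measurable_rV.
rewrite (_ : @enorm R N = fun x : V => (wt 0 0 x) `^ 2^-1); last first.
  apply/funext => x; rewrite wt0_enorm add0r powR12_sqrt ?sqr_ge0//.
  by rewrite sqrtr_sqr ger0_norm// enorm_ge0.
rewrite (_ : (fun _ => _) = fun x : V => Num.sqrt (wt 0 0 x)); last first.
  by apply/funext => x; rewrite powR12_sqrt// wt0_enorm add0r sqr_ge0.
by apply: (@continuous_compf _ _ Num.sqrt); [exact: sqrt_continuous|exact: continuous_wt].
Qed.

Lemma measurable_enorm_powR (m : R) : measurable_fun setT (fun x : V => enorm x `^ m).
Proof. exact: (measurableT_comp (@measurable_powR R m) measurable_enorm). Qed.

(** Let [del] decrease to zero. At the origin [powR] gives the limiting weight the value [0], so
    restricting to [0 < enorm x] loses nothing; elsewhere the weights converge. *)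
Lemma int_weight_limit (F : V -> R) (m : R) (C : \bar R) : measurable_fun setT F ->
  (forall x, 0 <= F x) -> 0 < m ->
  (forall del : R, 0 < del -> (\int[leb]_x (F x * wt 0 del x `^ (- m))%:E <= C)%E) ->
  (\int[leb]_x (F x * enorm x `^ (- (2 * m)))%:E <= C)%E.
Proof.
move=> mF F0 m0 FC.
have mw (del : R) : measurable_fun setT (fun x : V => F x * wt 0 del x `^ (- m)).
  apply: measurable_funM => //.
  by apply: (measurableT_comp (@measurable_powR R (- m))); apply: continuous_measurable_rV; exact: continuous_wt.
have mZ : measurable_fun setT (fun x : V => (F x * wt 0 0 x `^ (- m)) * \1_[set x | 0 < enorm x] x).
  by apply: measurable_funM => //; apply: measurable_indic; apply: measurable_set_gt; exact: measurable_enorm.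
have mI : measurable [set x : V | 0 < enorm x] by apply: measurable_set_gt; exact: measurable_enorm.
apply: (@le_trans _ _ (\int[leb]_x ((F x * wt 0 0 x `^ (- m)) * \1_[set x | 0 < enorm x] x)%:E)%E).
  apply: le_int => //; first by apply: measurable_funM => //; exact: measurable_enorm_powR.
    by move=> x; rewrite mulr_ge0 ?powR_ge0.
  move=> x; rewrite wt0_enorm add0r indicE.
  have [x0|x0] := ltP 0 (enorm x).
    by rewrite mem_set// mulr1 -powR_mulrn ?enorm_ge0// -powRrM mulrN.
  rewrite memNset ?mulr0; last by rewrite /= ltNge x0.
  have -> : enorm x = 0 by apply/eqP; rewrite eq_le x0 enorm_ge0.
  by rewrite powR0 ?mulr0// oppr_eq0 mulf_neq0// gt_eqF.
apply: (@fatou_bound _ _ _ _ (fun n x => F x * wt 0 n.+1%:R^-1 x `^ (- m) * \1_[set x | 0 < enorm x] x)) => //.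
- by move=> n; apply: measurable_funM => //; exact: measurable_indic.
- by move=> n x; rewrite mulr_ge0// mulr_ge0 ?powR_ge0.
- by move=> x; rewrite mulr_ge0// mulr_ge0 ?powR_ge0.
- apply: aeW => x; have [x0|x0] := ltP 0 (enorm x); last first.
    have nx : \1_[set x : V | 0 < enorm x] x = 0 :> R by rewrite indicE memNset//= ltNge x0.
    by apply: cvg_near_cst; apply: nearW => n; rewrite nx !mulr0.
  apply: cvgM; last exact: cvg_cst.
  apply: cvgM; first exact: cvg_cst.
  have w0 : 0 < wt 0 0 x by rewrite wt0_enorm add0r exprn_gt0.
  apply: (@continuous_cvg _ _ _ _ _ _ (fun t : R => t `^ (- m))).
    apply: differentiable_continuous; apply/derivable1_diffP.
    by case: (is_derive_powR_gt0 (- m) w0).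
  rewrite /wt; apply: cvgD; last exact: cvg_cst.
  exact: cvg_harmonic.
move=> n; apply: le_trans (FC n.+1%:R^-1 _); last by rewrite invr_gt0.
apply: le_int => //; first by apply: measurable_funM => //; exact: measurable_indic.
  by move=> x; rewrite mulr_ge0// mulr_ge0 ?powR_ge0.
by move=> x; rewrite indicE; case: (_ \in _); rewrite ?mulr1 ?mulr0// mulr_ge0 ?powR_ge0.
Qed.

Lemma wt_shift_le eps x z : cube 0 eps z -> wt x (eps ^+ 2) (x + z) <= (N%:R + 1) * eps ^+ 2.
Proof.
move=> zc; rewrite /wt mulrDl mul1r addrC lerD//.
have -> : N%:R * eps ^+ 2 = \sum_(i < N) eps ^+ 2 by rewrite sumr_const card_ord mulr_natl.
apply: ler_sum => i _; rewrite mxE (addrC (x _ _)) addrK.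
have := zc i; rewrite mxE subr0 => h.
by rewrite -[z _ _ ^+ 2]ger0_norm ?sqr_ge0// normrX lerXn2r ?nnegrE// (le_trans _ h).
Qed.

(** Hardy's inequality centred at [x] itself with [del = eps^2]: on the support of the kernel the
    weight is at least [((N + 1) eps^2)^(-p/2)], so the weighted integral controls the kernel mean
    of [|v|^p]. *)
Lemma mol_sup psi v eps p x (M C : R) : loc_integrable v -> averaging psi eps -> 0 < eps ->
  (forall z, psi z <= M) -> 1 < p ->
  (forall del : R, 0 < del -> (\int[leb]_z (`|v z| `^ p * wt x del z `^ (- (p / 2)))%:E <= C%:E)%E) ->
  `|mol psi v x| `^ p <= M * (N%:R + 1) `^ (p / 2) * eps `^ p * C.
Proof.
move=> lv av e0 psiM p1 vC; have [cpsi psi0 psir psi1] := av.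
have mv : measurable_fun setT v by case: lv.
have M0 : 0 <= M by exact: le_trans (psi0 0) (psiM 0).
rewrite -lee_fin; have := mol_powR_le x 0 lv av p1; rewrite subr0 => /le_trans; apply.
pose K := M * (N%:R + 1) `^ (p / 2) * eps `^ p.
have K0 : 0 <= K by rewrite mulr_ge0 ?powR_ge0// mulr_ge0 ?powR_ge0.
have e20 : 0 < eps ^+ 2 by rewrite exprn_gt0.
pose G (z : V) := `|v z| `^ p * wt x (eps ^+ 2) z `^ (- (p / 2)).
have mG : measurable_fun setT G.
  apply: measurable_funM; first exact: measurable_powR_norm.
  by apply: (measurableT_comp (@measurable_powR R (- (p / 2)))); apply: continuous_measurable_rV; exact: continuous_wt.
have G0 z : 0 <= G z by rewrite mulr_ge0 ?powR_ge0.
have mGs : measurable_fun setT (fun z : V => G (z + x)) by exact: (measurableT_comp mG (measurable_rV_shift x)).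
have mvs : measurable_fun setT (fun z : V => v (x + z)).
  rewrite (_ : (fun _ => _) = fun z : V => v (z + x)); last by apply/funext => z; rewrite addrC.
  exact: (measurableT_comp mv (measurable_rV_shift x)).
apply: (@le_trans _ _ (\int[leb]_z (K * G ((z : V) + x))%:E)%E); last first.
  rewrite -/K (intZ leb mGs)// (EFinM K) lee_wpmul2l ?lee_fin//.
  rewrite (@ge0_integral_shift _ _ _ (EFin \o G)); last 2 first.
  - exact/measurable_EFinP.
  - by move=> z; rewrite /= lee_fin.
  exact: vC.
apply: le_int.
- apply: measurable_funM; last by apply: continuous_measurable_rV; exact: coord_algebra_continuous.
  by apply: measurable_powR_norm; apply: measurable_funB.
- exact: measurable_funM.
- by move=> z; rewrite mulr_ge0 ?powR_ge0.
move=> z; have [zc|zc] := pselect (cube 0 eps z); last by rewrite psir// mulr0 mulr_ge0.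
rewrite subr0 /G (addrC z); set a := `|_| `^ p.
have a0 : 0 <= a by exact: powR_ge0.
have w0 := wt_gt0 x (x + z) e20.
have wl := wt_shift_le x zc.
rewrite mulrCA ler_wpM2l// /K -!mulrA; apply: (le_trans (psiM z)).
rewrite ler_peMr// mulrA -(@powR_sqr _ eps p (ltW e0)) -powRM ?(ltW e20)//.
rewrite powRN ler_pdivlMr ?powR_gt0// mul1r ge0_ler_powR// ?nnegrE ?(ltW w0)//.
  by rewrite divr_ge0//; lra.
by rewrite mulr_ge0 ?(ltW e20)// addr_ge0.
Qed.

(* Approximate [v] by its mollification at the scale where the latter is at most [lam / 2]. *)
Lemma weak_type p (C0 C1 : R) : 1 < p -> p < N%:R -> 0 <= C0 -> 0 <= C1 ->
  exists2 K : R, 0 <= K & forall v, loc_integrable v ->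
  (forall y (del : R), 0 < del -> (\int[leb]_z (`|v z| `^ p * wt y del z `^ (- (p / 2)))%:E <= C0%:E)%E) ->
  (forall eps, 0 < eps ->
     (\int[leb]_x (`|mol (mollifier eps) v x - v x| `^ p)%:E <= (C1 * eps `^ p)%:E)%E) ->
  forall lam : R, 0 < lam -> (leb [set x | (lam < `|v x|)%R] <= (K * lam `^ (- sobolev1 N p))%:E)%E.
Proof.
move=> p1 pN C00 C10; have p0 : 0 < p by lra.
(* The summand [1] keeps [A] positive even if [C0 = 0], since the scale below is defined by dividing
   by it. *)
pose A : R := @mollifier_bound R N * (N%:R + 1) `^ (p / 2) * (C0 + 1).
have A0 : 0 < A.
  rewrite mulr_gt0 ?ltr_wpDl// mulr_gt0 ?mollifier_bound_gt0// powR_gt0// ltr_wpDl//.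
pose s := sobolev1 N p.
exists (C1 * A `^ (p / (N%:R - p)) * 2^-1 `^ (- s)).
  by rewrite mulr_ge0 ?powR_ge0// mulr_ge0 ?powR_ge0.
move=> v lv vC0 vC1 lam l0.
have l20 : 0 < lam / 2 by rewrite divr_gt0.
(* Solves [A * eps^(p - N) = (lam / 2)^p]: at this scale the bound of [mol_sup] does not exceed
   [(lam / 2)^p], so [|v| > lam] forces an approximation error of at least [lam / 2]. *)
pose eps := ((lam / 2) `^ p / A) `^ (p - N%:R)^-1.
have LA : 0 < (lam / 2) `^ p / A by rewrite divr_gt0// powR_gt0.
have e0 : 0 < eps by rewrite powR_gt0.
have eN : A * eps `^ (p - N%:R) = (lam / 2) `^ p.
  have pn : p - N%:R != 0 by rewrite subr_eq0 lt_eqF.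
  by rewrite /eps -powRrM (mulVf pn) (powRr1 (ltW LA)) mulrC divfK// gt_eqF.
have av := @averaging_mollifier R N _ e0.
have [_ _ psiM _ _] := @mollifierP R N _ e0.
have mv : measurable_fun setT v by case: lv.
have [cpsi _ psir _] := av.
have mm : measurable_fun setT (mol (mollifier eps) v).
  by apply: continuous_measurable_rV; exact: (continuous_mol lv cpsi psir).
have sup x : `|mol (mollifier eps) v x| <= lam / 2.
  rewrite leNgt; apply/negP => hx.
  have h1 := mol_sup lv av e0 psiM p1 (vC0 x).
  have : (lam / 2) `^ p < `|mol (mollifier eps) v x| `^ p.
    by apply: gt0_ltr_powR; rewrite // ?nnegrE ?ltW.
  apply/negP; rewrite -leNgt; apply: (le_trans h1).
  rewrite -eN powRD ?(gt_eqF e0) ?implybT// powRN powR_mulrn ?(ltW e0)//.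
  set a := (N%:R + 1) `^ _; set b := eps `^ p; set c := (eps ^+ N)^-1.
  have a0 : 0 <= a by exact: powR_ge0.
  have b0 : 0 <= b by exact: powR_ge0.
  have c0 : 0 <= c by rewrite invr_ge0 exprn_ge0// ltW.
  have M0 : 0 <= @mollifier_bound R N by rewrite ltW// mollifier_bound_gt0.
  have -> : @mollifier_bound R N * c * a * b * C0 = @mollifier_bound R N * a * b * c * C0 by ring.
  have -> : A * (b * c) = @mollifier_bound R N * a * b * c * (C0 + 1) by rewrite /A -/a; ring.
  by rewrite ler_wpM2l ?lerDl// !mulr_ge0.
have mset : measurable [set x | lam < `|v x|] by exact: measurable_set_gt_norm.
have mk := @markov_int _ _ _ leb (fun x => `|mol (mollifier eps) v x - v x| `^ p) ((lam / 2) `^ p)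
  _ mset (measurable_powR_norm p (measurable_funB mm mv)) (fun x => powR_ge0 _ _) (powR_ge0 _ _).
have {}mk : (((lam / 2) `^ p)%:E * leb [set x | (lam < `|v x|)%R] <= (C1 * eps `^ p)%:E)%E.
  apply: le_trans (vC1 _ e0); apply: mk => x /= lx.
  apply: ge0_ler_powR; rewrite ?nnegrE ?(ltW p0) ?(ltW l20)//.
  have := sup x; have := lerB_dist (v x) (mol (mollifier eps) v x); rewrite distrC; lra.
have -> : C1 * A `^ (p / (N%:R - p)) * 2^-1 `^ (- s) * lam `^ (- s) = C1 * eps `^ p / (lam / 2) `^ p.
  have np : N%:R - p != 0 by rewrite gt_eqF// subr_gt0.
  have pn : p - N%:R != 0 by rewrite -oppr_eq0 opprB.
  rewrite -[RHS]mulrA -[LHS]mulrA -powRM ?(ltW l0)// [2^-1 * lam]mulrC -mulrA; congr (_ * _).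
  have Ai : A^-1 = A `^ (-1) by rewrite powR_inv1// ltW.
  have -> : eps `^ p = (lam / 2) `^ (p * ((p - N%:R)^-1 * p)) * A `^ (-1 * ((p - N%:R)^-1 * p)).
    by rewrite /eps Ai -powRrM powRM ?powR_ge0// -!powRrM.
  clearbody A; rewrite [RHS]mulrAC -powRN -powRD ?(gt_eqF l20) ?implybT// [LHS]mulrC.
  congr (_ `^ _ * _ `^ _); first by rewrite /s /sobolev1; field; rewrite np pn.
  by field; rewrite np pn.
by rewrite mulrC EFinM lee_pdivlMl ?powR_gt0.
Qed.

(** The ratio [4] of consecutive scales leaves a factor [2^(-j)] after the weights [2^j] used in
    [riesz_fischer]. *)
Definition molj (j : nat) (u : V -> R) : V -> R := mol (mollifier (4 ^+ j)^-1) u.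

Lemma rate_gt0 (j : nat) : 0 < (4 ^+ j)^-1 :> R.
Proof. by rewrite invr_gt0 exprn_gt0. Qed.

Lemma cvg_rate : (fun j => (4 ^+ j)^-1 : R) @ \oo --> (0 : R).
Proof.
have := @cvg_geometric R 1 4^-1; rewrite ger0_norm// => /(_ _); rewrite invf_lt1// ltr1n => /(_ isT).
by apply: cvg_trans; apply: near_eq_cvg; apply: nearW => j; rewrite /geometric /= mul1r exprVn.
Qed.

Lemma cvg_molj (u : V -> R) x : continuous u -> (fun j => molj j u x) @ \oo --> u x.
Proof.
move=> cu; apply/cvgrPdist_le => e0 e00.
have lu := continuous_loc_integrable cu.
have /(@cvgrPdist_le _ _ _ (nbhs (x : V)) (nbhs_filter (x : V))) /(_ _ e00) /nbhs_ballP[d /= d0 bd] := cu x.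
have h : \forall t \near \oo, ((4 : R) ^+ t)^-1 < d by exact: (cvgr_lt (0:R) cvg_rate d d0).
apply: filterS h => j rj.
have av := @averaging_mollifier R N _ (rate_gt0 j).
have [cpsi psi0 psir psi1] := av.
(* The exponent [2] is arbitrary above [1]: Jensen turns smallness of [u (x + z) - u x] on the
   support of the kernel into smallness of the averaged error. *)
have := @mol_powR_le _ _ _ _ u x (u x) 2 lu av ltac:(by rewrite ltr1n).
have mpsi : measurable_fun setT (mollifier (N := N) (4 ^+ j)^-1 : V -> R).
  by apply: continuous_measurable_rV; exact: coord_algebra_continuous.
have mus : measurable_fun setT (fun z : V => u (x + z)).
  rewrite (_ : (fun _ => _) = fun z : V => u (z + x)); last by apply/funext => z; rewrite addrC.
  exact: (measurableT_comp (continuous_measurable_rV cu) (measurable_rV_shift x)).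
move=> h1; have : ((`|molj j u x - u x| `^ 2)%:E <= (e0 `^ 2)%:E)%E.
  apply: (le_trans h1); rewrite -[leRHS]mule1 -psi1 -intZ ?powR_ge0//.
  apply: le_int.
  - by apply: measurable_funM => //; apply: measurable_powR_norm; apply: measurable_funB.
  - exact: measurable_funM.
  - by move=> z; rewrite mulr_ge0 ?powR_ge0.
  move=> z; have [zc|/psir ->] := pselect (cube 0 (4 ^+ j)^-1 z); last by rewrite !mulr0.
  rewrite ler_wpM2r// ge0_ler_powR// ?nnegrE ?(ltW e00)// distrC; apply: bd.
  rewrite -ball_normE /= opprD addNKr normrN.
  apply: le_lt_trans rj; rewrite [leLHS]/Num.norm /= mx_normrE.
  apply: bigmax_le => [|[a b] _]; first by rewrite ltW// rate_gt0.
  by rewrite /= (ord1 a); have := zc b; rewrite mxE subr0.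
rewrite lee_fin distrC leNgt => hh; rewrite leNgt; apply: contraNN hh => hh.
by apply: gt0_ltr_powR; rewrite // ?nnegrE ltW.
Qed.

End smooth_bounds.

(** * Almost everywhere limits of rapidly Cauchy sequences *)

Section riesz_fischer.
Context {R : realType}.

Lemma continuous_powR_norm (p : R) : 0 < p -> continuous (fun t : R => `|t| `^ p).
Proof.
move=> p0 t; have [->|t0] := eqVneq t 0.
  rewrite /continuous_at normr0 powR0 ?gt_eqF//.
  apply/cvgrPdist_lt => e e0; near=> s.
  rewrite sub0r normrN ger0_norm ?powR_ge0//.
  have -> : e = (e `^ p^-1) `^ p by rewrite -powRrM mulVf ?gt_eqF// powRr1// ltW.
  apply: gt0_ltr_powR; rewrite // ?nnegrE ?powR_ge0//.
  near: s; have /cvgrPdist_lt := @cvg_id _ (nbhs (0 : R)).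
  move=> /(_ (e `^ p^-1)); rewrite powR_gt0// => /(_ isT).
  by apply: filterS => s; rewrite sub0r normrN.
apply: (@continuous_comp _ _ _ (fun t : R => `|t|) (fun s : R => s `^ p)).
  exact: norm_continuous.
apply: differentiable_continuous; apply/derivable1_diffP.
by case: (is_derive_powR_gt0 p (_ : 0 < `|t|)); rewrite ?normr_gt0.
Unshelve. all: by end_near. Qed.

Lemma cvg_powR_norm (f : nat -> R) (l p : R) : 0 < p -> f @ \oo --> l ->
  (fun n => `|f n| `^ p) @ \oo --> `|l| `^ p.
Proof. by move=> p0 fl; exact: (cvg_comp _ _ fl (@continuous_powR_norm p p0 l)). Qed.

Lemma cvg_of_geometric (u : nat -> R) (K : R) :
  (forall j, `|u j - u j.+1| <= K * (2 ^+ j)^-1) -> cvgn u.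
Proof.
move=> uK.
have K0 : 0 <= K by have := uK 0%N; rewrite expr0 invr1 mulr1; exact: le_trans.
have h : cvgn (series (telescope u)).
  apply: normed_cvg; apply: (@series_le_cvg _ _ (geometric K 2^-1)) => //.
  - by move=> n; rewrite /= normr_ge0.
  - by move=> n; rewrite /geometric /= mulr_ge0// exprn_ge0.
  - by move=> n; rewrite /geometric /= exprVn distrC.
  - by apply: is_cvg_geometric_series; rewrite ger0_norm// invf_lt1// ltr1n.
rewrite (_ : u = fun n => u 0%N + series (telescope u) n); last first.
  by apply/funext => n; exact: eq_sum_telescope.
by apply: is_cvgD => //; exact: is_cvg_cst.
Qed.

Context d (T : measurableType d) (mu : {measure set T -> \bar R}).

(* [sum_j 2^(jp) |f_j - f_(j+1)|^p] is integrable, hence finite almost everywhere. *)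
Lemma riesz_fischer (f_ : nat -> T -> R) (p C : R) : 0 < p -> 0 <= C ->
  (forall j, measurable_fun setT (f_ j)) ->
  (forall j k, (j <= k)%N ->
    (\int[mu]_x (`|f_ j x - f_ k x| `^ p)%:E <= (C * ((4 ^+ j)^-1) `^ p)%:E)%E) ->
  exists f : T -> R, [/\ measurable_fun setT f, {ae mu, forall x, (f_ ^~ x) @ \oo --> f x} &
    forall j, (\int[mu]_x (`|f_ j x - f x| `^ p)%:E <= (C * ((4 ^+ j)^-1) `^ p)%:E)%E].
Proof.
move=> p0 C0 mf fC.
pose D (j : nat) x := (2 ^+ j) `^ p * `|f_ j x - f_ j.+1 x| `^ p.
have mD j : measurable_fun setT (D j).
  by apply: measurable_funM => //; apply: measurable_powR_norm; exact: measurable_funB.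
have D0 j x : 0 <= D j x by rewrite mulr_ge0 ?powR_ge0.
pose G x := (\sum_(0 <= j <oo) (D j x)%:E)%E.
have mG : measurable_fun setT G.
  apply: ge0_emeasurable_sum => j; first by move=> x _ _; rewrite lee_fin.
  by move=> _; apply/measurable_EFinP.
have G0 x : (0 <= G x)%E by apply: nneseries_ge0 => j _ _; rewrite lee_fin.
(* Ratio of the dominating series, as [2^(jp) * 4^(-jp) = th^j]. *)
pose th : R := (2^-1) `^ p.
have th0 : 0 < th by rewrite powR_gt0.
have th1 : th < 1.
  have <- : (1 : R) `^ p = 1 by rewrite powR1.
  by apply: gt0_ltr_powR; rewrite // ?nnegrE ?invf_lt1 ?ltr1n.
have intD j : (\int[mu]_x (D j x)%:E <= (C * th ^+ j)%:E)%E.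
  rewrite (@intZ _ _ _ mu) ?powR_ge0//; last by apply: measurable_powR_norm; exact: measurable_funB.
  apply: (@le_trans _ _ (((2 ^+ j) `^ p)%:E * (C * ((4 ^+ j)^-1) `^ p)%:E)%E).
    by rewrite lee_wpmul2l ?lee_fin ?powR_ge0// fC.
  rewrite -EFinM lee_fin mulrCA ler_wpM2l// -powRM ?exprn_ge0// ?invr_ge0 ?exprn_ge0//.
  have -> : th ^+ j = ((2^-1) ^+ j) `^ p.
    by rewrite -powR_mulrn ?powR_ge0// /th -powRrM mulrC powRrM powR_mulrn.
  by rewrite -exprVn -exprMn (_ : 2 * 4^-1 = 2^-1 :> R)//; lra.
have intG : (\int[mu]_x G x <= (C / (1 - th))%:E)%E.
  rewrite integral_nneseries//; last 2 first.
  - by move=> j; exact/measurable_EFinP.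
  - by move=> j x _; rewrite lee_fin.
  apply: (@le_trans _ _ (\sum_(0 <= k <oo) (C * th ^+ k)%:E)%E).
    by apply: lee_nneseries => j _; first by rewrite integral_ge0// => x _; rewrite lee_fin.
  have := @cvg_geometric_series R C th.
  rewrite ger0_norm ?(ltW th0)// => /(_ th1) h.
  rewrite le_eqVlt; apply/orP; left; apply/eqP; apply: cvg_lim => //.
  apply/fine_cvgP; split; first by apply: nearW => n; rewrite sumEFin.
  by apply: cvg_trans h; apply: near_eq_cvg; apply: nearW => n; rewrite /= sumEFin.
have iG : mu.-integrable setT G.
  apply/integrableP; split => //; under eq_integral do rewrite gee0_abs//.
  exact: le_lt_trans intG (ltry _).
(* The upper limit is measurable as it stands, and it is the true limit wherever [G] is finite. *)
pose f x := fine (limn_esup (fun n => (f_ n x)%:E)).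
have mf' : measurable_fun setT f.
  apply: (measurableT_comp (@fine_measurable R setT measurableT)).
  by apply: measurable_fun_limn_esup => n; exact/measurable_EFinP.
have cf : {ae mu, forall x, (f_ ^~ x) @ \oo --> f x}.
  apply: filterS (integrable_ae measurableT iG) => x /(_ I) Gx.
  have DG j : D j x <= fine (G x).
    rewrite -lee_fin fineK// /G (nneseries_split_cond 0 j.+1) ?add0n; last first.
      by move=> i _; rewrite lee_fin.
    rewrite big_nat_recr//= -[leLHS]adde0 leeD//; last first.
      by apply: nneseries_ge0 => i _ _; rewrite lee_fin.
    by rewrite leeDr// sume_ge0// => i _; rewrite lee_fin.
  have Gx0 : 0 <= fine (G x) by exact: fine_ge0.
  have cu : cvgn (f_ ^~ x).
    apply: (@cvg_of_geometric _ (fine (G x) `^ p^-1)) => j.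
    have e2 : 0 < 2 ^+ j :> R by rewrite exprn_gt0.
    rewrite ler_pdivlMr// mulrC.
    have -> : 2 ^+ j * `|f_ j x - f_ j.+1 x| = (D j x) `^ p^-1.
      rewrite /D -powRM ?(ltW e2)// -powRrM divff ?gt_eqF// powRr1// mulr_ge0// ltW//.
    by apply: ge0_ler_powR; rewrite ?nnegrE ?invr_ge0 ?(ltW p0) ?D0.
  have cE : (fun n => (f_ n x)%:E) @ \oo --> (limn (f_ ^~ x))%:E.
    by apply/fine_cvgP; split; first exact: nearW.
  by rewrite /f (cvg_limn_einf_sup cE).2.
exists f; split => // j.
apply: (@fatou_bound _ _ _ mu (fun k x => `|f_ j x - f_ (k + j)%N x| `^ p)) => //.
- by move=> k; apply: measurable_powR_norm; exact: measurable_funB.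
- by apply: measurable_powR_norm; exact: measurable_funB.
- apply: filterS cf => x fx; apply: cvg_powR_norm => //.
  by apply: cvgB; [exact: cvg_cst|exact: (cvg_comp _ _ (cvg_addnr j) fx)].
- by move=> k; apply: fC; exact: leq_addl.
Qed.

End riesz_fischer.

(** * Functions orthogonal to all bumps vanish *)

Section du_bois_reymond.
Context {R : realType} {N : nat}.
Local Notation V := 'rV[R]_N.
Local Notation leb := (measure_function_SigmaFiniteMeasure__to__measure_function_Measure (lebesgue_rV R N)).
Implicit Types (a b : V) (w : V -> R).

Definition obox a b : set V := [set x | forall i, a ord0 i < x ord0 i < b ord0 i].

Lemma measurable_obox a b : measurable (obox a b).
Proof.
apply: (@measurable_rV_forall R N (fun i => `]a ord0 i, b ord0 i[%classic)) => i.
exact: measurable_itv.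
Qed.

Lemma oboxI a b c e : obox a b `&` obox c e =
  obox (\row_i Num.max (a ord0 i) (c ord0 i)) (\row_i Num.min (b ord0 i) (e ord0 i)).
Proof.
apply/seteqP; split => x /=.
  by move=> [h1 h2] i; rewrite !mxE gt_max lt_min; have /andP[-> ->] := h1 i; have /andP[-> ->] := h2 i.
by move=> h; split => i; have := h i; rewrite !mxE gt_max lt_min => /andP[/andP[h1 h2] /andP[h3 h4]]; apply/andP.
Qed.

Lemma cvg_bump a b x : (fun n => bump n.+1%:R a b x) @ \oo --> (\1_(obox a b) x : R).
Proof.
rewrite indicE; have [xb|xb] := pselect (obox a b x); last first.
  rewrite memNset//; apply: cvg_near_cst; apply: nearW => n; apply: bump_eq0 => //.
  by apply: contrapT => h; apply: xb => i; apply: contrapT => /negP hi; apply: h; exists i.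
have fl (s : R) : 0 < s -> (fun n => flat 1 (n.+1%:R * s)) @ \oo --> (1 : R).
  move=> s0; rewrite (_ : (fun _ => _) = (fun n => expR (- (n.+1%:R^-1 * s^-1)))); last first.
    by apply/funext => n; rewrite /flat mulr_gt0// hornerC mul1r invfM.
  rewrite -[X in _ --> X]expR0; apply: continuous_cvg; first exact: continuous_expR.
  rewrite -oppr0; apply: cvgN; rewrite -[X in _ --> X](mul0r s^-1).
  by apply: cvgM; [exact: cvg_harmonic|exact: cvg_cst].
have mul1 (f g : nat -> R) : f @ \oo --> (1 : R) -> g @ \oo --> (1 : R) ->
    (fun n => f n * g n) @ \oo --> (1 : R).
  by move=> hf hg; rewrite -[X in _ --> X](mulr1 (1 : R)); apply: cvgM.
rewrite mem_set//=.
have gen (s : seq 'I_N) : (fun n => \prod_(i <- s) (flat 1 (n.+1%:R * (x ord0 i - a ord0 i)) *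
    flat 1 (n.+1%:R * (b ord0 i - x ord0 i)))) @ \oo --> (1 : R).
  elim: s => [|i s IH].
    by apply: cvg_near_cst; apply: nearW => n; rewrite big_nil.
  rewrite (_ : (fun _ => _) = fun n => flat 1 (n.+1%:R * (x ord0 i - a ord0 i)) *
     flat 1 (n.+1%:R * (b ord0 i - x ord0 i)) *
     \prod_(j <- s) (flat 1 (n.+1%:R * (x ord0 j - a ord0 j)) * flat 1 (n.+1%:R * (b ord0 j - x ord0 j)))).
    have /andP[h1 h2] := xb i.
    by apply: (mul1) => //; apply: (mul1); apply: fl; rewrite subr_gt0.
  by apply/funext => n; rewrite big_cons.
exact: gen.
Qed.

Lemma obox_bounded a b : exists2 r : R, 0 < r & obox a b `<=` cube 0 r.
Proof.
  exists (\sum_i (`|a ord0 i| + `|b ord0 i|) + 1).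
    by rewrite ltr_wpDl// sumr_ge0// => i _; rewrite addr_ge0.
  move=> x xab i; rewrite mxE subr0; have /andP[h1 h2] := xab i.
  apply: (@le_trans _ _ (`|a ord0 i| + `|b ord0 i|)).
    rewrite ler_norml; have := ler_norm (b ord0 i); have := ler_norm (- a ord0 i).
    rewrite normrN; have := normr_ge0 (a ord0 i); have := normr_ge0 (b ord0 i).
    move=> *; apply/andP; split; lra.
  rewrite (bigD1 i)//= -addrA lerDl addr_ge0// sumr_ge0// => j _; exact: addr_ge0.
Qed.

(** Open boxes, empty ones included, are stable under intersection, so they are a generating family
    suitable for Dynkin induction. *)
Lemma measurable_rV_oboxes :
  measurable = <<s [set B : set V | exists a b, B = obox a b] >> :> set (set V).
Proof.
apply/seteqP; split; last first.
  by apply: smallest_sub; [exact: sigma_algebra_measurable|move=> _ [a [b ->]]; exact: measurable_obox].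
apply: smallest_sub; first exact: smallest_sigma_algebra.
set G := <<s _ >>.
pose W := g_sigma_algebraType [set B : set V | exists a b, B = obox a b].
have mc i : measurable_fun [set: W] (fun v : W => (v : V) ord0 i).
  apply: (measurability (@RGenOInfty.G R)); first exact: RGenOInfty.measurableE.
  move=> _ [_ [r ->] <-]; rewrite setTI.
  (* A half-space is exhausted by boxes whose [i]-th lower bound is [r] while all other bounds
     recede. *)
  rewrite (_ : _ @^-1` _ = \bigcup_n obox (\row_j (if j == i then r else - n%:R)) (const_mx n%:R)).
    by apply: bigcup_measurable => n _; apply: sub_sigma_algebra; exists (\row_j (if j == i then r else - n%:R)), (const_mx n%:R).
  apply/seteqP; split => v /=; rewrite in_itv/= andbT.
    move=> rv; exists (Num.truncn (\sum_j `|v ord0 j|)).+1 => // j; rewrite !mxE.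
    have vj : `|v ord0 j| < (Num.truncn (\sum_j `|v ord0 j|)).+1%:R.
      apply: le_lt_trans (truncnS_gt _); rewrite (bigD1 j)//= lerDl.
      exact: sumr_ge0.
    move: vj; rewrite ltr_norml => /andP[v1 v2]; rewrite v2 andbT.
    by case: eqP => [->|].
  by move=> [n _ /(_ i)]; rewrite !mxE eqxx => /andP[].
move=> A; elim/big_ind : _ => [//|P Q IP IQ [/IP//|/IQ//]|i _ [B mB <-]].
by have := mc i measurableT B mB.
Qed.

(** The bumps converge to the indicators of open boxes. The sets over which [w], cut to [K n], has
    integral zero satisfy the Dynkin conditions and contain the boxes, hence are all measurable
    sets. *)
Lemma du_bois_reymond w : loc_integrable w ->
  (forall n a b, (\int[leb]_x (w x * bump n.+1%:R a b x)%:E = 0)%E) ->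
  {ae leb, forall x, w x = 0}.
Proof.
move=> lw w0; have mw : measurable_fun setT w by case: lw.
have ib a b : leb.-integrable setT (fun x => (w x * \1_(obox a b) x)%:E).
  have [r _ abr] := obox_bounded a b.
  apply: (@loc_integrable_mul _ _ w _ 0 r 1) => //.
  - by apply: measurable_indic; exact: measurable_obox.
  - by move=> y; rewrite ger0_norm// indicE; case: (_ \in _).
  - by move=> y yr; rewrite indicE memNset// => /abr.
have b0 a b : (\int[leb]_x (w x * \1_(obox a b) x)%:E = 0)%E.
  have h := @dominated_cvg _ _ _ leb setT measurableT (fun n x => (w x * bump n.+1%:R a b x)%:E)
    (fun x => (w x * \1_(obox a b) x)%:E) (fun x => `|(w x * \1_(obox a b) x)%:E|%E).
  have {}h : ((fun n => \int[leb]_x (w x * bump n.+1%:R a b x)%:E) @ \oo -->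
      \int[leb]_x (w x * \1_(obox a b) x)%:E)%E.
    apply: h => //.
    - by move=> n; apply/measurable_EFinP; apply: measurable_funM => //; exact: measurable_bump.
    - move=> x _; apply/fine_cvgP; split; first exact: nearW.
      by apply: cvgM; [exact: cvg_cst|exact: cvg_bump].
    - exact: integrable_abse.
    - move=> n x _ /=; rewrite lee_fin !normrM indicE.
      have [xb|xb] := pselect (obox a b x).
        by rewrite mem_set// normr1 ler_wpM2l// ger0_norm ?bump_ge0 ?bump_le1.
      rewrite bump_eq0 ?normr0 ?mulr0 ?mulr_ge0//.
      by apply: contrapT => h'; apply: xb => i; apply: contrapT => /negP hi; apply: h'; exists i.
  apply: cvg_unique h _; first exact: ereal_hausdorff.
  by apply: cvg_near_cst; apply: nearW => n; exact: w0.
(* [w] is only locally integrable, so it is cut to an exhausting sequence of boxes. *)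
pose K (n : nat) := obox (const_mx (- n%:R)) (const_mx n%:R).
have wK n : {ae leb, forall x, w x * \1_(K n) x = 0}.
  have iK := ib (const_mx (- n%:R)) (const_mx n%:R).
  have : ae_eq leb setT (fun x => (w x * \1_(K n) x)%:E) (cst 0%E).
    apply: (integral_ae_eq measurableT iK) => // A _ mA.
    rewrite integral0; move: mA; rewrite [X in X A]measurable_rV_oboxes.
    have iKA (B : set V) : measurable B -> leb.-integrable B (fun x => (w x * \1_(K n) x)%:E).
      by move=> mB; exact: integrableS iK.
    apply: (@dynkin_induction _ _ _
      (fun A => \int[leb]_(x in A) (w x * \1_(K n) x)%:E = 0)%E measurable_rV_oboxes).
    - move=> _ _ [a [b ->]] [c [e ->]]; rewrite oboxI; by do 2 eexists.
    - exact: b0.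
    - move=> _ [a [b ->]]; rewrite integral_mkcond.
      rewrite (eq_integral (fun x => (w x * \1_(obox a b `&` K n) x)%:E)); first by rewrite oboxI b0.
      move=> x _; rewrite patchE indicI /=; case: ifPn => xb.
        by rewrite [\1_(obox a b) x]indicE xb mul1r.
      by rewrite [\1_(obox a b) x]indicE (negbTE xb) mul0r mulr0.
    - move=> S mS S0.
      have := @integral_setU_EFin _ _ _ leb S (~` S) (fun x => w x * \1_(K n) x) mS (measurableC mS).
      rewrite setUv S0 add0e => <-; first exact: b0.
        by apply/measurable_EFinP; case/integrableP: iK.
      by rewrite disj_set2E setICr.
    - move=> F mF tF F0.
      rewrite (integral_bigcup tF mF (iKA _ (bigcup_measurable (fun k _ => mF k)))).
      by apply: eseries0 => k _ _; exact: F0.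
  by apply: filterS => x /(_ I)[].
have : {ae leb, forall x, forall n, w x * \1_(K n) x = 0} by apply: ae_foralln.
apply: filterS => x wx.
have := wx (Num.truncn (\sum_j `|x ord0 j|)).+1.
rewrite indicE mem_set ?mulr1// => j; rewrite !mxE -ltr_norml.
apply: le_lt_trans (truncnS_gt _); rewrite (bigD1 j)//= lerDl.
exact: sumr_ge0.
Qed.

End du_bois_reymond.

(** * Uniform bounds for the mollifications of a function in [W] *)

Section energy_bounds.
Context {R : realType} {N : nat}.
Local Notation V := 'rV[R]_N.
Local Notation e i := (delta_mx ord0 i : V).
Local Notation leb := (measure_function_SigmaFiniteMeasure__to__measure_function_Measure (lebesgue_rV R N)).
Variables (p q : R).
Hypotheses (p1 : 1 < p) (pN : p < N%:R) (q1 : 1 < q) (qN : 2 * q < N%:R).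
Local Notation ps := (sobolev1 N p).
Implicit Types (u v f : V -> R) (g h : 'I_N -> V -> R) (M : R).

Let p0 : 0 < p. Proof. exact: lt_trans ltr01 p1. Qed.
Let q0 : 0 < q. Proof. exact: lt_trans ltr01 q1. Qed.

Lemma sobolev1_gt1 : 1 < ps.
Proof.
rewrite /sobolev1 ltr_pdivlMr ?subr_gt0// mul1r.
have N0 : 0 < N%:R :> R by exact: lt_trans pN.
have h1 : 0 < (p - 1) * N%:R by rewrite mulr_gt0// subr_gt0.
by move: h1 p0; lra.
Qed.

Lemma sobolev2_gt1 : 1 < sobolev2 N q.
Proof.
rewrite /sobolev2 ltr_pdivlMr ?subr_gt0// mul1r.
have N0 : 0 < N%:R :> R by apply: lt_trans qN; rewrite mulr_gt0.
have h1 : 0 < (q - 1) * N%:R by rewrite mulr_gt0// subr_gt0.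
by move: h1 q0; lra.
Qed.

(** What the estimates retain from membership in [W]. Only diagonal second derivatives occur; [M]
    and [M2] are the quantitative bounds, while the two critical powers are merely integrable, which
    is what [absorb] asks for. *)
Definition energy (M M2 : R) u g h := loc_integrable u /\
  [/\ forall i, is_weak_partials [:: i] u (g i), forall i, is_weak_partials [:: i; i] u (h i),
   (\int[leb]_x (`|u x| `^ ps)%:E < +oo)%E, (\int[leb]_x (`|u x| `^ (sobolev2 N q))%:E < +oo)%E
   & (\sum_i \int[leb]_x (`|g i x| `^ p)%:E <= M%:E)%E /\
     (\int[leb]_x (`|\sum_i h i x| `^ q)%:E <= M2%:E)%E].

(** The Hardy, Rellich and weak Sobolev bounds shared by all mollifications of a bounded family.
    They are the input of [tails]. *)
Definition tame (C : R) v := [/\ continuous v,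
  (\int[leb]_x (`|v x| `^ p * enorm x `^ (- p))%:E <= C%:E)%E,
  (\int[leb]_x (`|v x| `^ q * enorm x `^ (- (2 * q)))%:E <= C%:E)%E &
  forall lam : R, 0 < lam -> (leb [set x | (lam < `|v x|)%R] <= (C * lam `^ (- ps))%:E)%E].

Let av j : averaging (mollifier (4 ^+ j)^-1 : V -> R) (4 ^+ j)^-1.
Proof. by apply: averaging_mollifier; exact: rate_gt0. Qed.

Lemma loc_integrable_sum (s : seq 'I_N) h : (forall i, loc_integrable (h i)) ->
  loc_integrable (fun x => \sum_(i <- s) h i x).
Proof.
move=> lh; elim: s => [|i s [m1 m2]].
  rewrite (_ : (fun _ => _) = cst 0); last by apply/funext => x; rewrite big_nil.
  by apply: continuous_loc_integrable; exact: cst_continuous.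
rewrite (_ : (fun _ => _) = fun x => h i x + \sum_(j <- s) h j x); last first.
  by apply/funext => x; rewrite big_cons.
have [n1 n2] := lh i; split; first exact: measurable_funD.
move=> K cK; have mK := compact_measurable_rV cK.
by have := integrableD mK (n2 K cK) (m2 K cK); apply: eq_integrable.
Qed.

(** Makes the Laplacian of a mollification the mollification of the Laplacian, so that the
    contraction estimate applies to the sum and not to each second derivative. *)
Lemma molj_sum j (s : seq 'I_N) h x : (forall i, loc_integrable (h i)) ->
  molj j (fun x => \sum_(i <- s) h i x) x = \sum_(i <- s) molj j (h i) x.
Proof.
move=> lh; have [cpsi _ psir _] := av j.
elim: s => [|i s IH].
  rewrite big_nil /molj /mol; under eq_Rintegral do rewrite big_nil mul0r.
  by rewrite Rintegral_cst// mul0r.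
rewrite big_cons -IH /molj /mol -RintegralD//.
- by apply: eq_Rintegral => y _; rewrite big_cons mulrDl.
- exact: mol_integrable (lh i) cpsi psir.
- exact: mol_integrable (loc_integrable_sum s lh) cpsi psir.
Qed.

Section one_function.
Variables (M M2 : R) (u : V -> R) (g h : 'I_N -> V -> R).
Hypothesis (En : energy M M2 u g h).

Let lu : loc_integrable u. Proof. by case: En. Qed.

Let lg i : loc_integrable (g i). Proof. by case: En => _ [/(_ i)[]]. Qed.

Let lh i : loc_integrable (h i). Proof. by case: En => _ [_ /(_ i)[]]. Qed.

Lemma continuous_molj j f : loc_integrable f -> continuous (molj j f).
Proof. by move=> lf; have [cpsi _ psir _] := av j; exact: continuous_mol lf cpsi psir. Qed.

Let cu j : continuous (molj j u). Proof. exact: continuous_molj. Qed.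

Lemma is_derive_molj j i x : is_derive x (e i) (molj j u) (molj j (g i) x).
Proof.
by have [cpsi _ psir _] := av j; case: En => _ [wg _ _ _ _]; exact: weak_partial_mol (wg i) cpsi psir.
Qed.

Let dg j i x : is_derive x (e i) (molj j (g i)) (molj j (h i) x).
Proof.
have [cpsi _ psir _] := av j; case: En => _ [wg wh _ _ _].
exact: weak_second_partial_mol (wg i) (wh i) cpsi psir.
Qed.

Let sum_g j : (\sum_i \int[leb]_x (`|molj j (g i) x| `^ p)%:E <= M%:E)%E.
Proof.
case: En => _ [_ _ _ _ [gM _]]; apply: le_trans gM.
by apply: lee_sum => i _; exact: int_mol_powR (lg i) (av j) p1.
Qed.

Let fin1 j : (\int[leb]_x (`|molj j u x| `^ ps)%:E < +oo)%E.
Proof.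
by case: En => _ [_ _ uoo _ _]; exact: le_lt_trans (int_mol_powR lu (av j) sobolev1_gt1) uoo.
Qed.

Let fin2 j : (\int[leb]_x (`|molj j u x| `^ (sobolev2 N q))%:E < +oo)%E.
Proof.
by case: En => _ [_ _ _ uoo _]; exact: le_lt_trans (int_mol_powR lu (av j) sobolev2_gt1) uoo.
Qed.

Let hc0 : 0 <= hardy_const (N := N) p.
Proof. by rewrite /hardy_const divr_ge0 ?mulr_ge0 ?powR_ge0 ?subr_ge0 ?(ltW p0) ?(ltW pN)// divr_ge0// subr_ge0 ltW. Qed.

Let rc0 : 0 <= rellich_const (N := N) q.
Proof. by rewrite /rellich_const divr_ge0// mulr_ge0 ?powR_ge0 ?subr_ge0 ?(ltW q0) ?(ltW q1) ?(ltW qN). Qed.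

Lemma molj_hardy j y (del : R) : 0 < del ->
  (\int[leb]_z (`|molj j u z| `^ p * wt y del z `^ (- (p / 2)))%:E <= (hardy_const (N := N) p * M)%:E)%E.
Proof.
move=> d0; have hh := @hardy_ineq R N (molj j u) (fun i => molj j (g i)) y del d0 (@cu j)
  (fun i => @continuous_molj j _ (lg i)) (is_derive_molj j) p p1 pN (fin1 j).
apply: (le_trans hh).
by rewrite (EFinM _ M) lee_wpmul2l// lee_fin.
Qed.

Lemma molj_rellich j y (del : R) : 0 < del ->
  (\int[leb]_z (`|molj j u z| `^ q * wt y del z `^ (- q))%:E <= (rellich_const (N := N) q * M2)%:E)%E.
Proof.
move=> d0; have hh := @rellich_ineq R N (molj j u) (fun i => molj j (g i)) y del d0 (@cu j)
  (fun i => @continuous_molj j _ (lg i)) (is_derive_molj j) (fun i => molj j (h i)) q q1 qN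
  (fun i => @continuous_molj j _ (lh i)) (dg j) (fin2 j).
apply: (le_trans hh).
rewrite (EFinM _ M2) lee_wpmul2l ?lee_fin//.
case: En => _ [_ _ _ _ [_ hM]]; apply: le_trans hM.
under eq_integral do rewrite -molj_sum//.
exact: int_mol_powR (loc_integrable_sum _ lh) (av j) q1.
Qed.

Lemma molj_hardy0 j : (\int[leb]_x (`|molj j u x| `^ p * enorm x `^ (- p))%:E <=
  (hardy_const (N := N) p * M)%:E)%E.
Proof.
have := @int_weight_limit R N (fun x => `|molj j u x| `^ p) (p / 2) (hardy_const (N := N) p * M)%:E
  (measurable_powR_norm p (continuous_measurable_rV (@cu j))) (fun x => powR_ge0 _ _)
  (divr_gt0 p0 (ltr0Sn _ 1)) (molj_hardy j 0).
by rewrite (_ : 2 * (p / 2) = p)// mulrC divfK.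
Qed.

Lemma molj_rellich0 j : (\int[leb]_x (`|molj j u x| `^ q * enorm x `^ (- (2 * q)))%:E <=
  (rellich_const (N := N) q * M2)%:E)%E.
Proof.
exact: (@int_weight_limit R N (fun x => `|molj j u x| `^ q) q (rellich_const (N := N) q * M2)%:E
  (measurable_powR_norm q (continuous_measurable_rV (@cu j))) (fun x => powR_ge0 _ _) q0 (molj_rellich j 0)).
Qed.

Definition incr_const : R := (2 `^ p) ^+ N.

Lemma molj_increment j (eps : R) : 0 < eps ->
  (\int[leb]_x (`|mol (mollifier eps) (molj j u) x - molj j u x| `^ p)%:E <=
   (incr_const * M * eps `^ p)%:E)%E.
Proof.
move=> e0; have hh := @int_mol_increment R N (mollifier eps) (molj j u) (fun i => molj j (g i)) p eps p1
  (averaging_mollifier e0) (is_derive_molj j) (@cu j) (fun i => @continuous_molj j _ (lg i)).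
apply: (le_trans hh).
apply: (@le_trans _ _ ((incr_const * eps `^ p)%:E * M%:E)%E).
  by apply: lee_wpmul2l => //; rewrite lee_fin mulr_ge0 ?powR_ge0// exprn_ge0// powR_ge0.
by rewrite -EFinM lee_fin mulrAC.
Qed.

Let comm j k x : molj j (molj k u) x = molj k (molj j u) x.
Proof.
have [c1 _ r1 _] := av j; have [c2 _ r2 _] := av k.
exact: mol_comm lu (ltW (rate_gt0 j)) c1 r1 c2 r2.
Qed.

(** [mol_sup] requires Hardy's inequality for the function being mollified, known at this point for
    [molj k u] only. Commuting the two mollifications and letting [k] grow transfers the bound to
    [molj j u]. *)
Lemma molj_sup j x : `|molj j u x| `^ p <=
  mollifier_bound (R := R) (N := N) * (((4 ^+ j)^-1) ^+ N)^-1 * (N%:R + 1) `^ (p / 2) * ((4 ^+ j)^-1) `^ p *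
  (hardy_const (N := N) p * M).
Proof.
have [_ _ psiM _ _] := @mollifierP R N _ (rate_gt0 j).
have hk k : `|molj j (molj k u) x| `^ p <= mollifier_bound (R := R) (N := N) * (((4 ^+ j)^-1) ^+ N)^-1 *
    (N%:R + 1) `^ (p / 2) * ((4 ^+ j)^-1) `^ p * (hardy_const (N := N) p * M).
  exact: (mol_sup (continuous_loc_integrable (@cu k)) (av j) (rate_gt0 j) psiM p1 (molj_hardy k x)).
have h1 : (fun k => `|molj j (molj k u) x| `^ p) @ \oo --> `|molj j u x| `^ p.
  apply: cvg_powR_norm => //; rewrite (_ : (fun _ => _) = fun k => molj k (molj j u) x).
    by apply: cvg_molj; exact: cu.
  by apply/funext => k; exact: comm.
rewrite -(cvg_lim (@Rhausdorff R) h1); apply: limr_le; last by apply: nearW => k; exact: hk.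
by apply/cvg_ex; eexists; exact: h1.
Qed.

(** Jensen, with the kernel replaced by its maximum. This supplies a Lipschitz constant at scale [j]
    that is common to a bounded family. *)
Lemma molj_partial_sup j i x : `|molj j (g i) x| `^ p <=
  mollifier_bound (R := R) (N := N) * (((4 ^+ j)^-1) ^+ N)^-1 * M.
Proof.
have [_ psi0 psiM _ _] := @mollifierP R N _ (rate_gt0 j).
rewrite -lee_fin; have := mol_powR_le x 0 (lg i) (av j) p1; rewrite subr0 => /le_trans; apply.
have mg : measurable_fun setT (g i) by case: (lg i).
have mgp := measurable_powR_norm p mg.
set B := mollifier_bound * _.
have B0 : 0 <= B by exact: le_trans (psi0 0) (psiM 0).
have mgs : measurable_fun setT (fun z : V => `|g i (z + x)| `^ p).
  exact: (measurableT_comp mgp (measurable_rV_shift x)).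
have [cpsi _ _ _] := av j.
apply: (@le_trans _ _ (\int[leb]_z (B * `|g i ((z : V) + x)| `^ p)%:E)%E).
  apply: le_int.
  - apply: measurable_funM; last by apply: continuous_measurable_rV; exact: coord_algebra_continuous.
    rewrite (_ : (fun _ => _) = fun z : V => `|g i (z + x)| `^ p)//.
    by apply/funext => z; rewrite subr0 addrC.
  - exact: measurable_funM.
  - by move=> z; rewrite mulr_ge0 ?powR_ge0.
  - by move=> z; rewrite subr0 (addrC x) mulrC ler_wpM2r ?powR_ge0.
rewrite (intZ leb mgs)//.
rewrite (EFinM _ M) lee_wpmul2l ?lee_fin//.
rewrite (@ge0_integral_shift _ _ _ (fun x => (`|g i x| `^ p)%:E)); last 2 first.
- exact/measurable_EFinP.
- by move=> z; rewrite lee_fin powR_ge0.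
case: En => _ [_ _ _ _ [gM _]]; apply: le_trans gM.
rewrite (bigD1 i)//= leeDl// sume_ge0// => k _; apply: integral_ge0 => z _.
by rewrite lee_fin powR_ge0.
Qed.

Definition approx_const : R := 2 `^ p * (2 * incr_const).

(** Both functions are close to the double mollification at scales [j] and [k], which by commutation
    is the same seen from either side. *)
Lemma molj_cauchy j k : 0 <= M -> (j <= k)%N ->
  (\int[leb]_x (`|molj j u x - molj k u x| `^ p)%:E <= (approx_const * M * ((4 ^+ j)^-1) `^ p)%:E)%E.
Proof.
move=> M0 jk.
have ic0 : 0 <= incr_const by rewrite exprn_ge0// powR_ge0.
have m1 := continuous_measurable_rV (@cu j).
have m2 := continuous_measurable_rV (@cu k).
have m3 := continuous_measurable_rV (@continuous_molj k _ (continuous_loc_integrable (@cu j))).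
pose F1 x := `|molj k (molj j u) x - molj j u x| `^ p.
pose F2 x := `|molj j (molj k u) x - molj k u x| `^ p.
have mF1 : measurable_fun setT F1 by exact: (measurable_powR_norm p (measurable_funB m3 m1)).
have mF2 : measurable_fun setT F2.
  have m4 := continuous_measurable_rV (@continuous_molj j _ (continuous_loc_integrable (@cu k))).
  exact: (measurable_powR_norm p (measurable_funB m4 m2)).
have mS : measurable_fun setT (fun x => F1 x + F2 x) := measurable_funD mF1 mF2.
have F10 x : 0 <= F1 x by exact: powR_ge0.
have F20 x : 0 <= F2 x by exact: powR_ge0.
apply: (@le_trans _ _ (\int[leb]_x (2 `^ p * (F1 x + F2 x))%:E)%E).
  apply: le_int.
  - exact: (measurable_powR_norm p (measurable_funB m1 m2)).
  - exact: (measurable_funM (measurable_cst _) mS).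
  - by move=> x; exact: powR_ge0.
  move=> x; rewrite /F1 /F2 (comm j k).
  move: (molj k (molj j u) x) (molj j u x) (molj k u x) => a b c.
  have := @powR_add_le R p (- (a - b)) (a - c) (ltW p0).
  by rewrite normrN (_ : - (a - b) + (a - c) = b - c)//; ring.
rewrite (intZ leb mS (fun x => addr_ge0 (F10 x) (F20 x)) (powR_ge0 _ _)).
rewrite (intD leb mF1 mF2 F10 F20).
have h1 : (\int[leb]_x (F1 x)%:E <= (incr_const * M * ((4 ^+ j)^-1) `^ p)%:E)%E.
  apply: (le_trans (molj_increment j (rate_gt0 k))); rewrite lee_fin ler_wpM2l ?mulr_ge0//.
  apply: ge0_ler_powR; rewrite ?nnegrE ?(ltW p0) ?(ltW (rate_gt0 _))//.
  by rewrite lef_pV2 ?posrE ?exprn_gt0// ler_weXn2l// ler1n.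
have h2 := molj_increment k (rate_gt0 j).
apply: (le_trans (lee_wpmul2l _ (leeD h1 h2))); first by rewrite lee_fin powR_ge0.
by rewrite -EFinD -EFinM lee_fin /approx_const le_eqVlt; apply/orP; left; apply/eqP; ring.
Qed.

(** Trades a small constant against a large multiple of [|a|^p]. On a bounded set it turns smallness
    of the [p]-th power integral into smallness of the integral of [|a|]. *)
Lemma abs_split (k a : R) : 0 < k -> `|a| <= k + k `^ (1 - p) * `|a| `^ p.
Proof.
move=> k0; have [ak|ka] := leP `|a| k.
  by rewrite (le_trans ak)// lerDl mulr_ge0 ?powR_ge0.
rewrite -[leLHS]add0r lerD ?(ltW k0)//.
have a0 : 0 < `|a| by exact: lt_trans ka.
have e1 : `|a| = `|a| `^ (1 - p) * `|a| `^ p.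
  by rewrite -powRD ?(gt_eqF a0) ?implybT// subrK powRr1.
rewrite {1}e1 ler_wpM2r ?powR_ge0// -[1 - p]opprK !(powRN _ (- (1 - p))).
rewrite lef_pV2 ?posrE ?powR_gt0// ge0_ler_powR// ?nnegrE ?(ltW k0) ?(ltW ka)//.
by rewrite opprB subr_ge0 ltW.
Qed.

Lemma cvg_powR_rate : (fun j => ((4 ^+ j)^-1 : R) `^ p) @ \oo --> (0 : R).
Proof.
have := cvg_powR_norm p0 (@cvg_rate R); rewrite normr0 powR0 ?gt_eqF//.
by apply: cvg_trans; apply: near_eq_cvg; apply: nearW => j; rewrite ger0_norm// ltW// rate_gt0.
Qed.

Lemma loc_integrable_near f f0 (C : R) : measurable_fun setT f -> continuous f0 ->
  (\int[leb]_x (`|f0 x - f x| `^ p)%:E <= C%:E)%E -> loc_integrable f.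
Proof.
move=> mf c0 fC; split => // K cK; have mK := compact_measurable_rV cK.
have mf0 := continuous_measurable_rV c0.
have md : measurable_fun setT (fun x => `|f0 x - f x| `^ p).
  exact: (measurable_powR_norm p (measurable_funB mf0 mf)).
have i1 : leb.-integrable K (EFin \o (fun x => `|f0 x| + 1)).
  have c1 : continuous (fun x => `|f0 x| + 1).
    apply: continuous_addf; last exact: cst_continuous.
    by apply: (@continuous_compf _ _ Num.norm f0) => //; exact: norm_continuous.
  by have [_] := continuous_loc_integrable c1; apply.
have i2 : leb.-integrable K (EFin \o (fun x => `|f0 x - f x| `^ p)).
  apply: (integrableS measurableT mK) => //.
  apply/integrableP; split; first exact/measurable_EFinP.
  under eq_integral do rewrite /= ger0_norm ?powR_ge0//.
  exact: le_lt_trans fC (ltry _).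
apply: le_integrable (integrableD mK i1 i2) => //.
  by apply/measurable_EFinP; exact: measurable_funS mf.
move=> x _ /=; rewrite lee_fin [leRHS]ger0_norm ?addr_ge0 ?powR_ge0//.
have := @abs_split 1 (f0 x - f x) ltr01; rewrite powR1 mul1r.
have := lerB_dist (f x) (f0 x); rewrite distrC; lra.
Qed.

(** The Cauchy estimate produces some limit [f], not yet related to [u]. Pairing [molj j u] with a
    bump converges to the pairing of the bump with [u] and also to that with [f], so [u - f] is
    orthogonal to all bumps. *)
Lemma molj_ae : 0 <= M ->
  {ae leb, forall x, (fun j => molj j u x) @ \oo --> u x} /\
  forall j, (\int[leb]_x (`|molj j u x - u x| `^ p)%:E <= (approx_const * M * ((4 ^+ j)^-1) `^ p)%:E)%E.
Proof.
move=> M0; set C := approx_const * M.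
have C0 : 0 <= C by rewrite !mulr_ge0 ?powR_ge0 ?exprn_ge0 ?powR_ge0.
have [f [mf cf fC]] := @riesz_fischer R _ _ leb (fun j => molj j u) p C p0 C0
  (fun j => continuous_measurable_rV (@cu j)) (fun j k => @molj_cauchy j k M0).
have lf : loc_integrable f by exact: loc_integrable_near mf (@cu 0%N) (fC 0%N).
have mu : measurable_fun setT u by case: lu.
pose w x := u x - f x.
have lw : loc_integrable w.
  have [m1 h1] := lu; have [m2 h2] := lf; split; first exact: measurable_funB.
  move=> K cK; have mK := compact_measurable_rV cK.
  by have := integrableB mK (h1 K cK) (h2 K cK); apply: eq_integrable.
suff w0 : {ae leb, forall x, w x = 0}.
  split; first by apply: filterS2 cf w0 => x + /eqP; rewrite subr_eq0 => + /eqP ->.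
  move=> j; apply: le_trans (fC j); rewrite le_eqVlt; apply/orP; left; apply/eqP.
  apply: ae_eq_integral => //.
  - by apply/measurable_EFinP; exact: (measurable_powR_norm p (measurable_funB (continuous_measurable_rV (@cu j)) mu)).
  - by apply/measurable_EFinP; exact: (measurable_powR_norm p (measurable_funB (continuous_measurable_rV (@cu j)) mf)).
  - by apply: filterS w0 => x /eqP; rewrite subr_eq0 => /eqP -> _.
apply: du_bois_reymond => // n a b.
have [r r0 br] := obox_bounded a b; set phi := bump n.+1%:R a b.
have phi0 x : ~ cube 0 r x -> phi x = 0.
  move=> xr; apply: bump_eq0 => //; apply: contrapT => h'; apply: xr; apply: br => i.
  by apply: contrapT => /negP hi; apply: h'; exists i.
have phi_ge0 x : 0 <= phi x by exact: bump_ge0.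
have phi_le1 x : phi x <= 1 by exact: bump_le1.
have mphi : measurable_fun setT phi by exact: measurable_bump.
have cphi : coord_algebra phi by exact: coord_algebra_bump.
have nphi x : `|phi x| <= 1 by rewrite ger0_norm.
have iphi v : loc_integrable v -> leb.-integrable setT (fun x => (v x * phi x)%:E).
  by move=> lv; exact: loc_integrable_mul lv mphi nphi phi0.
rewrite -EFin_Rintegral; last exact: iphi.
congr EFin.
have -> : \int[leb]_x (w x * phi x) = \int[leb]_x (u x * phi x) - \int[leb]_x (f x * phi x).
  rewrite -RintegralB//; [|exact: iphi|exact: iphi].
  by apply: eq_Rintegral => x _; rewrite /w mulrBl.
(* On the side of [u]: the pairing of [molj j u] with [phi] is [molj j (mol phi u)] at the origin,
   and [mol phi u] is continuous. *)
have cvg1 : (fun j => \int[leb]_x (molj j u x * phi x)) @ \oo --> \int[leb]_x (u x * phi x).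
  have -> : \int[leb]_x (u x * phi x) = mol phi u 0.
    by rewrite /mol; apply: eq_Rintegral => x _; rewrite subr0.
  rewrite (_ : (fun _ => _) = fun j => molj j (mol phi u) 0).
    by apply: cvg_molj; exact: continuous_mol lu cphi phi0.
  apply/funext => j; have [cpsi _ psir _] := av j.
  rewrite (mol_pairing lu (ltW r0) cpsi psir mphi nphi phi0) /molj {2}/mol.
  by apply: eq_Rintegral => z _; rewrite subr0 mulrC.
pose L := (2 * r) ^+ N.
have L0 : 0 <= L by rewrite exprn_ge0// mulr_ge0// ltW.
(* On the side of [f]: [abs_split] on a cube containing the support of [phi], where [k] will be
   chosen before [j]. *)
have near_f j (k : R) : 0 < k ->
    `|\int[leb]_x (molj j u x * phi x) - \int[leb]_x (f x * phi x)| <=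
     k * L + k `^ (1 - p) * (C * ((4 ^+ j)^-1) `^ p).
  move=> k0; have lj := continuous_loc_integrable (@cu j).
  rewrite -RintegralB//; [|exact: iphi|exact: iphi].
  have id : leb.-integrable setT (EFin \o (fun x => molj j u x * phi x - f x * phi x)).
    exact: (integrableB _ (iphi _ lj) (iphi _ lf)).
  rewrite -lee_fin EFin_normr_Rintegral//; apply: le_trans (le_abse_integral _ _ _) _ => //.
    by case/integrableP: id.
  have mj := continuous_measurable_rV (@cu j).
  have mcub : measurable (cube (0 : V) r) by exact: measurable_cube.
  have mdp : measurable_fun setT (fun x => `|molj j u x - f x| `^ p).
    exact: (measurable_powR_norm p (measurable_funB mj mf)).
  apply: (@le_trans _ _ (\int[leb]_x (k * \1_(cube 0 r) x + k `^ (1 - p) * `|molj j u x - f x| `^ p)%:E)%E).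
    rewrite (eq_integral (fun x => (`|molj j u x * phi x - f x * phi x|)%:E)); last by [].
    apply: le_int.
    - apply: measurableT_comp => //; apply: measurable_funB; exact: measurable_funM.
    - apply: measurable_funD; last exact: measurable_funM.
      by apply: measurable_funM => //; exact: measurable_indic.
    - by move=> x; exact: normr_ge0.
    move=> x; have [xr|/phi0 ->] := pselect (cube 0 r x); last first.
      by rewrite !mulr0 subrr normr0 addr_ge0// mulr_ge0 ?powR_ge0// ltW.
    rewrite indicE mem_set// mulr1 -mulrBl normrM.
    apply: le_trans (abs_split (molj j u x - f x) k0).
    by rewrite ler_piMr.
  rewrite intD; last 4 first.
  - by apply: measurable_funM => //; exact: measurable_indic.
  - exact: measurable_funM.
  - by move=> x; rewrite mulr_ge0// ltW.
  - by move=> x; rewrite mulr_ge0 ?powR_ge0.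
  rewrite int_indic ?(ltW k0)// (intZ leb mdp) ?powR_ge0//.
  rewrite leb_cube ?(ltW r0)// -EFinM EFinD; apply: leeD => //.
  by rewrite (EFinM (k `^ _)); apply: lee_wpmul2l => //; rewrite lee_fin powR_ge0.
apply/eqP; rewrite -normr_eq0 eq_le normr_ge0 andbT; apply/ler_addgt0Pr => eps e0; rewrite add0r.
pose k := eps / (4 * (L + 1)).
have k0 : 0 < k by rewrite divr_gt0// mulr_gt0// ltr_wpDl.
have kL : k * L <= eps / 4.
  rewrite /k -mulrA ler_wpM2l ?(ltW e0)// mulrC ler_pdivrMr ?mulr_gt0 ?ltr_wpDl//.
  by rewrite mulrA mulVf// mul1r lerDl.
pose D := k `^ (1 - p) * C + 1.
have D0 : 0 < D by rewrite ltr_wpDl// mulr_ge0 ?powR_ge0.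
have h1 : \forall j \near \oo, `|\int[leb]_x (u x * phi x) - \int[leb]_x (molj j u x * phi x)| <= eps / 4.
  by move/cvgrPdist_le: cvg1; apply; rewrite divr_gt0.
have h2 : \forall j \near \oo, ((4 ^+ j)^-1 : R) `^ p < eps / 4 / D.
  by apply: (cvgr_lt (0:R) cvg_powR_rate); rewrite !divr_gt0.
have [j [hj1 hj2]] := filter_ex (filterI h1 h2).
have hn := near_f j k k0.
have hj3 : k `^ (1 - p) * (C * ((4 ^+ j)^-1) `^ p) <= eps / 4.
  apply: (@le_trans _ _ (D * ((4 ^+ j)^-1) `^ p)).
    by rewrite mulrA ler_wpM2r ?powR_ge0// lerDl.
  by move: hj2; rewrite ltr_pdivlMr// mulrC => /ltW.
set A := \int[leb]_x (u x * phi x) in hj1 *; set B := \int[leb]_x (f x * phi x) in hn *.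
set E := \int[leb]_x (molj j u x * phi x) in hj1 hn *.
have -> : A - B = (A - E) + (E - B) by ring.
apply: (le_trans (ler_normD _ _)); lra.
Qed.

End one_function.

Lemma molj_tame (M M2 : R) : 0 <= M -> 0 <= M2 -> exists2 C : R, 0 <= C &
  forall u g h, energy M M2 u g h -> forall j, tame C (molj j u).
Proof.
move=> M0 M20.
have hc0 : 0 <= hardy_const (N := N) p.
  by rewrite /hardy_const divr_ge0 ?mulr_ge0 ?powR_ge0 ?subr_ge0 ?(ltW p0) ?(ltW pN)// divr_ge0// subr_ge0 ltW.
have rc0 : 0 <= rellich_const (N := N) q.
  by rewrite /rellich_const divr_ge0// mulr_ge0 ?powR_ge0 ?subr_ge0 ?(ltW q0) ?(ltW q1) ?(ltW qN).
have ic0 : 0 <= incr_const * M by rewrite mulr_ge0// exprn_ge0// powR_ge0.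
have [K K0 wt] := @weak_type R N p _ _ p1 pN (mulr_ge0 hc0 M0) ic0.
set C1 := hardy_const (N := N) p * M; set C2 := rellich_const (N := N) q * M2.
have C10 : 0 <= C1 by exact: mulr_ge0.
have C20 : 0 <= C2 by exact: mulr_ge0.
exists (C1 + C2 + K); first by rewrite !addr_ge0.
move=> u g h En j; have lu : loc_integrable u by case: En.
have cu : continuous (molj j u) by exact: continuous_molj.
have mcu := continuous_measurable_rV cu.
have le1 : C1 <= C1 + C2 + K by rewrite -addrA lerDl addr_ge0.
have le2 : C2 <= C1 + C2 + K by rewrite addrAC lerDr addr_ge0.
have le3 : K <= C1 + C2 + K by rewrite lerDr addr_ge0.
split => //.
- by apply: (le_trans (molj_hardy0 En j)); rewrite lee_fin.
- by apply: (le_trans (molj_rellich0 En j)); rewrite lee_fin.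
move=> lam l0; apply: (@le_trans _ _ (K * lam `^ (- ps))%:E).
  by apply: (wt _ (continuous_loc_integrable cu) (molj_hardy En j) (molj_increment En j)).
by rewrite lee_fin ler_wpM2r ?powR_ge0.
Qed.

End energy_bounds.

(** * Dyadic layer-cake estimates *)

Section layer_cake.
Context {R : realType}.

Lemma dyadic_bracket (x : R) : 1 < x -> exists k : nat, 2 ^+ k < x <= 2 ^+ k.+1.
Proof.
move=> x1.
have ex : exists n : nat, x <= 2 ^+ n.
  exists (Num.truncn x).+1; apply: (le_trans (ltW (truncnS_gt x))).
  by rewrite -natrX ler_nat ltnW// ltn_expl.
case: (ex_minnP ex) => -[|k] xk kmin.
  by move: xk; rewrite expr0 leNgt x1.
exists k; rewrite xk andbT ltNge; apply/negP => /kmin.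
by rewrite ltnn.
Qed.

Lemma powR_small (a B : R) : 0 < a -> 0 < B ->
  exists2 x0 : R, 0 < x0 & forall x, 0 <= x -> x <= x0 -> x `^ a <= B.
Proof.
move=> a0 B0; exists (B `^ a^-1); first by rewrite powR_gt0.
move=> x x0 xB; have -> : B = (B `^ a^-1) `^ a by rewrite -powRrM mulVf ?gt_eqF// powRr1// ltW.
by apply: ge0_ler_powR; rewrite ?nnegrE ?powR_ge0// ltW.
Qed.

Lemma th_bounds (c : R) : c < 0 -> 0 < (2 : R) `^ c < 1.
Proof.
move=> c0; rewrite powR_gt0//= -[c]opprK powRN invf_lt1 ?powR_gt0//.
have : (1 : R) `^ (- c) < 2 `^ (- c) by apply: gt0_ltr_powR; rewrite ?oppr_gt0 ?nnegrE ?ltr1n.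
by rewrite powR1.
Qed.

(** On [2^k Lam < f <= 2^(k+1) Lam] the integrand is at most [(2^(k+1) Lam)^b], and with the weak
    bound the sum becomes geometric of ratio [2^(b - a)]. *)
Lemma layer_cake d (T : measurableType d) (mu : {measure set T -> \bar R}) (f : T -> R)
    (C a b Lam : R) : measurable_fun setT f -> (forall x, 0 <= f x) -> 0 <= C -> 0 <= b -> b < a ->
  0 < Lam -> (forall lam : R, 0 < lam -> (mu [set x | (lam < f x)%R] <= (C * lam `^ (- a))%:E)%E) ->
  (\int[mu]_x (f x `^ b * \1_[set x | Lam < f x] x)%:E <=
   (C * 2 `^ b * Lam `^ (b - a) / (1 - 2 `^ (b - a)))%:E)%E.
Proof.
move=> mf f0 C0 b0 ba L0 fC.
have th := @th_bounds (b - a) ltac:(by rewrite subr_lt0).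
apply: (@int_dyadic_le _ _ _ mu _ (fun k => [set x | 2 ^+ k * Lam < f x])
  (fun k => (2 ^+ k.+1 * Lam) `^ b)) => //.
- apply: measurable_funM; first exact: (measurableT_comp (@measurable_powR R b) mf).
  by apply: measurable_indic; exact: measurable_set_gt.
- by move=> x; rewrite mulr_ge0 ?powR_ge0.
- by move=> k; exact: measurable_set_gt.
- by move=> k; exact: powR_ge0.
- by rewrite !mulr_ge0 ?powR_ge0.
- move=> x; rewrite indicE; have [xL|xL] := ltP Lam (f x); last first.
    by rewrite memNset ?mulr0 ?ltxx//= ltNge xL.
  rewrite mem_set// mulr1 => _.
  have [k /andP[k1 k2]] : exists k : nat, 2 ^+ k < f x / Lam <= 2 ^+ k.+1.
    by apply: dyadic_bracket; rewrite ltr_pdivlMr// mul1r.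
  exists k; first by move: k1; rewrite /= ltr_pdivlMr.
  apply: ge0_ler_powR; rewrite ?nnegrE ?mulr_ge0 ?exprn_ge0 ?(ltW L0)//.
  by rewrite -ler_pdivrMr.
move=> k; have kL : 0 < 2 ^+ k * Lam by rewrite mulr_gt0 ?exprn_gt0.
apply: (le_trans (lee_wpmul2l _ (fC _ kL))); first by rewrite lee_fin powR_ge0.
rewrite -EFinM lee_fin le_eqVlt; apply/orP; left; apply/eqP.
have -> : 2 ^+ k.+1 * Lam = 2 * (2 ^+ k * Lam) by rewrite exprS mulrA.
rewrite (powRM b (ler0n _ 2) (ltW kL)).
have -> : 2 `^ b * (2 ^+ k * Lam) `^ b * (C * (2 ^+ k * Lam) `^ (- a)) =
  C * 2 `^ b * ((2 ^+ k * Lam) `^ b * (2 ^+ k * Lam) `^ (- a)) by ring.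
rewrite -powRD ?(gt_eqF kL) ?implybT// powRM ?exprn_ge0 ?(ltW L0)//.
have -> : (2 ^+ k) `^ (b - a) = ((2 : R) `^ (b - a)) ^+ k.
  by rewrite -powR_mulrn// -powRrM mulrC powRrM powR_mulrn// powR_ge0.
by ring.
Qed.

Context {N : nat}.
Local Notation V := 'rV[R]_N.
Local Notation leb := (measure_function_SigmaFiniteMeasure__to__measure_function_Measure (lebesgue_rV R N)).

Lemma enorm_cube (x : V) (s : R) : 0 <= s -> enorm x <= s -> cube 0 s x.
Proof.
move=> s0 xs i; rewrite mxE subr0; apply: le_trans xs.
rewrite -sqrtr_sqr /enorm ler_sqrt; last by apply: sumr_ge0 => j _; exact: sqr_ge0.
by rewrite (bigD1 i)//= lerDl; apply: sumr_ge0 => j _; exact: sqr_ge0.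
Qed.

(** The same decomposition into dyadic shells, each inside a cube of comparable volume; the ratio is
    [2^(N - b)]. *)
Lemma int_enorm_far (b S : R) : N%:R < b -> 0 < S ->
  (\int[leb]_x (enorm x `^ (- b) * \1_[set x | S < enorm x] x)%:E <=
   (4 ^+ N * S `^ (N%:R - b) / (1 - 2 `^ (N%:R - b)))%:E)%E.
Proof.
move=> Nb S0; have th := @th_bounds (N%:R - b) ltac:(by rewrite subr_lt0).
have b0 : 0 <= b by rewrite (le_trans _ (ltW Nb)).
apply: (@int_dyadic_le _ _ _ leb _ (fun k => cube 0 (2 ^+ k.+1 * S))
  (fun k => (2 ^+ k * S) `^ (- b))) => //.
- apply: measurable_funM; first exact: measurable_enorm_powR.
  by apply: measurable_indic; apply: measurable_set_gt; exact: measurable_enorm.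
- by move=> x; rewrite mulr_ge0 ?powR_ge0.
- by move=> k; exact: measurable_cube.
- by move=> k; exact: powR_ge0.
- by rewrite mulr_ge0 ?powR_ge0 ?exprn_ge0.
- move=> x; rewrite indicE; have [xS|xS] := ltP S (enorm x); last first.
    by rewrite memNset ?mulr0 ?ltxx//= ltNge xS.
  rewrite mem_set// mulr1 => _.
  have [k /andP[k1 k2]] : exists k : nat, 2 ^+ k < enorm x / S <= 2 ^+ k.+1.
    by apply: dyadic_bracket; rewrite ltr_pdivlMr// mul1r.
  have kS : 0 < 2 ^+ k * S by rewrite mulr_gt0 ?exprn_gt0.
  exists k.
    by apply: enorm_cube; rewrite ?mulr_ge0 ?exprn_ge0 ?(ltW S0)// -ler_pdivrMr.
  have kx : 2 ^+ k * S <= enorm x by rewrite -ler_pdivlMr// ltW.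
  rewrite !powRN lef_pV2 ?posrE ?powR_gt0//; last exact: lt_le_trans kx.
  by apply: ge0_ler_powR; rewrite ?nnegrE ?enorm_ge0 ?(ltW kS).
move=> k; have kS : 0 < 2 ^+ k * S by rewrite mulr_gt0 ?exprn_gt0.
rewrite leb_cube ?mulr_ge0 ?exprn_ge0 ?(ltW S0)// -EFinM lee_fin le_eqVlt; apply/orP; left; apply/eqP.
have -> : 2 * (2 ^+ k.+1 * S) = 4 * (2 ^+ k * S) by rewrite exprS; ring.
rewrite exprMn -(powR_mulrn N (ltW kS)) mulrCA [(_ `^ (- b)) * _]mulrC -powRD ?(gt_eqF kS) ?implybT//.
rewrite powRM ?exprn_ge0 ?(ltW S0)//.
have -> : (2 ^+ k) `^ (N%:R - b) = ((2 : R) `^ (N%:R - b)) ^+ k.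
  by rewrite -powR_mulrn// -powRrM mulrC powRrM powR_mulrn// powR_ge0.
by ring.
Qed.

End layer_cake.

(** * Uniform smallness near the origin and near infinity *)

Section tails.
Context {R : realType} {N : nat}.
Local Notation V := 'rV[R]_N.
Local Notation leb := (measure_function_SigmaFiniteMeasure__to__measure_function_Measure (lebesgue_rV R N)).
Variables (p q sigma : R).
Hypotheses (p1 : 1 < p) (pN : p < N%:R) (q1 : 1 < q) (qN : 2 * q < N%:R) (pq : p <> q)
  (sp : p < sigma) (sq : sigma < 2 * q) (crit : N%:R * (p - q) < p * q).
Let r : R := (p * q + sigma * (q - p)) / (2 * q - p).
(** The interpolation parameter: [r = (1 - t) p + t q] and [sigma = (1 - t) p + 2 t q]. *)
Let t : R := (sigma - p) / (2 * q - p).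

Let d0 : 0 < 2 * q - p. Proof. by rewrite subr_gt0 (lt_trans sp sq). Qed.
Let t0 : 0 < t. Proof. by rewrite divr_gt0// subr_gt0. Qed.
Let t1 : t < 1. Proof. by rewrite /t ltr_pdivrMr// mul1r ltrD2r. Qed.
Let p0 : 0 < p. Proof. exact: lt_trans ltr01 p1. Qed.
Let q0 : 0 < q. Proof. exact: lt_trans ltr01 q1. Qed.
Let rE : r = p + (q - p) * t.
Proof. by rewrite /r /t; field; rewrite gt_eqF. Qed.
Let r_gt0 : 0 < r.
Proof.
rewrite rE (_ : p + (q - p) * t = p * (1 - t) + q * t); last by ring.
by rewrite addr_gt0// mulr_gt0// subr_gt0.
Qed.

Section pointwise.
Variables (U L : R).
Hypotheses (U0 : 0 < U) (L0 : 0 < L).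
Let Y : R := U `^ (q - p) * L `^ (p - 2 * q).

Let Y0 : 0 < Y. Proof. by rewrite mulr_gt0// powR_gt0. Qed.

Lemma ratio_powR (a b c : R) :
  U `^ a * L `^ b * Y `^ c = U `^ (a + (q - p) * c) * L `^ (b + (p - 2 * q) * c).
Proof.
rewrite /Y powRM ?powR_ge0// -!powRrM !powRD ?(gt_eqF U0) ?(gt_eqF L0) ?implybT//.
by ring.
Qed.

Lemma ratio_p : U `^ r * L `^ (- sigma) = U `^ p * L `^ (- p) * Y `^ t.
Proof. by rewrite ratio_powR rE; congr (_ `^ _ * _ `^ _); rewrite /t; field; rewrite gt_eqF. Qed.

Lemma ratio_q : U `^ r * L `^ (- sigma) = U `^ q * L `^ (- (2 * q)) * Y `^ (t - 1).
Proof. by rewrite ratio_powR /r; congr (_ `^ _ * _ `^ _); rewrite /t; field; rewrite gt_eqF. Qed.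

(** A power of [Y] eliminates either variable, here [L] and in [ratio_L] the variable [U]. For [Y]
    bounded above and below, the integrand is thus, up to constants, a power of [U] alone and also a
    power of [L] alone. *)
Lemma ratio_U : U `^ r * L `^ (- sigma) = U `^ (p * q / (2 * q - p)) * Y `^ (sigma / (2 * q - p)).
Proof.
have := ratio_powR (p * q / (2 * q - p)) 0 (sigma / (2 * q - p)).
rewrite powRr0 mulr1 => ->; rewrite /r.
by congr (_ `^ _ * _ `^ _); field; rewrite gt_eqF.
Qed.

Lemma ratio_L : U `^ r * L `^ (- sigma) = L `^ (p * q / (q - p)) * Y `^ (r / (q - p)).
Proof.
have qp : q - p != 0 by rewrite subr_eq0; apply/eqP => /esym.
have := ratio_powR 0 (p * q / (q - p)) (r / (q - p)).
rewrite powRr0 mul1r => ->; rewrite /r.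
by congr (_ `^ _ * _ `^ _); field; rewrite qp ?gt_eqF.
Qed.

(* On [eps < Y < 1/eps] the values of [U] and [L] determine each other up to constants. *)
Lemma ratio_trichotomy (eps : R) : 0 < eps -> eps < 1 ->
  [\/ U `^ r * L `^ (- sigma) <= eps `^ t * (U `^ p * L `^ (- p)),
      U `^ r * L `^ (- sigma) <= eps `^ (1 - t) * (U `^ q * L `^ (- (2 * q))) |
   [/\ eps < Y, Y < eps^-1,
      U `^ r * L `^ (- sigma) <= eps `^ (- (sigma / (2 * q - p))) * U `^ (p * q / (2 * q - p)) &
      U `^ r * L `^ (- sigma) <= eps `^ (- `|r / (q - p)|) * L `^ (p * q / (q - p))]].
Proof.
move=> e0 e1; have [Ye|eY] := leP Y eps.
  apply: Or31; rewrite ratio_p mulrC ler_wpM2r ?mulr_ge0 ?powR_ge0//.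
  by apply: ge0_ler_powR; rewrite ?nnegrE ?(ltW t0) ?(ltW Y0) ?(ltW e0).
have inv (a b c : R) : 0 < a -> a <= b -> 0 <= c -> b `^ (- c) <= a `^ (- c).
  move=> a0 ab c0; have b0 := lt_le_trans a0 ab.
  by rewrite !powRN lef_pV2 ?posrE ?powR_gt0// ge0_ler_powR// nnegrE ltW.
have epsV (c : R) : (eps^-1) `^ c = eps `^ (- c).
  by rewrite -powR_inv1 ?(ltW e0)// -powRrM mulN1r.
have [Ye|Ye] := leP eps^-1 Y.
  apply: Or32; rewrite ratio_q mulrC ler_wpM2r ?mulr_ge0 ?powR_ge0//.
  rewrite -opprB; apply: (le_trans (inv _ _ _ _ Ye _)); rewrite ?invr_gt0 ?subr_ge0 ?(ltW t1)//.
  by rewrite epsV opprK.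
apply: Or33; split => //.
  rewrite ratio_U mulrC ler_wpM2r ?powR_ge0// -epsV.
  have s0 : 0 <= sigma / (2 * q - p) by rewrite ltW// divr_gt0// (lt_trans p0).
  by apply: ge0_ler_powR; rewrite ?nnegrE ?(ltW Y0) ?invr_ge0 ?(ltW e0) ?(ltW Ye).
rewrite ratio_L mulrC ler_wpM2r ?powR_ge0//.
have [c0|c0] := leP 0 (r / (q - p)).
  by rewrite ger0_norm// -epsV; apply: ge0_ler_powR; rewrite ?nnegrE ?(ltW Y0) ?invr_ge0 ?(ltW e0) ?(ltW Ye).
rewrite ltr0_norm// opprK -[r / (q - p)]opprK.
by apply: inv; rewrite ?oppr_ge0 ?(ltW c0) ?(ltW eY).
Qed.

End pointwise.

Definition tail (rho : R) : set V := [set x | enorm x < rho] `|` [set x | rho^-1 < enorm x].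

Lemma measurable_tail rho : measurable (tail rho).
Proof.
by apply: measurableU; [apply: measurable_set_lt|apply: measurable_set_gt]; exact: measurable_enorm.
Qed.

(** With denominators cleared the difference is [p (p q - N (p - q))], positive by [crit]. The
    strict inequality is what lets the layer-cake estimate work from a weak Sobolev bound. *)
Lemma critical_exponent_lt : p * q / (2 * q - p) < sobolev1 N p.
Proof.
have np : 0 < N%:R - p by rewrite subr_gt0.
rewrite /sobolev1 ltr_pdivrMr// mulrAC ltr_pdivlMr// -subr_gt0.
have -> : N%:R * p * (2 * q - p) - p * q * (N%:R - p) = p * (p * q - N%:R * (p - q)) by ring.
by rewrite mulr_gt0// subr_gt0.
Qed.

(** The half of the tail on which [|x|^(pq/(q-p))] has small integral: near the origin if [p < q],
    where the exponent is positive; near infinity if [q < p], where the exponent is below [-N]. On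
    the other half, bounds on [Y] force [|v|] to be large. *)
Definition low_part (rho : R) : set V :=
  if p < q then [set x | enorm x < rho] else [set x | rho^-1 < enorm x].

Lemma measurable_low_part rho : measurable (low_part rho).
Proof.
by rewrite /low_part; case: ifP => _; [apply: measurable_set_lt|apply: measurable_set_gt]; exact: measurable_enorm.
Qed.

Lemma int_low_part (eta : R) : 0 < eta -> exists2 x0 : R, 0 < x0 & forall rho, 0 < rho -> rho < 1 -> rho <= x0 ->
  (\int[leb]_x (enorm x `^ (p * q / (q - p)) * \1_(low_part rho) x)%:E <= eta%:E)%E.
Proof.
move=> e0; rewrite /low_part; have [pq'|] := boolP (p < q).
  have c0 : 0 < p * q / (q - p) by rewrite divr_gt0 ?mulr_gt0// subr_gt0.
  (* As [rho < 1], the cube of radius [rho] has volume at most [2 ^+ N]. *)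
  have e20 : 0 < eta / 2 ^+ N by rewrite divr_gt0// exprn_gt0.
  have [x0 x00 hx] := powR_small c0 e20; exists x0 => // rho rho0 rho1 rhox.
  apply: (@le_trans _ _ (\int[leb]_x (eta / 2 ^+ N * \1_(cube 0 rho) x)%:E)%E).
    apply: le_int.
    - apply: measurable_funM; first exact: measurable_enorm_powR.
      by apply: measurable_indic; apply: measurable_set_lt; exact: measurable_enorm.
    - by apply: measurable_funM => //; apply: measurable_indic; exact: measurable_cube.
    - by move=> x; rewrite mulr_ge0 ?powR_ge0.
    move=> x; have [xr|xr] := ltP (enorm x) rho; last first.
      rewrite [\1_[set _ | _] x]indicE memNset; last by rewrite /= ltNge xr.
      by rewrite mulr0 mulr_ge0// ltW.
    rewrite !indicE !mem_set ?mulr1//; last by apply: enorm_cube; rewrite ltW.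
    by apply: hx; rewrite ?enorm_ge0// (le_trans (ltW xr)).
  rewrite int_indic; [|exact: measurable_cube|exact: ltW].
  rewrite leb_cube ?(ltW rho0)// -EFinM lee_fin exprMn mulrA divfK ?expf_neq0//.
  by rewrite ler_piMr ?(ltW e0)// exprn_ile1// ltW.
rewrite -leNgt le_eqVlt => /orP[/eqP qp|qp]; first by exfalso; exact: pq.
have pqn : 0 < p - q by rewrite subr_gt0.
set b := p * q / (p - q); have Nb : N%:R < b by rewrite ltr_pdivlMr.
have -> : p * q / (q - p) = - b by rewrite /b -mulrN -invrN opprB.
have /andP[th0 th1] := @th_bounds R (N%:R - b) ltac:(by rewrite subr_lt0).
have bN0 : 0 < b - N%:R by rewrite subr_gt0.
have e20 : 0 < eta * (1 - 2 `^ (N%:R - b)) / 4 ^+ N.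
  by rewrite divr_gt0 ?exprn_gt0// mulr_gt0// subr_gt0.
have [x0 x00 hx] := powR_small bN0 e20; exists x0 => // rho rho0 rho1 rhox.
have ri0 : 0 < rho^-1 by rewrite invr_gt0.
apply: (le_trans (int_enorm_far Nb ri0)); rewrite lee_fin ler_pdivrMr ?subr_gt0//.
have -> : rho^-1 `^ (N%:R - b) = rho `^ (b - N%:R).
  by rewrite -powR_inv1 ?(ltW rho0)// -powRrM mulN1r opprB.
rewrite mulrC -ler_pdivlMr ?exprn_gt0//.
by apply: hx => //; exact: ltW.
Qed.

Lemma tails (C eta : R) : 0 <= C -> 0 < eta -> exists2 rho : R, 0 < rho < 1 &
  forall v, tame p q C v ->
  (\int[leb]_x (`|v x| `^ r * enorm x `^ (- sigma) * \1_(tail rho) x)%:E <= eta%:E)%E.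
Proof.
move=> C0 eta0; pose e1 := eta / 4; have e10 : 0 < e1 by rewrite divr_gt0.
have B0 : 0 < e1 / (C + 1) by rewrite divr_gt0// ltr_wpDl.
have t10 : 0 < 1 - t by rewrite subr_gt0.
have [x1 x10 hx1] := powR_small t0 B0.
have [x2 x20 hx2] := powR_small t10 B0.
(* [eps] is so small that the regions [Y <= eps] and [eps^-1 <= Y] contribute at most [e1] each,
   through the Hardy and Rellich bounds. *)
pose eps := Num.min (Num.min x1 x2) 2^-1.
have eps0 : 0 < eps by rewrite !lt_min x10 x20 invr_gt0 ltr0n.
have eps1 : eps < 1 by rewrite gt_min invf_lt1 ?ltr1n ?orbT.
have ex1 : eps <= x1 by rewrite !ge_min lexx.
have ex2 : eps <= x2 by rewrite !ge_min lexx orbT.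
have CB (B : R) : B <= e1 / (C + 1) -> B * C <= e1.
  move=> hB; apply: (le_trans (ler_wpM2r C0 hB)).
  by rewrite mulrAC ler_pdivrMr ?ltr_wpDl// ler_wpM2l ?(ltW e10)// lerDl.
have E1 := CB _ (hx1 _ (ltW eps0) ex1); have E2 := CB _ (hx2 _ (ltW eps0) ex2).
pose b0 := p * q / (2 * q - p); pose ps := sobolev1 N p.
have b0ps : b0 < ps by exact: critical_exponent_lt.
have b0_ge0 : 0 <= b0 by rewrite ltW// divr_gt0// mulr_gt0.
have /andP[th0 th1] := @th_bounds R (b0 - ps) ltac:(by rewrite subr_lt0).
pose A1 := eps `^ (- (sigma / (2 * q - p))); pose A2 := eps `^ (- `|r / (q - p)|).
have A10 : 0 < A1 by rewrite powR_gt0. have A20 : 0 < A2 by rewrite powR_gt0.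
pose K1 := A1 * (C * 2 `^ b0 / (1 - 2 `^ (b0 - ps))).
have K10 : 0 <= K1.
  by rewrite mulr_ge0 ?(ltW A10)// divr_ge0 ?mulr_ge0 ?powR_ge0// subr_ge0 ltW.
have K20 : 0 < e1 / (K1 + 1) by rewrite divr_gt0// ltr_wpDl.
(* Level above which the layer-cake bound contributes at most [e1]. *)
pose Lam := (e1 / (K1 + 1)) `^ (b0 - ps)^-1.
have Lam0 : 0 < Lam by rewrite powR_gt0.
have LamE : Lam `^ (b0 - ps) = e1 / (K1 + 1).
  by rewrite -powRrM mulVf ?powRr1 ?(ltW K20)// subr_eq0 lt_eqF.
(* Prepares the condition on [rho] under which [eps < Y < eps^-1] forces [Lam < |v|] on the tail
   outside [low_part]. *)
have B10 : 0 < eps * Lam `^ (- `|q - p|) by rewrite mulr_gt0// powR_gt0.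
have [y1 y10 hy1] := powR_small d0 B10.
have eA0 : 0 < e1 / A2 by rewrite divr_gt0.
have [y2 y20 hy2] := int_low_part eA0.
pose rho := Num.min (Num.min y1 y2) 2^-1.
have rho0 : 0 < rho by rewrite !lt_min y10 y20 invr_gt0 ltr0n.
have rho1 : rho < 1 by rewrite gt_min invf_lt1 ?ltr1n ?orbT.
have ry1 : rho <= y1 by rewrite !ge_min lexx.
have ry2 : rho <= y2 by rewrite !ge_min lexx orbT.
exists rho; first by rewrite rho0.
have cond := hy1 _ (ltW rho0) ry1; have low := hy2 _ rho0 rho1 ry2.
clearbody rho Lam eps.
move=> v [cv hp hq hw].
have mv := continuous_measurable_rV cv.
pose T1 (x : V) := `|v x| `^ p * enorm x `^ (- p).
pose T2 (x : V) := `|v x| `^ q * enorm x `^ (- (2 * q)).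
pose T3 (x : V) := `|v x| `^ b0 * \1_[set x | Lam < `|v x|] x.
pose T4 (x : V) := enorm x `^ (p * q / (q - p)) * \1_(low_part rho) x.
have mT1 : measurable_fun setT T1.
  exact: (measurable_funM (measurable_powR_norm p mv) (measurable_enorm_powR _)).
have mT2 : measurable_fun setT T2.
  exact: (measurable_funM (measurable_powR_norm q mv) (measurable_enorm_powR _)).
have mT3 : measurable_fun setT T3.
  apply: (measurable_funM (measurable_powR_norm b0 mv)); apply: measurable_indic.
  exact: measurable_set_gt_norm.
have mT4 : measurable_fun setT T4.
  apply: (measurable_funM (measurable_enorm_powR _)); apply: measurable_indic.
  exact: measurable_low_part.
have T10 x : 0 <= T1 x by rewrite mulr_ge0 ?powR_ge0.
have T20 x : 0 <= T2 x by rewrite mulr_ge0 ?powR_ge0.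
have T30 x : 0 <= T3 x by rewrite mulr_ge0 ?powR_ge0.
have T40 x : 0 <= T4 x by rewrite mulr_ge0 ?powR_ge0.
have [et0 et10] : 0 <= eps `^ t /\ 0 <= eps `^ (1 - t) by split; exact: powR_ge0.
apply: (@le_trans _ _ (\int[leb]_x (eps `^ t * T1 x + eps `^ (1 - t) * T2 x + (A1 * T3 x + A2 * T4 x))%:E)%E).
  apply: le_int.
  - apply: measurable_funM.
      exact: (measurable_funM (measurable_powR_norm r mv) (measurable_enorm_powR _)).
    by apply: measurable_indic; exact: measurable_tail.
  - by apply: measurable_funD; apply: measurable_funD; exact: measurable_funM.
  - by move=> x; rewrite mulr_ge0 ?mulr_ge0 ?powR_ge0.
  move=> x; have s1 : 0 <= eps `^ t * T1 x by exact: mulr_ge0.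
  have s2 : 0 <= eps `^ (1 - t) * T2 x by exact: mulr_ge0.
  have s3 : 0 <= A1 * T3 x by rewrite mulr_ge0// ltW.
  have s4 : 0 <= A2 * T4 x by rewrite mulr_ge0// ltW.
  have rhs0 : 0 <= eps `^ t * T1 x + eps `^ (1 - t) * T2 x + (A1 * T3 x + A2 * T4 x) by rewrite !addr_ge0.
  rewrite [\1_(tail _) x]indicE; have [xt|xt] := pselect (tail rho x); last by rewrite memNset// mulr0.
  rewrite mem_set// mulr1.
  have [->|v0] := eqVneq (v x) 0; first by rewrite normr0 powR0 ?gt_eqF// mul0r.
  have [->|L0] := eqVneq (enorm x) 0.
    by rewrite [X in _ * X]powR0 ?mulr0// oppr_eq0 gt_eqF// (lt_trans p0).
  have U0' : 0 < `|v x| by rewrite normr_gt0.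
  have L0' : 0 < enorm x by rewrite lt_neqAle eq_sym L0 enorm_ge0.
  have [h|h|[h1 h2 h3 h4]] := ratio_trichotomy U0' L0' eps0 eps1.
  - by apply: (le_trans h); rewrite -/(T1 x); lra.
  - by apply: (le_trans h); rewrite -/(T2 x); lra.
  have [xl|xl] := pselect (low_part rho x).
    apply: (le_trans h4); rewrite -/A2.
    have -> : A2 * enorm x `^ (p * q / (q - p)) = A2 * T4 x by rewrite /T4 indicE mem_set// mulr1.
    lra.
  apply: (le_trans h3); rewrite -/A1 -/b0.
  suff Lv : Lam < `|v x|.
    have -> : A1 * `|v x| `^ b0 = A1 * T3 x by rewrite /T3 indicE mem_set// mulr1.
    lra.
  (* This is [Y * |x|^(2q-p) = |v|^(q-p)]. If [p < q], large [|x|] and [eps < Y] make [|v|^(q-p)]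
     large; if [q < p], small [|x|] and [Y < eps^-1] make it small. In both cases [|v|] is large. *)
  have UE : `|v x| `^ (q - p) * enorm x `^ (p - 2 * q) * enorm x `^ (2 * q - p) = `|v x| `^ (q - p).
    by rewrite -mulrA -powRD ?(gt_eqF L0') ?implybT// (_ : p - 2 * q + (2 * q - p) = 0) ?powRr0 ?mulr1//; ring.
  have Lp0 : 0 < enorm x `^ (2 * q - p) by rewrite powR_gt0.
  move: xl xt cond; rewrite /low_part /tail; have [pq'|] := boolP (p < q).
    move=> xl [//|/= xt]; have qp0 : 0 < q - p by rewrite subr_gt0.
    rewrite gtr0_norm// => cond.
    have Lq0 : 0 < Lam `^ (q - p) by rewrite powR_gt0.
    have h5 : Lam `^ (q - p) < `|v x| `^ (q - p).
      rewrite -UE; apply: (@le_lt_trans _ _ (eps * enorm x `^ (2 * q - p))); last by rewrite ltr_pM2r.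
      have h6 : (rho `^ (2 * q - p))^-1 <= enorm x `^ (2 * q - p).
        rewrite -powRN -mulN1r powRrM powR_inv1 ?(ltW rho0)//.
        by apply: ge0_ler_powR; rewrite ?nnegrE ?invr_ge0 ?(ltW d0) ?(ltW rho0) ?(ltW xt) ?(ltW L0').
      apply: (@le_trans _ _ (eps * (rho `^ (2 * q - p))^-1)); last by rewrite ler_wpM2l// ltW.
      rewrite ler_pdivlMr ?powR_gt0// mulrC -ler_pdivlMr//.
      by rewrite powRN in cond.
    rewrite ltNge; apply: contraL h5 => h5; rewrite -leNgt.
    by apply: ge0_ler_powR; rewrite ?nnegrE ?(ltW qp0) ?(ltW Lam0).
  rewrite -leNgt le_eqVlt => /orP[/eqP qp|qp]; first by exfalso; exact: pq.
  move=> xl [/= xt|//]; have pq0 : 0 < p - q by rewrite subr_gt0.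
  rewrite ltr0_norm ?subr_lt0// opprK => cond.
  have h5 : `|v x| `^ (q - p) < Lam `^ (q - p).
    rewrite -UE; apply: (@lt_le_trans _ _ (eps^-1 * enorm x `^ (2 * q - p))); first by rewrite ltr_pM2r.
    rewrite [leLHS]mulrC ler_pdivrMr// [_ * eps]mulrC; apply: le_trans cond.
    by apply: ge0_ler_powR; rewrite ?nnegrE ?(ltW d0) ?(ltW rho0) ?(ltW xt) ?(ltW L0').
  rewrite ltNge; apply: contraL h5 => h5; rewrite -leNgt.
  rewrite -[q - p]opprB !powRN lef_pV2 ?posrE ?powR_gt0//.
  by apply: ge0_ler_powR; rewrite ?nnegrE ?(ltW pq0) ?(ltW Lam0).
have mZ (k : R) f : measurable_fun setT f -> measurable_fun setT (fun x : V => k * f x).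
  by move=> mf; exact: measurable_funM.
have nZ (k : R) (f : V -> R) : 0 <= k -> (forall x, 0 <= f x) -> forall x, 0 <= k * f x.
  by move=> k0 f0 x; exact: mulr_ge0.
have s1 := nZ _ _ et0 T10; have s2 := nZ _ _ et10 T20.
have s3 := nZ _ _ (ltW A10) T30; have s4 := nZ _ _ (ltW A20) T40.
rewrite (intD leb (measurable_funD (mZ _ _ mT1) (mZ _ _ mT2)) (measurable_funD (mZ _ _ mT3) (mZ _ _ mT4))
  (fun x => addr_ge0 (s1 x) (s2 x)) (fun x => addr_ge0 (s3 x) (s4 x))).
rewrite (intD leb (mZ _ _ mT1) (mZ _ _ mT2) s1 s2) (intD leb (mZ _ _ mT3) (mZ _ _ mT4) s3 s4).
rewrite (intZ leb mT1 T10 et0) (intZ leb mT2 T20 et10) (intZ leb mT3 T30 (ltW A10)) (intZ leb mT4 T40 (ltW A20)).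
have -> : eta = e1 + e1 + (e1 + e1) by rewrite /e1; field.
rewrite !EFinD; apply: leeD; apply: leeD.
- apply: (le_trans (lee_wpmul2l _ hp)); first by rewrite lee_fin.
  by rewrite -EFinM lee_fin.
- apply: (le_trans (lee_wpmul2l _ hq)); first by rewrite lee_fin.
  by rewrite -EFinM lee_fin.
- have mnv : measurable_fun setT (fun x => `|v x|) by apply: measurableT_comp.
  have lc := layer_cake mnv (fun x => normr_ge0 (v x)) C0 b0_ge0 b0ps Lam0 hw.
  apply: (le_trans (lee_wpmul2l _ lc)); first by rewrite lee_fin ltW.
  rewrite -EFinM lee_fin LamE.
  have -> : A1 * (C * 2 `^ b0 * (e1 / (K1 + 1)) / (1 - 2 `^ (b0 - ps))) = K1 * (e1 / (K1 + 1)).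
    by move: (e1 / (K1 + 1)) => X; rewrite /K1; ring.
  by rewrite mulrA ler_pdivrMr ?ltr_wpDl// mulrC ler_wpM2l ?(ltW e10)// lerDl.
- apply: (le_trans (lee_wpmul2l _ low)); first by rewrite lee_fin ltW.
  by rewrite -EFinM lee_fin mulrC divfK// gt_eqF.
Qed.

End tails.

(** * Extraction of a subsequence converging at every scale *)

Section extraction.
Context {R : realType} {N : nat}.
Local Notation V := 'rV[R]_N.

(** Enumerates the rational vectors; an index that codes none of them gives the origin. *)
Definition rational_point (m : nat) : V :=
  if unpickle m is Some v then map_mx ratr (v : 'rV[rat]_N) else 0.

Lemma rational_point_dense (x : V) (d : R) : 0 < d ->
  exists m, \sum_i `|x ord0 i - rational_point m ord0 i| <= d.
Proof.
move=> d0; pose d' := d / (N%:R + 1).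
have d'0 : 0 < d' by rewrite divr_gt0// ltr_wpDl.
have /choice[v hv] : forall i : 'I_N, exists v : rat, `|x ord0 i - ratr v| <= d'.
  move=> i.
  have [s] : exists s : rat, ratr s \in `](x ord0 i), (x ord0 i + d')[.
    by apply: rat_in_itvoo; rewrite ltrDl.
  rewrite in_itv/= => /andP[h1 h2]; exists s.
  by rewrite ler_norml; apply/andP; split; lra.
exists (pickle (\row_i v i : 'rV[rat]_N)); rewrite /rational_point pickleK.
apply: (@le_trans _ _ (\sum_(i < N) d')).
  by apply: ler_sum => i _; rewrite !mxE.
rewrite sumr_const card_ord -mulr_natr /d' mulrAC ler_pdivrMr ?ltr_wpDl//.
by rewrite ler_wpM2l ?(ltW d0)// lerDl.
Qed.

Import ArrowAsProduct.

(* A cluster point of the sequence in a product of segments; equicontinuity turns closeness at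
   finitely many rational points into pointwise convergence. *)
Lemma equilipschitz_extraction (f : nat -> nat -> V -> R) (A L : nat -> R) :
  (forall j, 0 <= L j) ->
  (forall n j x, `|f n j x| <= A j) ->
  (forall n j (x z : V), `|f n j (x + z) - f n j x| <= L j * \sum_i `|z ord0 i|) ->
  exists k : nat -> nat, {homo k : m n / (m < n)%N} /\
    exists G : nat -> V -> R, forall j x, (fun l => f (k l) j x) @ \oo --> G j x.
Proof.
move=> L0 fA fL.
pose I := (nat * V)%type.
pose seqf (n : nat) : (I -> R) := fun i => f n i.1 i.2.
have cpt := @tychonoff I (fun=> R) (fun i => `[- A i.1, A i.1]%classic) (fun i => @segment_compact R _ _).
have pf : ProperFilter ((seqf : nat -> (I -> R)) @ \oo) by exact: fmap_proper_filter.
have inA n i : `[- A i.1, A i.1]%classic (seqf n i) by rewrite /= in_itv/= -ler_norml fA.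
have inF : ((seqf : nat -> (I -> R)) @ \oo) [set g | (forall i : I, `[- A i.1, A i.1]%classic (g i))].
  by exists 0%N => // n _ i; exact: inA.
(* A product over an uncountable index set need not be sequentially compact, so only a cluster point
   is available here. *)
have [G [_ clG]] := cpt _ pf inF.
have close (n0 : nat) (s : seq I) (e : R) : 0 < e -> exists2 n, (n0 <= n)%N &
    forall i, i \in s -> `|G i - f n i.1 i.2| < e.
  move=> e0.
  have nG : nbhs G [set g : I -> R | forall i, i \in s -> `|G i - g i| < e].
    elim: s => [|i s IH]; first by apply: filterS filterT => g _ i.
    have hi : nbhs G [set g : I -> R | `|G i - g i| < e].
      have /cvgrPdist_lt := @proj_continuous I (fun=> R) i G.
      exact.
    apply: filterS2 hi IH => g h1 h2 i'; rewrite inE => /orP[/eqP ->//|]; exact: h2.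
  have Fn : ((seqf : nat -> (I -> R)) @ \oo) [set g | exists2 n, (n0 <= n)%N & g = seqf n].
    by exists n0 => // n /= n0n; exists n.
  by have [g [[n n0n ->] h]] := clG _ _ Fn nG; exists n.
(* Step [l] imposes closeness at the first [l + 1] scales and rational points, so every pair is
   covered from some step on. *)
pose pts (l : nat) : seq I := [seq (j, rational_point m) | j <- iota 0 l.+1, m <- iota 0 l.+1].
have inv0 (l : nat) : 0 < l.+1%:R^-1 :> R by rewrite invr_gt0.
have /choice[sel hsel] : forall ln : nat * nat, exists n, (ln.2 <= n)%N /\
    forall i, i \in pts ln.1 -> `|G i - f n i.1 i.2| < ln.1.+1%:R^-1.
  move=> [l n0].
  by have [n h1 h2] := close n0 (pts l) _ (inv0 l); exists n.
pose k := fix k (l : nat) := if l is l'.+1 then sel (l, (k l').+1) else sel (0%N, 0%N).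
have kS l : (k l < k l.+1)%N by have [] := hsel (l.+1, (k l).+1).
have kclose l i : i \in pts l -> `|G i - f (k l) i.1 i.2| < l.+1%:R^-1.
  by case: l => [|l]; [have [_] := hsel (0%N, 0%N)|have [_] := hsel (l.+1, (k l).+1)]; exact.
exists k; split; first exact: homo_ltn ltn_trans kS.
have krat j m : \forall l \near \oo, `|G (j, rational_point m) - f (k l) j (rational_point m)| < l.+1%:R^-1.
  exists (maxn j m) => // l /=; rewrite geq_max => /andP[jl ml].
  apply: (kclose l (j, rational_point m)); apply: allpairs_f; by rewrite mem_iota/= add0n ltnS.
have cinv (e : R) : 0 < e -> \forall l \near \oo, l.+1%:R^-1 < e :> R.
  by move=> e0; exact: (cvgr_lt (0:R) (@cvg_harmonic R) e e0).
have cau j x : cvgn (fun l => f (k l) j x).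
  apply/cauchy_cvgP; apply/cauchy_ballP => e e0.
  have e40 : 0 < e / 4 / (L j + 1) by rewrite !divr_gt0// ltr_wpDl.
  have [m hm] := rational_point_dense x e40.
  have Lm : L j * \sum_i `|x ord0 i - rational_point m ord0 i| <= e / 4.
    apply: (le_trans (ler_wpM2l (L0 j) hm)); rewrite mulrCA ler_piMr ?divr_ge0 ?(ltW e0)//.
    by rewrite ler_pdivrMr ?ltr_wpDl// mul1r lerDl.
  have lip n : `|f n j x - f n j (rational_point m)| <= e / 4.
    apply: le_trans Lm; have := fL n j (rational_point m) (x - rational_point m).
    rewrite (addrC (rational_point m)) subrK => /le_trans; apply; rewrite ler_wpM2l//.
    by apply: ler_sum => i _; rewrite !mxE.
  have e8 : 0 < e / 4 by rewrite divr_gt0.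
  have near1 : \forall l \near \oo, `|G (j, rational_point m) - f (k l) j x| < e / 2.
    apply: filterS2 (krat j m) (cinv _ e8) => l h1 h2.
    have h3 := lip (k l); rewrite distrC in h3.
    have -> : G (j, rational_point m) - f (k l) j x =
      (G (j, rational_point m) - f (k l) j (rational_point m)) + (f (k l) j (rational_point m) - f (k l) j x) by ring.
    by have h12 := lt_trans h1 h2; clear h1 h2; apply: (le_lt_trans (ler_normD _ _)); lra.
  near=> a b; rewrite /ball /=.
  have ha : `|G (j, rational_point m) - a| < e / 2 by near: a; exact: near1.
  have hb : `|G (j, rational_point m) - b| < e / 2 by near: b; exact: near1.
  have -> : a - b = (a - G (j, rational_point m)) + (G (j, rational_point m) - b) by ring.
  by apply: (le_lt_trans (ler_normD _ _)); rewrite distrC; lra.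
exists (fun j x => limn (fun l => f (k l) j x)) => j x.
exact: cau.
Unshelve. all: by end_near. Qed.

End extraction.

(** * Weighted limits and norms as integrals *)

Section weighted_limits.
Context d (T : measurableType d) (R : realType) (mu : {measure set T -> \bar R}).

Lemma fatou_weighted (f_ : nat -> T -> R) (f w : T -> R) (s : R) (K : \bar R) : 0 < s ->
  (forall n, measurable_fun setT (f_ n)) -> measurable_fun setT f -> measurable_fun setT w ->
  (forall x, 0 <= w x) -> {ae mu, forall x, (fun n => f_ n x) @ \oo --> f x} ->
  (forall n, (\int[mu]_x (`|f_ n x| `^ s * w x)%:E <= K)%E) ->
  (\int[mu]_x (`|f x| `^ s * w x)%:E <= K)%E.
Proof.
move=> s0 mf_ mf mw w0 cf fK; apply: (@fatou_bound _ _ _ mu (fun n x => `|f_ n x| `^ s * w x)) => //.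
- by move=> n; apply: measurable_funM => //; exact: measurable_powR_norm.
- by apply: measurable_funM => //; exact: measurable_powR_norm.
- by move=> n x; rewrite mulr_ge0 ?powR_ge0.
- by move=> x; rewrite mulr_ge0 ?powR_ge0.
- by apply: filterS cf => x fx; apply: cvgM; [exact: cvg_powR_norm|exact: cvg_cst].
Qed.

Lemma int_of_Lnorm (f : T -> R) (s : R) : s != 0 ->
  (\int[mu]_x (`|f x| `^ s)%:E = 'N[mu]_s%:E [EFin \o f] `^ s)%E.
Proof. by move=> s0; rewrite poweR_Lnorm//; apply: eq_integral => x _ /=; rewrite poweR_EFin. Qed.

Lemma le_poweR (a b : \bar R) (s : R) : 0 <= s -> (0 <= a)%E -> (a <= b)%E -> (a `^ s <= b `^ s)%E.
Proof.
move=> s0 a0 ab; apply: gt0_ler_poweR => //; rewrite in_itv/= ?a0 ?leey//.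
by rewrite (le_trans a0 ab).
Qed.

Lemma int_of_Lnorm_le (f : T -> R) (s M : R) : 0 < s -> 0 <= M ->
  ('N[mu]_s%:E [EFin \o f] <= M%:E)%E -> (\int[mu]_x (`|f x| `^ s)%:E <= (M `^ s)%:E)%E.
Proof.
move=> s0 M0 fM; rewrite int_of_Lnorm ?gt_eqF// -poweR_EFin.
by apply: le_poweR => //; [exact: ltW|exact: Lnorm_ge0].
Qed.

Lemma Lfun_int (f : T -> R) (s : R) : 0 < s -> f \in Lfun mu s%:E ->
  measurable_fun setT f /\ (\int[mu]_x (`|f x| `^ s)%:E < +oo)%E.
Proof.
move=> s0; rewrite inE => /andP[]; rewrite !inE => mf ff; split => //.
by rewrite int_of_Lnorm ?gt_eqF//; exact: poweR_lty.
Qed.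

End weighted_limits.

(** * The exponent and the continuous embedding *)

Section embedding.
Context {R : realType} {N : nat}.
Local Notation V := 'rV[R]_N.
Local Notation leb := (measure_function_SigmaFiniteMeasure__to__measure_function_Measure (lebesgue_rV R N)).
Variables (p q sigma : R).
Hypotheses (p1 : 1 < p) (pN : p < N%:R) (q1 : 1 < q) (qN : 2 * q < N%:R) (pq : p <> q)
  (sp : p < sigma) (sq : sigma < 2 * q) (crit : N%:R * (p - q) < p * q).
Let r : R := (p * q + sigma * (q - p)) / (2 * q - p).
Let t : R := (sigma - p) / (2 * q - p).

Let d0 : 0 < 2 * q - p. Proof. by rewrite subr_gt0 (lt_trans sp sq). Qed.
Let t0 : 0 < t. Proof. by rewrite divr_gt0// subr_gt0. Qed.
Let t1 : t < 1. Proof. by rewrite /t ltr_pdivrMr// mul1r ltrD2r. Qed.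
Let p0 : 0 < p. Proof. exact: lt_trans ltr01 p1. Qed.
Let q0 : 0 < q. Proof. exact: lt_trans ltr01 q1. Qed.
Let rE : r = p + (q - p) * t.
Proof. by rewrite /r /t; field; rewrite gt_eqF. Qed.
Lemma critical_r_ge1 : 1 <= r.
Proof.
have -> : r = 1 + ((p - 1) * (1 - t) + (q - 1) * t) by rewrite rE; ring.
by rewrite lerDl addr_ge0// mulr_ge0// ?subr_ge0// ltW.
Qed.

Let r0 : 0 < r. Proof. exact: lt_le_trans ltr01 critical_r_ge1. Qed.

(** With denominators cleared both differences contain the factor [p q - N (p - q)], multiplied by
    [sigma - p] and by [2 q - sigma] respectively. *)
Lemma critical_r_bounds : hardy_sobolev1 N sigma p < r < hardy_sobolev2 N sigma q.
Proof.
have K0 : 0 < p * q - N%:R * (p - q) by rewrite subr_gt0.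
have np : 0 < N%:R - p by rewrite subr_gt0.
have nq : 0 < N%:R - 2 * q by rewrite subr_gt0.
rewrite /hardy_sobolev1 /hardy_sobolev2; apply/andP; split.
  rewrite ltr_pdivrMr// /r mulrAC ltr_pdivlMr// -subr_gt0.
  have -> : (p * q + sigma * (q - p)) * (N%:R - p) - p * (N%:R - sigma) * (2 * q - p) =
    (sigma - p) * (p * q - N%:R * (p - q)) by ring.
  by rewrite mulr_gt0// subr_gt0.
rewrite ltr_pdivlMr// /r mulrAC ltr_pdivrMr// -subr_gt0.
have -> : q * (N%:R - sigma) * (2 * q - p) - (p * q + sigma * (q - p)) * (N%:R - 2 * q) =
  (2 * q - sigma) * (p * q - N%:R * (p - q)) by ring.
by rewrite mulr_gt0// subr_gt0.
Qed.

(** Compare the ratio [Y] of the two integrands with [Z]: below, [Y^t <= Z^t] is used in [ratio_p];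
    above, [Y^(t-1) <= Z^(t-1)] in [ratio_q]. The free parameter weighs Hardy against Rellich. *)
Lemma interpolation (U L Z : R) : 0 <= U -> 0 <= L -> 0 < Z ->
  U `^ r * L `^ (- sigma) <= Z `^ t * (U `^ p * L `^ (- p)) + Z `^ (t - 1) * (U `^ q * L `^ (- (2 * q))).
Proof.
move=> U0 L0 Z0.
have h1 : 0 <= Z `^ t * (U `^ p * L `^ (- p)) by rewrite !mulr_ge0 ?powR_ge0.
have h2 : 0 <= Z `^ (t - 1) * (U `^ q * L `^ (- (2 * q))) by rewrite !mulr_ge0 ?powR_ge0.
move: U0; rewrite le_eqVlt => /orP[/eqP <-|U0].
  by rewrite [X in X * _ <= _]powR0 ?gt_eqF// mul0r addr_ge0 ?mulr_ge0 ?powR_ge0.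
move: L0; rewrite le_eqVlt => /orP[/eqP <-|L0].
  by rewrite [X in _ * X <= _]powR0 ?mulr0 ?addr_ge0 ?mulr_ge0 ?powR_ge0// oppr_eq0 gt_eqF// (lt_trans p0).
have Y0 : 0 < U `^ (q - p) * L `^ (p - 2 * q) by rewrite mulr_gt0// powR_gt0.
have t10 : 0 <= 1 - t by rewrite subr_ge0 ltW.
have [YZ|ZY] := leP (U `^ (q - p) * L `^ (p - 2 * q)) Z.
  rewrite (ratio_p sp sq U0 L0) mulrC; apply: le_trans (_ : _ <= Z `^ t * (U `^ p * L `^ (- p))) _.
    rewrite ler_wpM2r ?mulr_ge0 ?powR_ge0//.
    by apply: (@ge0_ler_powR _ t (ltW t0)); rewrite ?nnegrE ?(ltW Y0) ?(ltW Z0).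
  by rewrite lerDl.
rewrite (ratio_q sp sq U0 L0) mulrC; apply: le_trans (_ : _ <= Z `^ (t - 1) * (U `^ q * L `^ (- (2 * q)))) _.
  rewrite ler_wpM2r ?mulr_ge0 ?powR_ge0// -/t -[t - 1]opprB !powRN lef_pV2 ?posrE ?powR_gt0 ?mulr_gt0 ?powR_gt0//.
  by apply: (@ge0_ler_powR _ (1 - t) t10); rewrite ?nnegrE ?(ltW Y0) ?(ltW Z0) ?(ltW ZY).
by rewrite lerDr.
Qed.

Lemma measurable_weighted (v : V -> R) (s a : R) : measurable_fun setT v ->
  measurable_fun setT (fun x => `|v x| `^ s * enorm x `^ a).
Proof. by move=> mv; exact: (measurable_funM (measurable_powR_norm s mv) (measurable_enorm_powR a)). Qed.

Lemma int_interpolation (v : V -> R) (Z A B : R) : measurable_fun setT v -> 0 < Z ->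
  (\int[leb]_x (`|v x| `^ p * enorm x `^ (- p))%:E <= A%:E)%E ->
  (\int[leb]_x (`|v x| `^ q * enorm x `^ (- (2 * q)))%:E <= B%:E)%E ->
  (\int[leb]_x (`|v x| `^ r * enorm x `^ (- sigma))%:E <= (Z `^ t * A + Z `^ (t - 1) * B)%:E)%E.
Proof.
move=> mv Z0 hA hB.
have m1 := measurable_weighted p (- p) mv; have m2 := measurable_weighted q (- (2 * q)) mv.
have n0 (s a : R) x : 0 <= `|v x| `^ s * enorm x `^ a by rewrite mulr_ge0 ?powR_ge0.
apply: (@le_trans _ _ (\int[leb]_x (Z `^ t * (`|v x| `^ p * enorm x `^ (- p)) +
   Z `^ (t - 1) * (`|v x| `^ q * enorm x `^ (- (2 * q))))%:E)%E).
  apply: le_int; first exact: measurable_weighted.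
  - by apply: measurable_funD; exact: measurable_funM.
  - by move=> x; exact: n0.
  - by move=> x; apply: interpolation => //; exact: enorm_ge0.
rewrite intD; last 4 first.
- exact: measurable_funM.
- exact: measurable_funM.
- by move=> x; rewrite mulr_ge0 ?powR_ge0.
- by move=> x; rewrite mulr_ge0 ?powR_ge0.
rewrite (intZ leb m1 (n0 _ _) (powR_ge0 _ _)) (intZ leb m2 (n0 _ _) (powR_ge0 _ _)) EFinD !EFinM.
by apply: leeD; apply: lee_wpmul2l; rewrite ?lee_fin ?powR_ge0.
Qed.

Lemma W_energy (u : V -> R) (M : R) : W p q u -> 0 <= M -> (Wnorm p q u <= M%:E)%E ->
  energy p q (N%:R * M `^ p) (M `^ q) u (fun i => weak_partials [:: i] u)
    (fun i => weak_partials [:: i; i] u).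
Proof.
move=> [[u1 wg ug] [u2 wh uh]] M0 uM.
have wp (s : seq 'I_N) : has_weak_partials s u -> is_weak_partials s u (weak_partials s u).
  by move=> hs; exact: (xgetPex _ hs).
have wg' i := wp _ (wg i); have wh' i := wp _ (wh i i).
(* Local integrability of [u] is read off from a weak derivative, so one index is required; it
   exists since [0 < p < N]. *)
have i0 : 'I_N by apply: (@Ordinal N 0); rewrite -(ltr_nat R) (lt_trans p0 pN).
have lu : loc_integrable u by case: (wg' i0).
have mg i : measurable_fun setT (weak_partials [:: i] u) by have [_ []] := wg' i.
have nM1 : ('N[leb]_(p%:E) [EFin \o (enorm \o weak_grad u)] <= M%:E)%E.
  by apply: le_trans uM; rewrite leeDl// Lnorm_ge0.
have nM2 : ('N[leb]_(q%:E) [EFin \o weak_laplacian u] <= M%:E)%E.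
  by apply: le_trans uM; rewrite leeDr// Lnorm_ge0.
split=> //; split => //.
- by have [_] := Lfun_int (lt_trans ltr01 (sobolev1_gt1 p1 pN)) u1.
- by have [_] := Lfun_int (lt_trans ltr01 (sobolev2_gt1 q1 qN)) u2.
split.
  have h := int_of_Lnorm_le p0 M0 nM1.
  have [men _] := Lfun_int p0 ug.
  apply: (@le_trans _ _ (\sum_(i < N) (M `^ p)%:E)%E).
    apply: lee_sum => i _; apply: le_trans h; apply: le_int.
    - exact: measurable_powR_norm.
    - exact: measurable_powR_norm.
    - by move=> x; exact: powR_ge0.
    move=> x; apply: ge0_ler_powR; rewrite ?nnegrE ?(ltW p0)//.
    rewrite [leRHS]ger0_norm ?enorm_ge0//= /enorm -sqrtr_sqr ler_sqrt; last first.
      by apply: sumr_ge0 => j _; exact: sqr_ge0.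
    rewrite (bigD1 i)//= mxE lerDl; apply: sumr_ge0 => j _; exact: sqr_ge0.
  by rewrite sumEFin sumr_const card_ord mulr_natl.
have h := int_of_Lnorm_le q0 M0 nM2; apply: le_trans h.
rewrite le_eqVlt; apply/orP; left; apply/eqP; apply: eq_integral => x _.
rewrite /weak_laplacian /mxtrace; congr (`|_| `^ _)%:E.
by apply: eq_bigr => i _; rewrite mxE.
Qed.

Lemma energy_limit_bounds (M M2 : R) (u : V -> R) g h : energy p q M M2 u g h -> 0 <= M ->
  (\int[leb]_x (`|u x| `^ p * enorm x `^ (- p))%:E <= (hardy_const (N := N) p * M)%:E)%E /\
  (\int[leb]_x (`|u x| `^ q * enorm x `^ (- (2 * q)))%:E <= (rellich_const (N := N) q * M2)%:E)%E.
Proof.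
move=> En M0; have [ae _] := molj_ae p1 En M0; have [lu _] := En.
have mu : measurable_fun setT u by case: lu.
have mj j : measurable_fun setT (molj j u).
  by apply: continuous_measurable_rV; exact: continuous_molj.
split.
- apply: (fatou_weighted p0 mj mu (measurable_enorm_powR _) (fun x => powR_ge0 _ _) ae).
  exact: molj_hardy0 En.
- apply: (fatou_weighted q0 mj mu (measurable_enorm_powR _) (fun x => powR_ge0 _ _) ae).
  exact: molj_rellich0 En.
Qed.

Definition embedding_const : R := hardy_const (N := N) p * N%:R + rellich_const (N := N) q.

Lemma embedding_const_ge0 : 0 <= embedding_const.
Proof.
have hc0 : 0 <= hardy_const (N := N) p.
  by rewrite /hardy_const divr_ge0 ?mulr_ge0 ?powR_ge0 ?subr_ge0 ?(ltW p0) ?(ltW pN)// divr_ge0// subr_ge0 ltW.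
have rc0 : 0 <= rellich_const (N := N) q.
  by rewrite /rellich_const divr_ge0// mulr_ge0 ?powR_ge0 ?subr_ge0 ?(ltW q0) ?(ltW q1) ?(ltW qN).
by rewrite addr_ge0// mulr_ge0.
Qed.

(* With [Z = M^(q-p)] both terms of the interpolation scale like [M^r]. *)
Lemma W_wLnorm_le (u : V -> R) (M : R) : W p q u -> 0 < M -> (Wnorm p q u <= M%:E)%E ->
  (wLnorm r sigma u <= (embedding_const `^ r^-1 * M)%:E)%E.
Proof.
move=> Wu M0 uM; have En := W_energy Wu (ltW M0) uM.
have NM0 : 0 <= N%:R * M `^ p by rewrite mulr_ge0 ?powR_ge0.
have [hA hB] := energy_limit_bounds En NM0.
have mu : measurable_fun setT u by case: En => -[].
have Z0 : 0 < M `^ (q - p) by rewrite powR_gt0.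
have h := int_interpolation mu Z0 hA hB.
have e1 : (M `^ (q - p)) `^ t * (hardy_const (N := N) p * (N%:R * M `^ p)) +
   (M `^ (q - p)) `^ (t - 1) * (rellich_const (N := N) q * M `^ q) = embedding_const * M `^ r.
  rewrite -!powRrM.
  have -> : M `^ r = M `^ ((q - p) * t) * M `^ p.
    by rewrite -powRD ?(gt_eqF M0) ?implybT// rE addrC.
  have e2 : M `^ ((q - p) * (t - 1)) * M `^ q = M `^ ((q - p) * t) * M `^ p.
    by rewrite -!powRD ?(gt_eqF M0) ?implybT//; congr (_ `^ _); ring.
  rewrite [X in _ + X]mulrCA e2 /embedding_const.
  by move: (hardy_const p) (rellich_const q) => a b; ring.
rewrite e1 in h; rewrite /wLnorm.
have -> : embedding_const `^ r^-1 * M = (embedding_const * M `^ r) `^ r^-1.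
  rewrite powRM ?embedding_const_ge0 ?powR_ge0// -powRrM divff ?gt_eqF// powRr1// ltW//.
rewrite -poweR_EFin; apply: le_poweR => //; first by rewrite invr_ge0 ltW.
by apply: integral_ge0 => x _; rewrite lee_fin mulr_ge0 ?powR_ge0.
Qed.

(** [Wnorm] involves the Laplacian whereas [D2] controls the Hessian; the trace is at most [N] times
    the Hilbert-Schmidt norm. *)
Lemma W_fin (u : V -> R) : W p q u -> exists2 M : R, 0 < M & (Wnorm p q u <= M%:E)%E.
Proof.
move=> [[_ _ ug] [_ wh uh]].
have wp (s : seq 'I_N) : has_weak_partials s u -> is_weak_partials s u (weak_partials s u).
  by move=> hs; exact: (xgetPex _ hs).
have mh i : measurable_fun setT (weak_partials [:: i; i] u) by have [_ []] := wp _ (wh i i).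
have [mhs hsoo] := Lfun_int q0 uh.
have lapE : weak_laplacian u = (fun x => \sum_i weak_partials [:: i; i] u x).
  by apply/funext => x; rewrite /weak_laplacian /mxtrace; apply: eq_bigr => i _; rewrite mxE.
have mlap : measurable_fun setT (weak_laplacian u) by rewrite lapE; exact: measurable_sum.
have lap_le x : `|weak_laplacian u x| <= N%:R * `|hsnorm (weak_hess u x)|.
  rewrite /weak_laplacian /mxtrace; apply: le_trans (ler_norm_sum _ _ _) _.
  have -> : N%:R * `|hsnorm (weak_hess u x)| = \sum_(i < N) `|hsnorm (weak_hess u x)|.
    by rewrite sumr_const card_ord mulr_natl.
  apply: ler_sum => i _; rewrite [leRHS]ger0_norm ?sqrtr_ge0// /hsnorm -sqrtr_sqr ler_sqrt; last first.
    by apply: sumr_ge0 => j _; apply: sumr_ge0 => k _; exact: sqr_ge0.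
  rewrite (bigD1 i)//= (bigD1 i)//= -addrA lerDl addr_ge0//.
    by apply: sumr_ge0 => j _; exact: sqr_ge0.
  by apply: sumr_ge0 => j _; apply: sumr_ge0 => k _; exact: sqr_ge0.
have N2 : ('N[leb]_(q%:E) [EFin \o weak_laplacian u] < +oo)%E.
  apply: (@lty_poweRy _ _ q); first by rewrite gt_eqF.
  rewrite -int_of_Lnorm ?gt_eqF//.
  apply: (@le_lt_trans _ _ (\int[leb]_x (N%:R `^ q * `|hsnorm (weak_hess u x)| `^ q)%:E)%E).
    apply: le_int.
    - exact: measurable_powR_norm.
    - by apply: measurable_funM => //; exact: measurable_powR_norm mhs.
    - by move=> x; exact: powR_ge0.
    - by move=> x; rewrite -powRM//; apply: ge0_ler_powR; rewrite ?nnegrE ?mulr_ge0 ?(ltW q0).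
  rewrite (intZ leb (measurable_powR_norm q mhs) (fun x => powR_ge0 _ _) (powR_ge0 _ _)).
  by rewrite lte_mul_pinfty ?lee_fin ?powR_ge0.
have N1 : ('N[leb]_(p%:E) [EFin \o (enorm \o weak_grad u)] < +oo)%E.
  by move: ug; rewrite inE => /andP[_]; rewrite !inE.
have Wn : (Wnorm p q u < +oo)%E by rewrite /Wnorm lte_add_pinfty.
have W0 : (0 <= Wnorm p q u)%E by rewrite /Wnorm adde_ge0// Lnorm_ge0.
exists (fine (Wnorm p q u) + 1); first by rewrite ltr_wpDl// fine_ge0.
by rewrite EFinD fineK ?ge0_fin_numE// leeDl.
Qed.

Lemma W_sub_wL : W p q `<=` @wL R N r sigma.
Proof.
move=> u Wu; have [M M0 uM] := W_fin Wu; split; first by case: (W_energy Wu (ltW M0) uM) => -[].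
exact: le_lt_trans (W_wLnorm_le Wu M0 uM) (ltry _).
Qed.

Lemma W_wLnorm_bound : exists C : R, forall u : V -> R, W p q u ->
  (wLnorm r sigma u <= C%:E * Wnorm p q u)%E.
Proof.
exists (embedding_const `^ r^-1) => u Wu; have [M M0 uM] := W_fin Wu.
have W0 : (0 <= Wnorm p q u)%E by rewrite /Wnorm adde_ge0// Lnorm_ge0.
have Wf : Wnorm p q u \is a fin_num by rewrite ge0_fin_numE// (le_lt_trans uM (ltry _)).
set C := embedding_const `^ r^-1; have C0 : 0 <= C by exact: powR_ge0.
apply/lee_addgt0Pr => e e0.
have C10 : 0 < C + 1 by rewrite ltr_wpDl.
(* [Wnorm p q u] may be zero while [W_wLnorm_le] takes a positive bound; the slack added here costs
   at most [e] in the end. *)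
pose M' := fine (Wnorm p q u) + e / (C + 1).
have M'0 : 0 < M' by rewrite ltr_wpDl ?fine_ge0// divr_gt0.
have uM' : (Wnorm p q u <= M'%:E)%E.
  by rewrite /M' EFinD fineK// leeDl// lee_fin divr_ge0 ?(ltW e0) ?(ltW C10).
apply: (le_trans (W_wLnorm_le Wu M'0 uM')).
rewrite -(fineK Wf) -EFinM -EFinD lee_fin /M' mulrDr lerD2l mulrCA ler_piMr ?(ltW e0)//.
by rewrite ler_pdivrMr// mul1r lerDl.
Qed.

End embedding.

(** * Compactness of the embedding *)

Section compactness.
Context {R : realType} {N : nat}.
Local Notation V := 'rV[R]_N.
Local Notation leb := (measure_function_SigmaFiniteMeasure__to__measure_function_Measure (lebesgue_rV R N)).
Variables (p q sigma : R).
Hypotheses (p1 : 1 < p) (pN : p < N%:R) (q1 : 1 < q) (qN : 2 * q < N%:R) (pq : p <> q)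
  (sp : p < sigma) (sq : sigma < 2 * q) (crit : N%:R * (p - q) < p * q).
Let r : R := (p * q + sigma * (q - p)) / (2 * q - p).
Let t : R := (sigma - p) / (2 * q - p).

Let d0 : 0 < 2 * q - p. Proof. by rewrite subr_gt0 (lt_trans sp sq). Qed.
Let t1 : t < 1. Proof. by rewrite /t ltr_pdivrMr// mul1r ltrD2r. Qed.
Let p0 : 0 < p. Proof. exact: lt_trans ltr01 p1. Qed.
Let q0 : 0 < q. Proof. exact: lt_trans ltr01 q1. Qed.
Let r0 : 0 < r. Proof. exact: lt_le_trans ltr01 (critical_r_ge1 p1 q1 sp sq). Qed.

Lemma root_le (a b : R) : 0 <= a -> a `^ p <= b -> a <= b `^ p^-1.
Proof.
move=> a0 ab; have -> : a = (a `^ p) `^ p^-1 by rewrite -powRrM divff ?gt_eqF// powRr1.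
by apply: ge0_ler_powR; rewrite ?nnegrE ?powR_ge0 ?invr_ge0 ?(ltW p0)// (le_trans _ ab) ?powR_ge0.
Qed.

Section bounded_sequence.
Variables (M M2 C : R) (u : nat -> V -> R) (g h : nat -> 'I_N -> V -> R).
Hypotheses (M0 : 0 <= M) (C0 : 0 <= C) (En : forall n, energy p q M M2 (u n) (g n) (h n))
  (tm : forall n j, tame p q C (molj j (u n))).

Let f n j := molj j (u n).

Let lu n : loc_integrable (u n). Proof. by case: (En n). Qed.
Let mu n : measurable_fun setT (u n). Proof. by case: (lu n). Qed.
Let cf n j : continuous (f n j). Proof. exact: continuous_molj. Qed.
Let mf n j : measurable_fun setT (f n j). Proof. exact: continuous_measurable_rV (@cf n j). Qed.

Let A (j : nat) : R := (mollifier_bound (R := R) (N := N) / (4 ^- j) ^+ N * (N%:R + 1) `^ (p / 2) * (4 ^- j) `^ p *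
       (hardy_const (N := N) p * M)) `^ p^-1.
Let L (j : nat) : R := (mollifier_bound (R := R) (N := N) / (4 ^- j) ^+ N * M) `^ p^-1.

Let fA n j x : `|f n j x| <= A j.
Proof.
have hm := (molj_sup p1 pN (En n) j x).
by apply: root_le => //.
Qed.

Let fL n j (x z : V) : `|f n j (x + z) - f n j x| <= L j * \sum_i `|z ord0 i|.
Proof.
apply: (lipschitz_coord (is_derive_molj (En n) j)) => i y.
have hm := (molj_partial_sup p1 (En n) j i y).
by apply: root_le => //.
Qed.

Let K : R := approx_const (N := N) p * M.

Let K0 : 0 <= K.
Proof. by rewrite !mulr_ge0 ?powR_ge0 ?exprn_ge0 ?powR_ge0. Qed.

(** One subsequence serves all scales. By Fatou the limits [G j] inherit the rate of [molj_cauchy],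
    so [riesz_fischer] applies to them and yields [v]. *)
Lemma bounded_sequence_limit : exists k : nat -> nat, {homo k : m n / (m < n)%N} /\
  exists G : nat -> V -> R, exists v : V -> R,
  [/\ (forall j x, (fun l => f (k l) j x) @ \oo --> G j x),
      (forall j, measurable_fun setT (G j)), measurable_fun setT v,
      {ae leb, forall x, (fun j => G j x) @ \oo --> v x} &
      forall j, (\int[leb]_x (`|G j x - v x| `^ p)%:E <= (K * ((4 ^+ j)^-1) `^ p)%:E)%E].
Proof.
have L0 j : 0 <= L j by exact: powR_ge0.
have [k [hk [G fG]]] := equilipschitz_extraction L0 fA fL.
have mG j : measurable_fun setT (G j).
  by apply: (@measurable_fun_cvg _ _ _ _ (fun l => f (k l) j)) => // x _; exact: fG.
have Gc j l : (j <= l)%N -> (\int[leb]_x (`|G j x - G l x| `^ p)%:E <= (K * ((4 ^+ j)^-1) `^ p)%:E)%E.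
  move=> jl; apply: (@fatou_bound _ _ _ leb (fun n x => `|f (k n) j x - f (k n) l x| `^ p)).
  - by move=> n; exact: (measurable_powR_norm p (measurable_funB (mf (k n) j) (mf (k n) l))).
  - exact: (measurable_powR_norm p (measurable_funB (mG j) (mG l))).
  - by move=> n x; exact: powR_ge0.
  - by move=> x; exact: powR_ge0.
  - by apply: aeW => x; apply: cvg_powR_norm => //; apply: cvgB; exact: fG.
  - by move=> n; exact: (molj_cauchy p1 (En (k n)) M0 jl).
have [v [mv cv vC]] := @riesz_fischer R _ _ leb G p K p0 K0 mG Gc.
by exists k; split => //; exists G, v.
Qed.

Section limit.
Variables (k : nat -> nat) (G : nat -> V -> R) (v : V -> R).
Hypotheses (fG : forall j x, (fun l => f (k l) j x) @ \oo --> G j x)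
  (mG : forall j, measurable_fun setT (G j)) (mv : measurable_fun setT v)
  (Gv : {ae leb, forall x, (fun j => G j x) @ \oo --> v x})
  (vC : forall j, (\int[leb]_x (`|G j x - v x| `^ p)%:E <= (K * ((4 ^+ j)^-1) `^ p)%:E)%E).

(** Fatou's lemma is applied directly in [j] for each [u n], and twice for [v]: from [f (k l) j] to
    [G j], then from [G j] to [v]. *)
Lemma limit_bound (s : R) (w : V -> R) (B : \bar R) : 0 < s -> measurable_fun setT w -> (forall x, 0 <= w x) ->
  (forall n j, (\int[leb]_x (`|f n j x| `^ s * w x)%:E <= B)%E) ->
  (forall n, (\int[leb]_x (`|u n x| `^ s * w x)%:E <= B)%E) /\ (\int[leb]_x (`|v x| `^ s * w x)%:E <= B)%E.
Proof.
move=> s0 mw w0 fB; split.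
  move=> n; have [ae _] := molj_ae p1 (En n) M0.
  exact: (fatou_weighted s0 (mf n) (mu n) mw w0 ae (fB n)).
apply: (fatou_weighted s0 mG mv mw w0 Gv) => j.
apply: (fatou_weighted s0 (fun n => mf (k n) j) (mG j) mw w0 _ (fun n => fB (k n) j)).
by apply: aeW => x; exact: fG.
Qed.

Let GA j x : `|G j x| <= A j.
Proof.
have h1 : (fun l => `|f (k l) j x|) @ \oo --> `|G j x| by apply: cvg_norm; exact: fG.
rewrite -(cvg_lim (@Rhausdorff R) h1); apply: limr_le; last by apply: nearW => l; exact: fA.
by apply/cvg_ex; eexists; exact: h1.
Qed.

(** [u (k l) - v] is split at [f (k l) j] and [G j]. The two outer errors are small for large [j]
    uniformly in [l]; with [j] fixed, the middle one is bounded by [2 * A j] on the cube and tends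
    to zero. *)
Lemma local_convergence (S eta : R) : 0 < eta ->
  \forall l \near \oo, (\int[leb]_x (`|u (k l) x - v x| `^ p * \1_(cube 0 S) x)%:E <= eta%:E)%E.
Proof.
move=> eta0; pose c : R := 2 `^ p; have c0 : 0 < c by rewrite powR_gt0.
have mI : measurable_fun setT (\1_(cube (0 : V) S) : V -> R) by apply: measurable_indic; exact: measurable_cube.
have I01 x : 0 <= (\1_(cube (0 : V) S) x : R) <= 1 by rewrite indicE; case: (_ \in _); rewrite ?lexx ?ler01.
(* The factors [c] and [c * c] come from two successive uses of [powR_add_le]. *)
pose D := (c + c * c) * K + 1.
have D0 : 0 < D by rewrite ltr_wpDl// mulr_ge0// addr_ge0 ?mulr_ge0// ltW.
have [j hj] : exists j : nat, ((4 ^+ j)^-1 : R) `^ p < eta / 2 / D.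
  have hnear : \forall j \near \oo, ((4 ^+ j)^-1 : R) `^ p < eta / 2 / D.
    by apply: (cvgr_lt (0:R) (cvg_powR_rate p1)); rewrite !divr_gt0.
  by have [j] := filter_ex hnear; exists j.
have hj' : (c + c * c) * (K * ((4 ^+ j)^-1) `^ p) <= eta / 2.
  apply: (@le_trans _ _ (D * ((4 ^+ j)^-1) `^ p)).
    by rewrite mulrA ler_wpM2r ?powR_ge0// lerDl.
  by move: hj; rewrite ltr_pdivlMr// mulrC => /ltW.
pose b (l : nat) (x : V) := `|f (k l) j x - G j x| `^ p * \1_(cube 0 S) x.
have mb l : measurable_fun setT (b l).
  exact: (measurable_funM (measurable_powR_norm p (measurable_funB (mf (k l) j) (mG j))) mI).
have b0 l x : 0 <= b l x by rewrite mulr_ge0 ?powR_ge0//; have /andP[] := I01 x.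
have cb : (\int[leb]_x (b l x)%:E @[l --> \oo] --> 0%:E)%E.
  rewrite -[X in _ --> X](integral0 leb setT).
  apply: (@dominated_cvg _ _ _ leb setT measurableT (fun l x => (b l x)%:E) _
    (fun x => ((2 * A j) `^ p * \1_(cube 0 S) x)%:E)) => //.
  - by move=> l; apply/measurable_EFinP.
  - move=> x _; apply/fine_cvgP; split; first exact: nearW.
    rewrite -[X in _ --> X](mul0r (\1_(cube 0 S) x)); apply: cvgM; last exact: cvg_cst.
    have := @cvg_powR_norm R (fun l => f (k l) j x - G j x) 0 p p0.
    rewrite normr0 powR0 ?gt_eqF//; apply; rewrite -(subrr (G j x)).
    by apply: cvgB; [exact: fG|exact: cvg_cst].
  - apply/integrableP; split.
      by apply/measurable_EFinP; exact: measurable_funM.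
    under eq_integral do rewrite gee0_abs ?lee_fin ?mulr_ge0 ?powR_ge0//.
    rewrite int_indic ?powR_ge0//; last exact: measurable_cube.
    have S1 : cube (0 : V) S `<=` cube 0 `|S| by apply: cubeW; exact: ler_norm.
    apply: (@le_lt_trans _ _ (((2 * A j) `^ p)%:E * leb (cube 0 `|S|))%E).
      apply: lee_wpmul2l; first by rewrite lee_fin powR_ge0.
      by apply: le_measure => //; rewrite inE; exact: measurable_cube.
    by rewrite leb_cube// -EFinM ltry.
  - move=> l x _ /=; rewrite lee_fin ger0_norm// ler_wpM2r//.
    have h2 : `|f (k l) j x - G j x| <= 2 * A j by apply: (le_trans (ler_normB _ _)); have := fA (k l) j x; have := GA j x; lra.
    by apply: ge0_ler_powR; rewrite ?nnegrE ?(ltW p0)// (le_trans _ h2).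
have cc0 : 0 < eta / 2 / (c * c) by rewrite !divr_gt0// mulr_gt0.
have /fine_cvgP[hfin hcv] := cb.
have hs : \forall l \near \oo, fine (\int[leb]_x (b l x)%:E) < eta / 2 / (c * c).
  exact: (cvgr_lt (0:R) hcv).
apply: filterS2 hfin hs => l hl1 hl2.
have hb : (\int[leb]_x (b l x)%:E <= (eta / 2 / (c * c))%:E)%E by rewrite -(fineK hl1) lee_fin ltW.
have [_ hu] := molj_ae p1 (En (k l)) M0.
pose F1 (x : V) := `|f (k l) j x - u (k l) x| `^ p.
pose F3 (x : V) := `|G j x - v x| `^ p.
have mF1 : measurable_fun setT F1 by exact: (measurable_powR_norm p (measurable_funB (mf (k l) j) (mu (k l)))).
have mF3 : measurable_fun setT F3 by exact: (measurable_powR_norm p (measurable_funB (mG j) mv)).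
have F10 x : 0 <= F1 x by exact: powR_ge0.
have F30 x : 0 <= F3 x by exact: powR_ge0.
have cc : 0 <= c * c by rewrite mulr_ge0// ltW.
have m13 : measurable_fun setT (fun x => c * F1 x + (c * c) * F3 x).
  by apply: measurable_funD; exact: measurable_funM.
have n13 x : 0 <= c * F1 x + (c * c) * F3 x by rewrite addr_ge0// mulr_ge0// ltW.
have mcb : measurable_fun setT (fun x => (c * c) * b l x) by exact: measurable_funM.
have ncb x : 0 <= (c * c) * b l x by exact: mulr_ge0.
apply: (@le_trans _ _ (\int[leb]_x ((c * F1 x + (c * c) * F3 x) + (c * c) * b l x)%:E)%E).
  apply: le_int.
  - exact: (measurable_funM (measurable_powR_norm p (measurable_funB (mu (k l)) mv)) mI).
  - exact: measurable_funD.
  - by move=> x; rewrite mulr_ge0 ?powR_ge0//; have /andP[] := I01 x.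
  move=> x; rewrite /b indicE; case: (_ \in _); rewrite ?mulr1 ?mulr0 ?addr0//.
  have h1 := @powR_add_le R p (u (k l) x - f (k l) j x) (f (k l) j x - v x) (ltW p0).
  have h2 := @powR_add_le R p (f (k l) j x - G j x) (G j x - v x) (ltW p0).
  rewrite -/c (distrC (u (k l) x)) in h1; rewrite -/c in h2.
  rewrite (_ : u (k l) x - f (k l) j x + (f (k l) j x - v x) = u (k l) x - v x) in h1; last by ring.
  rewrite (_ : f (k l) j x - G j x + (G j x - v x) = f (k l) j x - v x) in h2; last by ring.
  apply: (le_trans h1); have h3 := ler_wpM2l (ltW c0) h2.
  move: h3; rewrite /F1 /F3 mulrDr -mulrA !mulrDr; lra.
rewrite (intD leb m13 mcb n13 ncb) (intZ leb (mb l) (b0 l) cc).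
rewrite (intD leb (measurable_funM (measurable_cst c) mF1) (measurable_funM (measurable_cst (c * c)) mF3)); last 2 first.
- by move=> x; rewrite mulr_ge0// ltW.
- by move=> x; exact: mulr_ge0.
rewrite (intZ leb mF1 F10 (ltW c0)) (intZ leb mF3 F30 cc).
have hu' : (\int[leb]_x (F1 x)%:E <= (K * ((4 ^+ j)^-1) `^ p)%:E)%E by exact: hu.
have hc1 : (0 <= c%:E)%E by rewrite lee_fin ltW.
have hc2 : (0 <= (c * c)%:E)%E by rewrite lee_fin.
apply: (le_trans (leeD (leeD (lee_wpmul2l hc1 hu') (lee_wpmul2l hc2 (vC j))) (lee_wpmul2l hc2 hb))).
rewrite -!EFinM -!EFinD lee_fin [X in _ + _ + X]mulrC divfK ?gt_eqF ?mulr_gt0//.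
move: hj'; rewrite mulrDl; lra.
Qed.

Lemma limit_in_wL : wL r sigma v.
Proof.
have [_ hA] := limit_bound p0 (measurable_enorm_powR (- p)) (fun x => powR_ge0 _ _)
  (fun n j => let: And4 _ a _ _ := tm n j in a).
have [_ hB] := limit_bound q0 (measurable_enorm_powR (- (2 * q))) (fun x => powR_ge0 _ _)
  (fun n j => let: And4 _ _ b _ := tm n j in b).
split => //; rewrite /wLnorm; apply: poweR_lty.
exact: le_lt_trans (int_interpolation p1 q1 sp sq mv ltr01 hA hB) (ltry _).
Qed.

(** On the tail both functions are small by [tails]. On the remaining annulus the difference is
    interpolated with [Z] large: as [t < 1] the Rellich part is small, and the Hardy part is a fixed
    constant times a local integral of [|u (k l) - v|^p]. *)
Lemma weighted_convergence (eta : R) : 0 < eta ->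
  \forall l \near \oo, (\int[leb]_x (`|u (k l) x - v x| `^ r * enorm x `^ (- sigma))%:E <= eta%:E)%E.
Proof.
move=> eta0.
have c0 : 0 < 2 `^ r :> R by rewrite powR_gt0.
have e10 : 0 < eta / 6 / 2 `^ r by rewrite !divr_gt0.
(* Three contributions of [eta / 3]. The tail counts both functions, hence [eta / 6], and [2 ^ r] is
   the constant of [powR_add_le]. *)
have [rho /andP[rho0 rho1] tl] := tails p1 pN q1 pq sp sq crit C0 e10.
pose wt (x : V) : R := enorm x `^ (- sigma) * \1_(tail rho) x.
have mwt : measurable_fun setT wt.
  by apply: (measurable_funM (measurable_enorm_powR _)); apply: measurable_indic; exact: measurable_tail.
have wt0 x : 0 <= wt x by rewrite mulr_ge0 ?powR_ge0.
have [tu tv] := limit_bound r0 mwt wt0 (fun n j =>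
  ltac:(by under eq_integral do rewrite /wt mulrA; exact: tl (tm n j))).
have [bu bv] := limit_bound q0 (measurable_enorm_powR (- (2 * q))) (fun x => powR_ge0 _ _)
  (fun n j => let: And4 _ _ b _ := tm n j in b).
have cq0 : 0 <= 2 `^ q :> R by exact: powR_ge0.
pose B := 2 `^ q * (C + C).
have B0 : 0 <= B by rewrite mulr_ge0// addr_ge0.
have eB0 : 0 < eta / 3 / (B + 1) by rewrite !divr_gt0// ltr_wpDl.
pose Z := (eta / 3 / (B + 1)) `^ (t - 1)^-1.
have Z0 : 0 < Z by rewrite powR_gt0.
have ZB : Z `^ (t - 1) * B <= eta / 3.
  rewrite -powRrM mulVf ?powRr1 ?(ltW eB0)//; last by rewrite subr_eq0 lt_eqF.
  by rewrite mulrAC ler_pdivrMr ?ltr_wpDl// ler_wpM2l ?divr_ge0 ?(ltW eta0)// lerDl.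
pose Q := Z `^ t * rho `^ (- p).
have Q0 : 0 <= Q by rewrite mulr_ge0 ?powR_ge0.
have eQ0 : 0 < eta / 3 / (Q + 1) by rewrite !divr_gt0// ltr_wpDl.
apply: filterS (local_convergence rho^-1 eQ0) => l hl.
have mw := measurable_funB (mu (k l)) mv.
pose T1 (x : V) := `|u (k l) x| `^ r * wt x.
pose T2 (x : V) := `|v x| `^ r * wt x.
pose T3 (x : V) := `|u (k l) x - v x| `^ p * \1_(cube 0 rho^-1) x.
pose T4 (x : V) := `|u (k l) x| `^ q * enorm x `^ (- (2 * q)).
pose T5 (x : V) := `|v x| `^ q * enorm x `^ (- (2 * q)).
have mT1 : measurable_fun setT T1 by exact: (measurable_funM (measurable_powR_norm r (mu (k l))) mwt).
have mT2 : measurable_fun setT T2 by exact: (measurable_funM (measurable_powR_norm r mv) mwt).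
have mT3 : measurable_fun setT T3.
  by apply: (measurable_funM (measurable_powR_norm p mw)); apply: measurable_indic; exact: measurable_cube.
have mT4 : measurable_fun setT T4 by exact: measurable_weighted.
have mT5 : measurable_fun setT T5 by exact: measurable_weighted.
have T10 x : 0 <= T1 x by rewrite mulr_ge0 ?powR_ge0.
have T20 x : 0 <= T2 x by rewrite mulr_ge0 ?powR_ge0.
have T30 x : 0 <= T3 x by rewrite mulr_ge0 ?powR_ge0.
have T40 x : 0 <= T4 x by rewrite mulr_ge0 ?powR_ge0.
have T50 x : 0 <= T5 x by rewrite mulr_ge0 ?powR_ge0.
have m12 : measurable_fun setT (fun x => T1 x + T2 x) by exact: measurable_funD.
have m45 : measurable_fun setT (fun x => T4 x + T5 x) by exact: measurable_funD.
have n12 x : 0 <= T1 x + T2 x by exact: addr_ge0.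
have n45 x : 0 <= T4 x + T5 x by exact: addr_ge0.
pose k4 := Z `^ (t - 1) * 2 `^ q.
have k40 : 0 <= k4 by rewrite mulr_ge0 ?powR_ge0.
have ma : measurable_fun setT (fun x => 2 `^ r * (T1 x + T2 x)) by exact: measurable_funM.
have mbb : measurable_fun setT (fun x => Q * T3 x) by exact: measurable_funM.
have mc : measurable_fun setT (fun x => k4 * (T4 x + T5 x)) by exact: measurable_funM.
have na x : 0 <= 2 `^ r * (T1 x + T2 x) by rewrite mulr_ge0 ?powR_ge0.
have nb x : 0 <= Q * T3 x by exact: mulr_ge0.
have nc x : 0 <= k4 * (T4 x + T5 x) by exact: mulr_ge0.
apply: (@le_trans _ _ (\int[leb]_x (2 `^ r * (T1 x + T2 x) + (Q * T3 x + k4 * (T4 x + T5 x)))%:E)%E).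
  apply: le_int.
  - exact: (measurable_weighted r (- sigma) mw).
  - by apply: measurable_funD => //; exact: measurable_funD.
  - by move=> x; rewrite mulr_ge0 ?powR_ge0.
  move=> x; have s0 : 0 <= enorm x `^ (- sigma) by exact: powR_ge0.
  have [xt|xt] := pselect (tail rho x).
    apply: (@le_trans _ _ (2 `^ r * (T1 x + T2 x))); last by rewrite lerDl addr_ge0.
    rewrite /T1 /T2 /wt indicE mem_set// mulr1 -mulrDl mulrA ler_wpM2r//.
    by have := @powR_add_le R r (u (k l) x) (- v x) (ltW r0); rewrite normrN.
  apply: (@le_trans _ _ (Q * T3 x + k4 * (T4 x + T5 x))); last by rewrite lerDr.
  have xr : rho <= enorm x by rewrite leNgt; apply/negP => h1; apply: xt; left.
  have xR : enorm x <= rho^-1 by rewrite leNgt; apply/negP => h1; apply: xt; right.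
  apply: (le_trans (interpolation p1 q1 sp sq (normr_ge0 _) (enorm_ge0 x) Z0)); rewrite -/t; apply: lerD.
    rewrite /Q /T3 indicE mem_set ?mulr1; last by apply: enorm_cube; rewrite ?invr_ge0 ?(ltW rho0).
    rewrite -mulrA ler_wpM2l ?powR_ge0// mulrC ler_wpM2r ?powR_ge0//.
    rewrite !powRN lef_pV2 ?posrE ?powR_gt0//; last exact: lt_le_trans xr.
    by apply: ge0_ler_powR; rewrite ?nnegrE ?enorm_ge0 ?(ltW p0) ?(ltW rho0).
  rewrite /k4 /T4 /T5 -mulrDl -mulrA ler_wpM2l ?powR_ge0// mulrA ler_wpM2r ?powR_ge0//.
  by have := @powR_add_le R q (u (k l) x) (- v x) (ltW q0); rewrite normrN.
rewrite (intD leb ma (measurable_funD mbb mc) na (fun x => addr_ge0 (nb x) (nc x))).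
rewrite (intD leb mbb mc nb nc) (intZ leb m12 n12 (ltW c0)) (intZ leb mT3 T30 Q0) (intZ leb m45 n45 k40).
rewrite (intD leb mT1 mT2 T10 T20) (intD leb mT4 mT5 T40 T50).
have hc1 : (0 <= (2 `^ r)%:E :> \bar R)%E by rewrite lee_fin ltW.
have hQ : (0 <= Q%:E)%E by rewrite lee_fin.
have hk4 : (0 <= k4%:E)%E by rewrite lee_fin.
apply: (le_trans (leeD (lee_wpmul2l hc1 (leeD (tu (k l)) tv))
  (leeD (lee_wpmul2l hQ hl) (lee_wpmul2l hk4 (leeD (bu (k l)) bv))))).
have e0 a0 a1 a2 a3 a4 a5 a6 : (a0%:E * (a1%:E + a2%:E) + (a3%:E * a4%:E + a5%:E * (a6%:E + a6%:E)))%E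
    = (a0 * (a1 + a2) + (a3 * a4 + a5 * (a6 + a6)))%:E :> \bar R by [].
rewrite e0 lee_fin.
have e1 : 2 `^ r * (eta / 6 / 2 `^ r + eta / 6 / 2 `^ r) = eta / 3.
  by rewrite mulrDr mulrC divfK ?gt_eqF//; field.
have e2 : Q * (eta / 3 / (Q + 1)) <= eta / 3.
  by rewrite mulrA ler_pdivrMr ?ltr_wpDl// mulrC ler_wpM2l ?divr_ge0 ?(ltW eta0)// lerDl.
have e3 : k4 * (C + C) <= eta / 3 by rewrite /k4 -mulrA.
rewrite e1; lra.
Qed.

End limit.

End bounded_sequence.

Lemma W_compact (u_ : nat -> V -> R) : (forall n, W p q (u_ n)) ->
  (exists M : R, forall n, (Wnorm p q (u_ n) <= M%:E)%E) ->
  exists k : nat -> nat, {homo k : m n / (m < n)%N} /\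
    exists2 v, wL r sigma v & wLnorm r sigma (u_ (k n) \- v) @[n --> \oo] --> 0%E.
Proof.
move=> Wu [M uM].
pose M' := `|M| + 1; have M'0 : 0 <= M' by rewrite addr_ge0.
have uM' n : (Wnorm p q (u_ n) <= M'%:E)%E.
  by apply: (le_trans (uM n)); rewrite lee_fin /M' (le_trans (ler_norm M))// lerDl.
have En n := W_energy p1 pN q1 qN (Wu n) M'0 (uM' n).
have M10 : 0 <= N%:R * M' `^ p by rewrite mulr_ge0 ?powR_ge0.
have [C C0 tm] := molj_tame p1 pN q1 qN M10 (powR_ge0 M' q).
have tm' n j := tm _ _ _ (En n) j.
have [k [hk [G [v [fG mG mv Gv vC]]]]] := bounded_sequence_limit M10 En.
exists k; split => //; exists v; first exact: (limit_in_wL M10 En tm' fG mG mv Gv).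
have small (e : R) : 0 < e -> \forall n \near \oo, (wLnorm r sigma (u_ (k n) \- v)%R <= e%:E)%E.
  move=> e0; have er0 : 0 < e `^ r by rewrite powR_gt0.
  apply: filterS (weighted_convergence M10 C0 En tm' fG mG mv Gv vC er0) => n hn.
  have -> : e = (e `^ r) `^ r^-1 by rewrite -powRrM divff ?gt_eqF// powRr1// ltW.
  rewrite -poweR_EFin /wLnorm; apply: le_poweR => //; first by rewrite invr_ge0 ltW.
  by apply: integral_ge0 => x _; rewrite lee_fin mulr_ge0 ?powR_ge0.
have nn n : (0 <= wLnorm r sigma (u_ (k n) \- v)%R)%E by exact: poweR_ge0.
apply/fine_cvgP; split.
  by apply: filterS (small 1 ltr01) => n hn; rewrite ge0_fin_numE// (le_lt_trans hn (ltry _)).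
apply/cvgrPdist_le => e e0; apply: filterS (small e e0) => n hn /=.
rewrite sub0r normrN ger0_norm ?fine_ge0//.
by rewrite -lee_fin fineK// ge0_fin_numE// (le_lt_trans hn (ltry _)).
Qed.

End compactness.

(** * The embedding theorem *)

Theorem corollary2p5 (R : realType) (N : nat) (p q sigma : R)
    (q_gt1 : 1 < q) (q_ltN2 : q < N%:R / 2)
    (p_gt1 : 1 < p) (p_lt : p < sobolev1 N q)
    (p_neq_q : p <> q) (q_neq : q <> sobolev1 N p)
    (sigma_gt : p < sigma) (sigma_lt : sigma < 2 * q) :
  let r := (p * q + sigma * (q - p)) / (2 * q - p) in
  [/\ 1 <= r,
      hardy_sobolev1 N sigma p < r < hardy_sobolev2 N sigma q
    & compact_embedding (@W R N p q) (Wnorm p q) (wL r sigma) (wLnorm r sigma)].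
Proof.
have qN : 2 * q < N%:R by rewrite mulrC -ltr_pdivlMr.
have q0 : 0 < q by exact: lt_trans ltr01 q_gt1.
have qN1 : 0 < N%:R - q by rewrite subr_gt0; move: qN; lra.
(* The hypothesis [p_lt] with its denominator cleared, the form in which all exponent comparisons
   use it. *)
have crit : N%:R * (p - q) < p * q.
  move: p_lt; rewrite /sobolev1 ltr_pdivlMr// -subr_gt0 => h.
  rewrite -subr_gt0; have -> : p * q - N%:R * (p - q) = N%:R * q - p * (N%:R - q) by ring.
  exact: h.
(* [sobolev1 N q] is below [N] because [2 * q < N]. *)
have pN : p < N%:R.
  apply: (lt_trans p_lt); rewrite /sobolev1 ltr_pdivrMr// ltr_pM2l; last by move: qN1; lra.
  by move: qN; lra.
split.
- exact: critical_r_ge1.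
- exact: critical_r_bounds.
split.
- exact: W_sub_wL.
- exact: W_wLnorm_bound.
- by move=> u_ Wu uM; exact: W_compact.
Qed.
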